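(* Let $A\subseteq \{1,2,\dots, N\}$ be a set of size $\alpha N$ and let $a_1 x_1 + a_2 x_2 + \cdots +a_k x_k =0$ be an invariant equation in $k\geq 4$ variables. Then there is a large constant $C$ (independent of $N$ and $A$) such that there are at least \[\exp\bigl(-C\log^7(2/\alpha)\bigr)N^{k-1}\] solutions to the equation, that is, tuples $(x_1,\dots,x_k)\in A^k$ with $a_1x_1+\cdots+a_kx_k=0$.
   Context: A linear equation $a_1x_1+\cdots+a_kx_k=0$ with coefficients $a_i\in\mathbb{Z}$ is called invariant if $a_1+a_2+\cdots+a_k=0$. *)

(* Defs.v *)
From mathcomp Require Import all_boot all_order all_algebra.
From Stdlib Require Import Reals.
Set Implicit Arguments. Unset Strict Implicit. Unset Printing Implicit Defensive.
Import GRing.Theory Num.Theory.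

Definition invariant_eq (k : nat) (a : 'I_k -> int) : Prop :=
  @GRing.zero int = \big[@GRing.add int/GRing.zero]_(i < k) a i.

(* Elements of {1,...,N} are represented as ordinals of 'I_(N.+1) with value
   >= 1; a subset A of {1,...,N} is a set A : {set 'I_N.+1} with 0 \notin A. *)
Definition subset_1N (N : nat) (A : {set 'I_N.+1}) : Prop :=
  forall x : 'I_N.+1, x \in A -> (0 < x)%N.

Definition nsol (k : nat) (a : 'I_k -> int) (N : nat) (A : {set 'I_N.+1}) : nat :=
  #|[set x : {ffun 'I_k -> 'I_N.+1} |
      [forall i, x i \in A] && (\big[@GRing.add int/GRing.zero]_(i < k) (GRing.mul (a i) (Posz (nat_of_ord (x i)))) == GRing.zero)]|.

(* Main.v *)
Require Import Defs.
From mathcomp Require Import all_boot all_order all_algebra.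
From mathcomp Require Import cyclic separable cyclotomic boolp reals complex Rstruct.
From mathcomp Require Import lra ring zify.
From mathcomp.analysis Require Import sequences exp.
Set Implicit Arguments. Unset Strict Implicit. Unset Printing Implicit Defensive.
Import Order.TTheory GRing.Theory Num.Theory.
Local Open Scope ring_scope.

(** The proof is a density increment over regular Bohr sets of [Z/M], with [M]
congruent to 1 modulo the product of the coefficients, so that every [a i] is
invertible. Writing [x_i = y + q_i b_i] with [a_i q_i] independent of [i] turns
the equation into [b_1 + ... + b_k = 0], where [b_i] lies in a set [A_i] of
density about alpha in a Bohr set.

If [A_1] has no density increment on a translate of a smaller Bohr set, then
[b_1 + b_2] is nearly uniformly distributed: for every subset [L] of the Bohr
set [B] it hits [L] with probability at least [|L| / |B| - 1 / 8]. Indeed the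
function [w |-> P(b_1 + b_2 + w \in L)] has, by random sampling from [A_2]
(Croot and Sisask), a set [T] of almost periods of density
[exp (- O (log^4 (1 / alpha)))]. Iterating the averages over [T - T] leaves only
the large spectrum of [T], which Chang's theorem controls by [O (log^4)]
frequencies; so the function is almost invariant under a Bohr set [V] of rank
larger by [O (log^4)], and without an increment [b_1 + v] is nearly uniform on [B].
Applying this to [(A_1, A_2)] and [(A_3, A_4)] shows that most elements of [B]
are popular sums of both pairs, hence there are many solutions.

Each increment multiplies the density by a constant, so there are [O (log)] of
them. The final rank is [O (log^5)], the final radius [exp (- O (log^2))], and
the final Bohr set has density [exp (- O (log^7))]. *)

(** * Concentration of sampled averages *)

(** Four variables are needed because the argument pairs two sums: each pair hits every set with the
    right probability up to 1/8, so popular values fill more than half of [B] and the two families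
    must meet. Within a pair the second set lives in a much narrower Bohr set than the first, so
    that adding its elements hardly leaves the wide one.

    The fourth power of the logarithm arises as follows. Killing the small spectrum down to a
    fraction of alpha takes about log rounds of averaging; each round costs an error of order [t],
    so [t] is about 1 / log. Sampling to accuracy [t] with exceptional set below [alpha * t] takes
    about [t ^- 2 * log], that is log cubed, samples, and each sample costs a factor alpha in the
    density of [T].

    Regularity creates a circularity: the relative width [kappa] must be small against the logarithm
    of the size loss of the smallest Bohr set, and this loss depends on [kappa]. It does so only
    linearly in [log (1 / kappa)], so a [kappa] that is a power of alpha suffices. *)

Definition avg (F : fieldType) (T : finType) (A : {set T}) (f : T -> F) : F :=
  (\sum_(x in A) f x) / #|A|%:R.

Section Concentration.
Variable R : realType.
Implicit Types (u s : R).

(** As [1 - v <= expR (- v)], it suffices that [(1 + u) * (1 - v) = 1 + u ^+ 2 * (1 + 2 * u)] is at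
    least 1. *)
Lemma expR_sub_sqr_le u : - (1 / 2) <= u -> expR (u - 2 * u ^+ 2) <= 1 + u.
Proof.
move=> hu; set v := u - 2 * u ^+ 2.
have v1 : 0 < 1 - v by rewrite /v; nra.
have h : 1 - v <= expR (- v) by exact: expR_ge1Dx.
have -> : expR v = (expR (- v))^-1 by rewrite expRN invrK.
apply: (@le_trans _ _ (1 - v)^-1).
  by rewrite lef_pV2 // posrE ?expR_gt0.
rewrite -[X in X <= _]mul1r ler_pdivrMr // /v; nra.
Qed.

Variables (T : finType) (A : {set T}).

Lemma prod_one_add_ge (n : nat) (x : 'I_n -> R) s : 0 <= s <= 1 / 2 ->
  (forall j, `|x j| <= 1) ->
  expR (s * (\sum_j x j) - 2 * s ^+ 2 * n%:R) <= \prod_j (1 + s * x j).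
Proof.
move=> /andP[s0 s1] hx.
have -> : s * (\sum_j x j) - 2 * s ^+ 2 * n%:R = \sum_j (s * x j - 2 * s ^+ 2).
  by rewrite sumrB -mulr_sumr sumr_const card_ord mulr_natr.
rewrite expR_sum; apply: ler_prod => j _; rewrite expR_ge0 /=.
have := hx j; rewrite ler_norml => /andP[h1 h2].
apply: le_trans (expR_sub_sqr_le _); last by nra.
rewrite ler_expR; suff : x j ^+ 2 <= 1 by move=> ?; nra.
nra.
Qed.

Lemma sum_ffun_on_prod (n : nat) (F : T -> R) :
  \sum_(y : {ffun 'I_n -> T} | y \in ffun_on (mem A)) \prod_j F (y j) = (\sum_(x in A) F x) ^+ n.
Proof.
by rewrite -[in RHS](card_ord n) -prodr_const bigA_distr_big.
Qed.

(** Chernoff's method with the weight [\prod_j (1 + t / 4 * h (y j))] in place of an exponential: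
    since [h] has mean zero on [A], the weights over [A ^ n] add up to exactly [#|A| ^ n], while on
    the tail each is at least [expR (t / 4 * t * n - 2 * (t / 4) ^ 2 * n) = expR (t ^ 2 * n /
    8)]. *)
Lemma tail_bound_one_sided (n : nat) (h : T -> R) (t : R) :
  0 <= t <= 1 -> (forall x, `|h x| <= 1) -> \sum_(x in A) h x = 0 ->
  #|[set y : {ffun 'I_n -> T} in ffun_on (mem A) | t * n%:R <= \sum_j h (y j)]|%:R
    * expR (t ^+ 2 * n%:R / 8) <= (#|A| ^ n)%:R :> R.
Proof.
move=> /andP[t0 t1] hh h0.
rewrite natrX -(sumr_const (mem A) 1) /=.
have -> : \sum_(x in A) 1 = \sum_(x in A) (1 + t / 4 * h x).
  by rewrite big_split /= -mulr_sumr h0 mulr0 addr0.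
rewrite -sum_ffun_on_prod -sum1_card natr_sum mulr_suml.
rewrite big_mkcond [X in _ <= X]big_mkcond /=; apply: ler_sum => y _.
rewrite inE; case: (y \in _) => //=.
have s4 : 0 <= t / 4 <= 1 / 2 by apply/andP; split; lra.
have P := prod_one_add_ge s4 (fun j => hh (y j)).
case: ifP => hy; last exact: le_trans (expR_ge0 _) P.
apply: le_trans P; rewrite mul1r ler_expR.
have n0 : (0 : R) <= n%:R by rewrite ler0n.
nra.
Qed.

Lemma tail_bound (n : nat) (f : T -> R) (t : R) :
  (0 < #|A|)%N -> 0 <= t <= 1 -> (forall x, 0 <= f x <= 1) ->
  #|[set y : {ffun 'I_n -> T} in ffun_on (mem A) |
      t * n%:R <= `|\sum_j f (y j) - n%:R * avg A f|]|%:R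
    * expR (t ^+ 2 * n%:R / 8) <= 2 * (#|A| ^ n)%:R :> R.
Proof.
move=> A0 ht hf.
have A0' : (0 : R) < #|A|%:R by rewrite ltr0n.
have /andP[m0 m1] : 0 <= avg A f <= 1.
  rewrite /avg; apply/andP; split.
    by rewrite divr_ge0 ?ler0n // sumr_ge0 // => x _; case/andP: (hf x).
  rewrite ler_pdivrMr // mul1r -sumr_const; apply: ler_sum => x _.
  by case/andP: (hf x).
set m := avg A f in m0 m1 *.
have hs : \sum_(x in A) (f x - m) = 0.
  rewrite sumrB sumr_const -[X in _ - X]mulr_natr /m /avg mulfVK ?subrr //.
  by rewrite pnatr_eq0 -lt0n.
have hb x : `|f x - m| <= 1.
  by case/andP: (hf x) => h1 h2; rewrite ler_norml; apply/andP; split; lra.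
have hb' x : `|- (f x - m)| <= 1 by rewrite normrN.
have hs' : \sum_(x in A) - (f x - m) = 0 by rewrite sumrN hs oppr0.
have P1 := @tail_bound_one_sided n (fun x => f x - m) t ht hb hs.
have P2 := @tail_bound_one_sided n (fun x => - (f x - m)) t ht hb' hs'.
apply: le_trans (_ : (#|[set y : {ffun 'I_n -> T} in ffun_on (mem A) |
      (t * n%:R <= \sum_j (f (y j) - m))]|%:R + #|[set y : {ffun 'I_n -> T} in ffun_on (mem A) |
      (t * n%:R <= \sum_j - (f (y j) - m))]|%:R) *
    expR (t ^+ 2 * n%:R / 8) <= _); last by rewrite mulrDl; lra.
rewrite ler_wpM2r ?expR_ge0 // -natrD ler_nat.
apply: leq_trans (leq_card_setU _ _); apply: subset_leq_card.
apply/subsetP => y; rewrite !inE => /andP[-> /=].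
by rewrite sumrN sumrB sumr_const card_ord -(mulr_natl (avg A f)) -ler_normr.
Qed.

End Concentration.

(** * Almost periodicity by random sampling *)

Lemma card_sum_exchange (I J : finType) (P : pred I) (B : I -> {set J}) :
  (\sum_(i | P i) #|B i| = \sum_j #|[set i | P i & j \in B i]|)%N.
Proof.
under eq_bigr do rewrite -sum1_card big_mkcond /=.
rewrite exchange_big /=; apply: eq_bigr => j _.
rewrite -sum1_card -big_mkcondr /=.
by apply: eq_bigl => i; rewrite inE.
Qed.

Lemma pigeonhole_sum (I : finType) (D : {set I}) (f : I -> nat) (m : nat) :
  (0 < #|D|)%N -> (m <= \sum_(i in D) f i)%N ->
  exists2 i, i \in D & (m <= f i * #|D|)%N.
Proof.
move=> D0 hm; apply/exists_inP; apply: contraT.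
rewrite negb_exists_in => /forall_inP H.
have [i0 i0D] := card_gt0P D0.
have : (\sum_(i in D) (f i * #|D|).+1 <= \sum_(i in D) m)%N.
  by apply: leq_sum => i iD; rewrite ltnNge; apply: H.
rewrite sum_nat_const (eq_bigr (fun i => f i * #|D| + 1)%N); last by move=> i _; rewrite addn1.
rewrite big_split /= sum1_card -big_distrl /=.
have := leq_mul hm (leqnn #|D|); lia.
Qed.

Section AlmostPeriodicity.
Variables (R : realType) (G : finComNzRingType).
Implicit Types (A S D X L T : {set G}).

(** A normalised convolution of the indicators of [L] and [- A]; for empty [A] it is 0, because
    [0^-1 = 0]. *)
Definition meas (A L : {set G}) (u : G) : R := avg A (fun y => (u + y \in L)%:R).

Lemma meas_bounds A L u : 0 <= meas A L u <= 1.
Proof.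
rewrite /meas /avg; have [->|A0] := eqVneq #|A| 0%N.
  by rewrite invr0 mulr0 lexx ler01.
have A0' : (0 : R) < #|A|%:R by rewrite ltr0n lt0n.
apply/andP; split; first by rewrite divr_ge0 ?ler0n // sumr_ge0 // => x _; rewrite ler0n.
rewrite ler_pdivrMr // mul1r -sumr_const; apply: ler_sum => x _.
by rewrite lern1 leq_b1.
Qed.

Lemma meas_out A L u : (forall y, y \in A -> u + y \notin L) -> meas A L u = 0.
Proof.
move=> h; rewrite /meas /avg big1 ?mul0r // => y yA.
by rewrite (negbTE (h _ yA)).
Qed.

Section Sampling.
Variables (A S D X L : {set G}) (n : nat) (t : R).
Hypotheses (A0 : (0 < #|A|)%N) (n0 : (0 < n)%N) (t01 : 0 < t <= 1).
Hypothesis hD : forall y s, y \in A -> s \in S -> y + s \in D.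
Hypothesis hX : forall u y, u \notin X -> y \in A -> u + y \notin L.

(** [emp z / n] estimates [meas A L] from the sample [z]. On average there are at most
    [2 * #|X| / E] bad points; allowing twice that in [good] keeps half of all samples, by Markov's
    inequality. *)
Let E : R := expR (t ^+ 2 * n%:R / 8).
Let emp (z : {ffun 'I_n -> G}) u : R := \sum_j (u + z j \in L)%:R.
Let bad z := [set u | t * n%:R <= `|emp z u - n%:R * meas A L u|].
Let good := [set z : {ffun 'I_n -> G} in ffun_on (mem A) | #|bad z|%:R * E <= 4 * #|X|%:R].

Lemma sum_card_bad :
  (\sum_(z : {ffun 'I_n -> G} | z \in ffun_on (mem A)) #|bad z|)%:R * E
    <= 2 * #|X|%:R * (#|A| ^ n)%:R.
Proof.
have t0 : 0 < t by case/andP: t01.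
rewrite card_sum_exchange natr_sum mulr_suml.
(* Outside [X] both the estimate and the true value vanish, so no sample is bad there. *)
rewrite (bigID (mem X)) /= [X in _ + X]big1 ?addr0; last first.
  move=> u uX; apply/eqP; rewrite mulf_eq0; apply/orP; left.
  rewrite pnatr_eq0 cards_eq0; apply/eqP/setP => z; rewrite !inE.
  apply/negbTE/negP => /andP[/ffun_onP zA].
  rewrite meas_out => [|y yA]; last exact: hX.
  rewrite /emp big1 => [|j _]; last by rewrite (negbTE (hX uX (zA j))).
  by rewrite mulr0 subrr normr0 leNgt mulr_gt0 ?ltr0n.
have -> : 2 * #|X|%:R * (#|A| ^ n)%:R = \sum_(u in X) 2 * (#|A| ^ n)%:R :> R.
  by rewrite sumr_const -[RHS]mulr_natl; ring.
apply: ler_sum => u _.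
have ht : 0 <= t <= 1 by case/andP: t01 => h1 h2; rewrite (ltW h1).
have hf x : 0 <= ((u + x \in L)%:R : R) <= 1 by rewrite ler0n lern1 leq_b1.
apply: le_trans (tail_bound n A0 ht hf).
rewrite ler_wpM2r ?expR_ge0 // ler_nat; apply: eq_leq; apply: eq_card => z.
by rewrite !inE.
Qed.

Lemma card_good_ge : (#|A| ^ n <= 2 * #|good|)%N.
Proof.
have cA : #|[set z : {ffun 'I_n -> G} | z \in ffun_on (mem A)]| = (#|A| ^ n)%N.
  by rewrite cardsE card_ffun_on card_ord.
(* Markov's inequality is divided by [#|X|] below; for empty [X] every sample is good. *)
have [X0|X0] := posnP #|X|.
  have -> : #|good| = (#|A| ^ n)%N; last by lia.
  rewrite -cA; apply: eq_card => z; rewrite !in_set.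
  case zA : (z \in ffun_on (mem A)) => //=.
  have -> : bad z = set0.
    apply/setP => u; rewrite !inE; apply/negbTE.
    have uX : u \notin X by rewrite (cards0_eq X0) inE.
    move/ffun_onP: zA => zA.
    rewrite meas_out => [|y yA]; last exact: hX.
    rewrite /emp big1 => [|j _]; last by rewrite (negbTE (hX uX (zA j))).
    by rewrite mulr0 subrr normr0 -ltNge mulr_gt0 ?ltr0n //; case/andP: t01.
  by rewrite cards0 mul0r X0 mulr0 lexx.
have X0' : (0 : R) < #|X|%:R by rewrite ltr0n.
pose ngood := [set z : {ffun 'I_n -> G} in ffun_on (mem A) | 4 * #|X|%:R < #|bad z|%:R * E].
have dis : good :&: ngood = set0.
  apply/setP => z; rewrite !in_set; case: (z \in ffun_on (mem A)) => //=.
  by case: (leP (#|bad z|%:R * E)).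
have cU : (#|good| + #|ngood| = #|A| ^ n)%N.
  rewrite -cA -cardsUI dis cards0 addn0; apply: eq_card => z; rewrite !in_set.
  by case: (z \in ffun_on (mem A)) => //=; case: (leP (#|bad z|%:R * E)).
suff : (2 * #|ngood| <= #|A| ^ n)%N by lia.
have h1 : 4 * #|X|%:R * #|ngood|%:R <= 2 * #|X|%:R * (#|A| ^ n)%:R :> R.
  apply: le_trans sum_card_bad; rewrite natr_sum mulr_suml.
  rewrite mulr_natr -sumr_const big_mkcond [X in _ <= X]big_mkcond /=.
  apply: ler_sum => z _; rewrite inE; case: (z \in ffun_on (mem A)) => //=.
  by case: ifP => [/ltW //|_]; rewrite mulr_ge0 ?ler0n ?expR_ge0.
rewrite -(ler_nat R) natrM; nra.
Qed.

(** The samples [z - s] and [z - s'] have the same points up to a shift, so the estimate of the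
    first at [u + s - s'] equals that of the second at [u]. If both are good, the two values of
    [meas] differ by at most [2 * t] off two bad sets of at most [4 * #|X| / E] points each. *)
Lemma croot_sisask :
  exists T : {set G}, [/\ T \subset S, (#|S| * #|A| ^ n <= 2 * #|T| * #|D| ^ n)%N &
    forall s s', s \in T -> s' \in T ->
      #|[set u | 2 * t < `|meas A L (u + s - s') - meas A L u| ]|%:R * E <= 8 * #|X|%:R].
Proof.
have [y0 y0A] := card_gt0P A0.
have [S0|S0] := posnP #|S|.
  exists set0; split; first exact: sub0set.
    by rewrite S0.
  by move=> s s'; rewrite inE.
have [s0 s0S] := card_gt0P S0.
have D0 : (0 < #|D|)%N by apply/card_gt0P; exists (y0 + s0); apply: hD.
pose DD := [set z : {ffun 'I_n -> G} | z \in ffun_on (mem D)].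
have cD : #|DD| = (#|D| ^ n)%N by rewrite cardsE card_ffun_on card_ord.
pose sh (z : {ffun 'I_n -> G}) s := [ffun j => z j - s] : {ffun 'I_n -> G}.
(* The pairs (good tuple [y] in [A ^ n], [s] in [S]) map injectively to
   (tuple [y + s] in [D ^ n], [s]): some tuple [z] has many [s] with [z - s] good. *)
have : (#|S| * #|good| <= \sum_(z in DD) #|[set s in S | sh z s \in good]|)%N.
  rewrite card_sum_exchange (bigID (mem S)) /=; apply: leq_trans (leq_addr _ _).
  rewrite -sum_nat_const; apply: leq_sum => s sS.
  have inj : injective (fun y : {ffun 'I_n -> G} => [ffun j => y j + s] : {ffun 'I_n -> G}).
    move=> y y' /ffunP H; apply/ffunP => j; have := H j; rewrite !ffunE.
    exact: addIr.
  rewrite -(card_imset good inj); apply: subset_leq_card; apply/subsetP => z.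
  case/imsetP => y yg ->; rewrite !inE sS /=; apply/andP; split.
    apply/ffun_onP => j; rewrite ffunE; apply: hD => //.
    by move: yg; rewrite inE => /andP[/ffun_onP].
  have -> : sh [ffun j => y j + s] s = y.
    by apply/ffunP => j; rewrite !ffunE addrK.
  by move: yg; rewrite inE.
case/pigeonhole_sum; first by rewrite cD expn_gt0 D0.
move=> z zD; rewrite cD => hz.
set T := [set s in S | sh z s \in good] in hz; exists T; split.
- by apply/subsetP => s; rewrite inE => /andP[].
- have := card_good_ge; move: hz; set a := (#|D| ^ n)%N; set b := (#|A| ^ n)%N.
  by move=> h1 h2; have := leq_mul (leqnn #|S|) h2; lia.
move=> s s' sT s'T.
have n0' : (0 : R) < n%:R by rewrite ltr0n.
have hg w : w \in T -> #|bad (sh z w)|%:R * E <= 4 * #|X|%:R.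
  by rewrite inE => /andP[_]; rewrite inE => /andP[].
apply: le_trans (_ : (#|bad (sh z s)|%:R + #|bad (sh z s')|%:R) * E <= _); last first.
  by rewrite mulrDl; have := hg _ sT; have := hg _ s'T; lra.
rewrite ler_wpM2r ?expR_ge0 // -natrD ler_nat.
rewrite -(card_imset (bad (sh z s)) (addIr (s' - s))).
apply: leq_trans (leq_card_setU _ _); apply: subset_leq_card.
apply/subsetP => u; rewrite 2!inE; apply: contraLR; rewrite negb_or => /andP[b1 b2].
have b1' : u + s - s' \notin bad (sh z s).
  apply: contra b1 => b1; apply/imsetP; exists (u + s - s') => //.
  ring.
move: b1' b2; rewrite !inE -!ltNge.
have -> : emp (sh z s) (u + s - s') = emp (sh z s') u.
  rewrite /emp; apply: eq_bigr => j _; rewrite !ffunE; congr (_ \in L)%:R.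
  ring.
set e := emp _ _; set m1 := meas _ _ _; set m2 := meas _ _ _.
rewrite !ltr_norml => /andP[h1 h2] /andP[h3 h4].
rewrite -leNgt ler_norml; apply/andP; split; rewrite -(ler_pM2r n0'); nra.
Qed.

End Sampling.
End AlmostPeriodicity.

(** * Fourier analysis *)

Section Average.
Variables (F : fieldType) (T : finType).
Implicit Types (A : {set T}) (f g : T -> F).

Lemma avgB A f g : avg A (fun x => f x - g x) = avg A f - avg A g.
Proof. by rewrite /avg sumrB mulrBl. Qed.

Lemma avgMr A f c : avg A (fun x => f x * c) = avg A f * c.
Proof. by rewrite /avg -mulr_suml mulrAC. Qed.

Lemma eq_avg A f g : (forall x, x \in A -> f x = g x) -> avg A f = avg A g.
Proof. by move=> h; rewrite /avg (eq_bigr _ h). Qed.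

End Average.

Lemma avg_const (F : numFieldType) (T : finType) (A : {set T}) (c : F) :
  (0 < #|A|)%N -> avg A (fun=> c) = c.
Proof.
move=> A0; rewrite /avg sumr_const -[c *+ _]mulr_natr mulfK //.
by rewrite pnatr_eq0 -lt0n.
Qed.

Lemma ler_avg (F : numFieldType) (T : finType) (A : {set T}) (f g : T -> F) :
  (forall x, x \in A -> f x <= g x) -> avg A f <= avg A g.
Proof.
by move=> h; rewrite /avg ler_wpM2r ?invr_ge0 ?ler0n // ler_sum.
Qed.

Section ComplexModulus.
Variable R : rcfType.
Implicit Types (z w : R[i]) (x : R).

(** The norm [|z|] is an element of [R[i]]; this version takes values in [R], where the order is
    total. *)
Definition cabs z : R := ComplexField.Normc.normc z.

Lemma cabsE z : (cabs z)%:C%C = `|z|.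
Proof. by []. Qed.

Lemma cabsM z w : cabs (z * w) = cabs z * cabs w.
Proof. exact: ComplexField.Normc.normcM. Qed.

Lemma cabsD z w : cabs (z + w) <= cabs z + cabs w.
Proof. exact: le_normcD. Qed.

Lemma cabsN z : cabs (- z) = cabs z.
Proof. exact: normcN. Qed.

Lemma cabs_ge0 z : 0 <= cabs z.
Proof. by case: z => a b; rewrite sqrtr_ge0. Qed.

Lemma cabs0 : cabs 0 = 0.
Proof. exact: ComplexField.Normc.normc0. Qed.

Lemma cabs1 : cabs 1 = 1.
Proof. exact: ComplexField.Normc.normc1. Qed.

Lemma cabs_real x : cabs x%:C%C = `|x|.
Proof. by rewrite /cabs /= expr0n addr0 sqrtr_sqr. Qed.

Lemma cabs_nat n : cabs n%:R = n%:R.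
Proof. by rewrite -(rmorph_nat (real_complex R)) cabs_real ger0_norm ?ler0n. Qed.

Lemma cabsX z n : cabs (z ^+ n) = cabs z ^+ n.
Proof. by elim: n => [|n IH]; rewrite ?expr0 ?cabs1 // !exprS cabsM IH. Qed.

Lemma cabs_sum (I : Type) (r : seq I) (P : pred I) (f : I -> R[i]) :
  cabs (\sum_(i <- r | P i) f i) <= \sum_(i <- r | P i) cabs (f i).
Proof.
elim/big_rec2: _ => [|i x y _ h]; first by rewrite cabs0.
by apply: le_trans (cabsD _ _) _; rewrite lerD2l.
Qed.

Lemma cabs_sqr z : (cabs z ^+ 2)%:C%C = z * conjc z.
Proof.
case: z => a b; rewrite /cabs /= sqr_sqrtr ?addr_ge0 ?sqr_ge0 //.
by apply/eqP; rewrite eq_complex /=; apply/andP; split; apply/eqP; ring.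
Qed.

Lemma cabsJ z : cabs (conjc z) = cabs z.
Proof. by case: z => a b; rewrite /cabs /= sqrrN. Qed.

Lemma Re_le_cabs z : complex.Re z <= cabs z.
Proof.
case: z => a b /=; apply: le_trans (ler_norm _) _.
by rewrite -sqrtr_sqr ler_sqrt ?addr_ge0 ?sqr_ge0 // lerDl sqr_ge0.
Qed.

Lemma cabs_le_Re_Im z : cabs z <= `|complex.Re z| + `|complex.Im z|.
Proof.
case: z => a b /=; rewrite -[X in _ <= X]ger0_norm ?addr_ge0 //.
rewrite -[X in _ <= X]sqrtr_sqr ler_sqrt ?sqr_ge0 // -(real_normK (num_real a)) -(real_normK (num_real b)).
have := normr_ge0 a; have := normr_ge0 b; nra.
Qed.

Lemma cabsV z : cabs z^-1 = (cabs z)^-1.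
Proof. exact: ComplexField.Normc.normcV. Qed.

Lemma cabs_avg (T : finType) (A : {set T}) (f : T -> R[i]) :
  cabs (avg A f) <= avg A (fun t => cabs (f t)).
Proof.
rewrite /avg cabsM cabsV cabs_nat.
by rewrite ler_wpM2r ?invr_ge0 ?ler0n //; apply: cabs_sum.
Qed.

End ComplexModulus.

(** A generating character: orthogonality makes the maps [x |-> e (r * x)] the full dual group, so
    that frequencies are ring elements too and frequency and point play symmetric roles. *)
Definition additive_char (R : rcfType) (G : finComNzRingType) (e : G -> R[i]) :=
  [/\ forall x y, e (x + y) = e x * e y, forall x, cabs (e x) = 1 &
      forall x, \sum_r e (r * x) = if x == 0 then #|G|%:R else 0].

Section Fourier.
Variables (R : rcfType) (G : finComNzRingType) (e : G -> R[i]).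
Hypothesis He : additive_char e.
Implicit Types (f g c : G -> R[i]) (A S T V : {set G}) (r x y : G).

Lemma charD x y : e (x + y) = e x * e y. Proof. by case: He. Qed.

Lemma cabs_char x : cabs (e x) = 1. Proof. by case: He. Qed.

Lemma char_orthogonality x : \sum_r e (r * x) = if x == 0 then #|G|%:R else 0.
Proof. by case: He. Qed.

Lemma charJ_mul x : e x * conjc (e x) = 1.
Proof. by rewrite -cabs_sqr cabs_char expr1n. Qed.

Lemma char0 : e 0 = 1.
Proof.
have e0 : e 0 != 0.
  by apply/eqP => h; have := cabs_char 0; rewrite h cabs0 => /eqP; rewrite eq_sym oner_eq0.
by apply: (mulfI e0); rewrite -charD addr0 mulr1.
Qed.

Lemma charN x : e (- x) = conjc (e x).
Proof.
have e0 : e x != 0.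
  by apply/eqP => h; have := cabs_char x; rewrite h cabs0 => /eqP; rewrite eq_sym oner_eq0.
by apply: (mulfI e0); rewrite -charD subrr char0 charJ_mul.
Qed.

Lemma conjc_sum (I : Type) (s : seq I) (P : pred I) (h : I -> R[i]) :
  conjc (\sum_(i <- s | P i) h i) = \sum_(i <- s | P i) conjc (h i).
Proof. exact: raddf_sum. Qed.

Lemma conjcM (z w : R[i]) : conjc (z * w) = conjc z * conjc w.
Proof. exact: rmorphM. Qed.

Definition fourier f r := \sum_x f x * e (r * x).

Lemma fourier_inversion0 f : \sum_r fourier f r = #|G|%:R * f 0.
Proof.
rewrite /fourier exchange_big /= (bigD1 0) //= [X in _ + X]big1 => [|x x0].
  by rewrite -mulr_sumr char_orthogonality eqxx addr0 mulrC.
by rewrite -mulr_sumr char_orthogonality (negbTE x0) mulr0.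
Qed.

Lemma parseval f : \sum_r cabs (fourier f r) ^+ 2 = #|G|%:R * \sum_x cabs (f x) ^+ 2.
Proof.
apply: (@complexI R); rewrite rmorphM rmorph_nat !rmorph_sum /=.
under eq_bigr do rewrite cabs_sqr /fourier conjc_sum big_distrlr /=.
rewrite exchange_big /= mulr_sumr; apply: eq_bigr => x _.
rewrite exchange_big /= (bigD1 x) //= [X in _ + X]big1 => [|y xy].
  rewrite addr0 cabs_sqr -sum1_card natr_sum mulr_suml; apply: eq_bigr => r _.
  by rewrite conjcM mulrACA charJ_mul mulr1 mul1r.
rewrite (eq_bigr (fun r => f x * conjc (f y) * e (r * (x - y)))) => [|r _].
  by rewrite -mulr_sumr char_orthogonality subr_eq0 eq_sym (negbTE xy) mulr0.
by rewrite conjcM mulrACA -charN -charD mulrBr.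
Qed.

Lemma fourier_shift f t r : fourier (fun w => f (w + t)) r = e (- (r * t)) * fourier f r.
Proof.
rewrite /fourier (reindex_inj (addIr (- t))) /= mulr_sumr; apply: eq_bigr => x _.
by rewrite subrK mulrBr charD; ring.
Qed.

Lemma fourier_avg (T : finType) (A : {set T}) (f : T -> G -> R[i]) r :
  fourier (fun w => avg A (fun t => f t w)) r = avg A (fun t => fourier (f t) r).
Proof.
rewrite /fourier /avg exchange_big /= mulr_suml; apply: eq_bigr => x _.
by rewrite mulrAC -mulr_suml.
Qed.

Definition char_mean A r : R[i] := avg A (fun x => e (r * x)).

Lemma conj_char_mean A r : conjc (char_mean A r) = avg A (fun x => e (- (r * x))).
Proof.
rewrite /char_mean /avg conjcM conjc_sum conjc_inv conjc_nat.
by congr (_ / _); apply: eq_bigr => x _; rewrite charN.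
Qed.

Definition shift_avg A f w := avg A (fun v => f (w + v)).
(** Averaging over differences has the real nonnegative Fourier multiplier
    [cabs (char_mean A r) ^+ 2], and sampling produces almost periods precisely as differences
    [s - s']. *)
Definition diff_avg A f w := avg A (fun s => avg A (fun s' => f (w + s - s'))).

Lemma fourier_shift_avg A f r :
  fourier (shift_avg A f) r = conjc (char_mean A r) * fourier f r.
Proof.
rewrite fourier_avg conj_char_mean -avgMr; apply: eq_avg => x _.
by rewrite fourier_shift.
Qed.

Lemma fourier_diff_avg A f r :
  fourier (diff_avg A f) r = (cabs (char_mean A r) ^+ 2)%:C%C * fourier f r.
Proof.
rewrite fourier_avg (eq_avg (g := fun s => e (- (r * s)) * (char_mean A r * fourier f r))).
  by rewrite avgMr -conj_char_mean cabs_sqr mulrCA mulrA.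
move=> s _; rewrite fourier_avg [RHS]mulrC -mulrA -avgMr.
apply: eq_avg => s' _.
rewrite (fourier_shift (fun w => f (w - s'))) (fourier_shift f) mulrN opprK; ring.
Qed.

Lemma diff_avg_close A c (tau : R) n w : (0 < #|A|)%N -> 0 <= tau ->
  (forall s s' u, s \in A -> s' \in A -> cabs (c (u + s - s') - c u) <= tau) ->
  cabs (iter n (diff_avg A) c w - c w) <= n%:R * tau.
Proof.
move=> A0 tau0 H; elim: n w => [|n IH] w.
  by rewrite subrr cabs0 mul0r.
rewrite iterS; set f := iter n _ _ in IH *.
have E (c0 : R[i]) : c0 = avg A (fun s : G => avg A (fun s' : G => c0)).
  by rewrite !avg_const.
rewrite [c w]E /diff_avg -avgB.
apply: le_trans (cabs_avg _ _) _; rewrite -[X in _ <= X](avg_const _ A0).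
apply: ler_avg => s sA; rewrite -avgB.
apply: le_trans (cabs_avg _ _) _; rewrite -[X in _ <= X](avg_const _ A0).
apply: ler_avg => s' s'A.
have -> : f (w + s - s') - c w = (f (w + s - s') - c (w + s - s')) + (c (w + s - s') - c w) by ring.
apply: le_trans (cabsD _ _) _; rewrite -[n.+1]addn1 natrD mulrDl mul1r.
by apply: lerD; [exact: IH | exact: H].
Qed.

Lemma sum_char_mean_sqr A : (0 < #|A|)%N ->
  \sum_r cabs (char_mean A r) ^+ 2 = #|G|%:R / #|A|%:R.
Proof.
move=> A0; have A0' : (#|A|%:R : R) != 0 by rewrite pnatr_eq0 -lt0n.
pose f x : R[i] := (x \in A)%:R.
have E r : cabs (char_mean A r) ^+ 2 = cabs (fourier f r) ^+ 2 / #|A|%:R ^+ 2.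
  rewrite /char_mean /avg cabsM cabsV cabs_nat exprMn exprVn; congr (cabs _ ^+ 2 / _).
  rewrite /fourier big_mkcond; apply: eq_bigr => x _; rewrite /f.
  by case: ifP; rewrite ?mul1r ?mul0r.
under eq_bigr do rewrite E.
rewrite -mulr_suml parseval.
have -> : \sum_x cabs (f x) ^+ 2 = #|A|%:R.
  rewrite -sum1_card natr_sum [RHS]big_mkcond; apply: eq_bigr => x _.
  by rewrite /f; case: (x \in A); rewrite ?cabs1 ?cabs0 ?expr1n ?expr0n.
by rewrite expr2; field.
Qed.

(** Each term is split by [x * y <= m / 2 * x ^ 2 + y ^ 2 / (2 * m)] with [m = #|A|], and Parseval
    sums the squares. This weight is balanced when [g] is bounded and supported on a set of size
    comparable with [#|A|]. *)
Lemma sum_cabs_fourier_shift_avg A g : (0 < #|A|)%N ->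
  \sum_r cabs (fourier (shift_avg A g) r) <=
    #|G|%:R / 2 * (1 + (\sum_x cabs (g x) ^+ 2) / #|A|%:R).
Proof.
move=> A0; have A0' : 0 < (#|A|%:R : R) by rewrite ltr0n.
apply: le_trans (_ : \sum_r (#|A|%:R / 2 * cabs (char_mean A r) ^+ 2 +
   (2 * #|A|%:R)^-1 * cabs (fourier g r) ^+ 2) <= _).
  apply: ler_sum => r _; rewrite fourier_shift_avg cabsM cabsJ.
  set a := cabs _; set b := cabs _; set m := #|A|%:R in A0' *.
  rewrite -subr_ge0 (_ : _ - _ = (m * a - b) ^+ 2 / (2 * m)).
    by rewrite divr_ge0 ?sqr_ge0 // mulr_ge0 // ltW.
  by field; rewrite gt_eqF.
rewrite big_split /= -!mulr_sumr sum_char_mean_sqr // parseval.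
rewrite le_eqVlt; apply/orP; left; apply/eqP; field.
by rewrite gt_eqF.
Qed.

(** By inversion at 0 the difference is the mean over [r] of [(1 - conjc (char_mean V r)) * cabs
    (char_mean T r) ^+ (2 * n)] times a Fourier coefficient of [shift_avg A g]. Off the large
    spectrum of [T] the second factor is at most [(1 / 4) ^+ n]; on it, [V] makes the first at most
    [eta]. *)
Lemma smoothing A T V g n (eta : R) : (0 < #|A|)%N -> (0 < #|V|)%N ->
  0 <= eta -> 2 * (1 / 4) ^+ n <= eta ->
  (forall r, cabs (char_mean T r) <= 1 / 2 \/
     forall v, v \in V -> cabs (1 - e (r * v)) <= eta) ->
  cabs (iter n (diff_avg T) (shift_avg A g) 0 -
      shift_avg V (iter n (diff_avg T) (shift_avg A g)) 0) <=
    eta / 2 * (1 + (\sum_x cabs (g x) ^+ 2) / #|A|%:R).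
Proof.
move=> A0 V0 eta0 eta1 H; set f := iter n _ _.
have G0 : 0 < (#|G|%:R : R) by rewrite ltr0n; apply/card_gt0P; exists 0.
have Ff r : fourier f r =
    ((cabs (char_mean T r) ^+ 2) ^+ n)%:C%C * fourier (shift_avg A g) r.
  rewrite /f; elim: n {eta1 f} => [|n IH]; first by rewrite /= expr0 rmorph1 mul1r.
  by rewrite iterS fourier_diff_avg IH (exprS _ n) mulrA; congr (_ * _); rewrite -rmorphM.
have Mle1 (B : {set G}) r : (0 < #|B|)%N -> cabs (char_mean B r) <= 1.
  move=> B0; apply: le_trans (cabs_avg _ _) _.
  rewrite -[X in _ <= X](avg_const _ B0); apply: ler_avg => x _.
  by rewrite cabs_char.
rewrite -(ler_pM2l G0) -{1}(cabs_nat R) -cabsM mulrBr -!fourier_inversion0 -sumrB.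
apply: le_trans (cabs_sum _ _ _) _.
apply: le_trans (_ : \sum_r eta * cabs (fourier (shift_avg A g) r) <= _); last first.
  rewrite -mulr_sumr; have := sum_cabs_fourier_shift_avg g A0.
  move/(ler_wpM2l eta0) => h; apply: le_trans h _.
  by rewrite le_eqVlt; apply/orP; left; apply/eqP; ring.
apply: ler_sum => r _; rewrite fourier_shift_avg Ff.
set F := fourier _ r; set m := cabs (char_mean T r).
rewrite (_ : _ - _ = (1 - conjc (char_mean V r)) * ((m ^+ 2) ^+ n)%:C%C * F); last by ring.
rewrite cabsM ler_wpM2r ?cabs_ge0 // cabsM cabs_real ger0_norm; last first.
  by rewrite exprn_ge0 // sqr_ge0.
have m0 : 0 <= m by exact: cabs_ge0.
case: (H r) => [h|h].
  apply: le_trans eta1; apply: ler_pM; rewrite ?cabs_ge0 ?exprn_ge0 ?sqr_ge0 //.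
    apply: le_trans (cabsD _ _) _; rewrite cabs1 cabsN cabsJ.
    by have := Mle1 V r V0; lra.
  have {}h : m <= 1 / 2 := h.
  by apply: lerXn2r; rewrite ?nnegrE ?sqr_ge0 //; try lra; nra.
have hm1 : (m ^+ 2) ^+ n <= 1.
  (* For empty [T] the mean is 0 by convention, and [0 ^+ n] is at most 1. *)
  case: (posnP #|T|) => [T0|T0]; last first.
    by rewrite -exprM; apply: exprn_ile1; rewrite // Mle1.
  rewrite /m /char_mean /avg T0 invr0 mulr0 cabs0 expr0n /= expr0n.
  by case: (n == _); rewrite ?lexx ?ler01.
rewrite -[X in _ <= X]mulr1; apply: ler_pM; rewrite ?cabs_ge0 ?exprn_ge0 ?sqr_ge0 //.
rewrite conj_char_mean -{1}(avg_const 1 V0) -avgB.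
apply: le_trans (cabs_avg _ _) _; rewrite -[X in _ <= X](avg_const _ V0).
apply: ler_avg => v vV; rewrite -[1 - _]conjcK cabsJ rmorphB rmorph1 /= charN conjcK.
exact: h.
Qed.

(** The smoothed function replaces [c] twice, at 0 and inside the average over [V], whence
    [2 * n * tau]. *)
Lemma shift_avg_close A T V g n (eta tau : R) :
  (0 < #|A|)%N -> (0 < #|V|)%N -> (0 < #|T|)%N ->
  0 <= eta -> 2 * (1 / 4) ^+ n <= eta -> 0 <= tau ->
  (forall r, cabs (char_mean T r) <= 1 / 2 \/
     forall v, v \in V -> cabs (1 - e (r * v)) <= eta) ->
  let c := shift_avg A g in
  (forall s s' u, s \in T -> s' \in T -> cabs (c (u + s - s') - c u) <= tau) ->
  cabs (c 0 - shift_avg V c 0) <=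
    2 * n%:R * tau + eta / 2 * (1 + (\sum_x cabs (g x) ^+ 2) / #|A|%:R).
Proof.
move=> A0 V0 T0 eta0 eta1 tau0 H c Hc.
have S1 := smoothing g A0 V0 eta0 eta1 H; rewrite -/c in S1.
have S2 w := diff_avg_close n w T0 tau0 Hc.
set f := iter n _ _ in S1 S2.
have S3 : cabs (shift_avg V f 0 - shift_avg V c 0) <= n%:R * tau.
  rewrite /shift_avg -avgB; apply: le_trans (cabs_avg _ _) _.
  by rewrite -[X in _ <= X](avg_const _ V0); apply: ler_avg => v _.
have -> : c 0 - shift_avg V c 0 = - (f 0 - c 0) + ((f 0 - shift_avg V f 0)
   + (shift_avg V f 0 - shift_avg V c 0)) by ring.
apply: le_trans (cabsD _ _) _; rewrite cabsN.
have := cabsD (f 0 - shift_avg V f 0) (shift_avg V f 0 - shift_avg V c 0).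
have := S2 0; lra.
Qed.

End Fourier.

(** * Chang's theorem relative to a set *)

Section Chang.
Variables (R : realType) (G : finComNzRingType) (e : G -> R[i]).
Hypothesis He : additive_char e.
Implicit Types (f : G -> R[i]) (A S T V : {set G}) (r x y v : G).

Definition dist r x : R := cabs (1 - e (r * x)).

Lemma dist_ge0 r x : 0 <= dist r x.
Proof. exact: cabs_ge0. Qed.

Lemma distDl r r' x : dist (r + r') x <= dist r x + dist r' x.
Proof.
rewrite /dist mulrDl (charD He).
rewrite [X in cabs X](_ : _ = (1 - e (r * x)) + e (r * x) * (1 - e (r' * x))); last by ring.
by apply: le_trans (cabsD _ _) _; rewrite cabsM (cabs_char He) mul1r.
Qed.

Lemma distC r x : dist r x = dist x r.
Proof. by rewrite /dist mulrC. Qed.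

Lemma dist0l x : dist 0 x = 0.
Proof. by rewrite /dist mul0r (char0 He) subrr cabs0. Qed.

Lemma distNl r x : dist (- r) x = dist r x.
Proof.
rewrite /dist mulNr (charN He) -[in RHS]cabsJ.
by congr cabs; rewrite rmorphB rmorph1.
Qed.

Lemma distDr r x y : dist r (x + y) <= dist r x + dist r y.
Proof. by rewrite !(distC r); exact: distDl. Qed.

Lemma distNr r x : dist r (- x) = dist r x.
Proof. by rewrite !(distC r); exact: distNl. Qed.

Lemma dist_suml (I : Type) (s : seq I) (P : pred I) (h : I -> G) x :
  dist (\sum_(i <- s | P i) h i) x <= \sum_(i <- s | P i) dist (h i) x.
Proof.
elim/big_rec2: _ => [|i a b _ IH]; first by rewrite dist0l.
by apply: le_trans (distDl _ _ _) _; rewrite lerD2l.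
Qed.

(* ['I_3] encodes the coefficients 0, 1, -1. *)
Definition trit (a : 'I_3) : G := if val a == 0%N then 0 else if val a == 1%N then 1 else -1.

Definition tritsum n (w : {ffun 'I_n -> 'I_3}) (lam : 'I_n -> G) : G :=
  \sum_i trit (w i) * lam i.

(** Dissociativity relative to [S]: ordinarily a nontrivial combination with coefficients 0, 1, -1
    has to be nonzero; here it has to stay out of the large spectrum of [S]. *)
Definition dissociated S n (lam : 'I_n -> G) :=
  forall w : {ffun 'I_n -> 'I_3}, (exists i, w i != ord0) ->
    cabs (char_mean e S (tritsum w lam)) <= 1 / 2.

Lemma sum_le_shift_avg S A (B : {set G}) f : (0 < #|S|)%N -> (forall x, 0 <= f x) ->
  (forall x s, x \in A -> s \in S -> x - s \in B) ->
  \sum_(x in A) f x <= \sum_(x in B) shift_avg S f x.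
Proof.
move=> S0 f0 H.
have -> : \sum_(x in B) shift_avg S f x = avg S (fun s => \sum_(x in B) f (x + s)).
  by rewrite /shift_avg /avg -mulr_suml exchange_big.
rewrite -[X in X <= _](avg_const _ S0); apply: ler_avg => s sS.
rewrite [X in X <= _](reindex_inj (addIr s)) /=.
rewrite big_mkcond [X in _ <= X]big_mkcond /=; apply: ler_sum => x _.
case: ifP => h; last by case: ifP.
by have := H _ _ h sS; rewrite addrK => ->.
Qed.

Lemma shift_avg_char S r x : shift_avg S (fun x => e (r * x)) x = char_mean e S r * e (r * x).
Proof.
rewrite /shift_avg /char_mean -avgMr; apply: eq_avg => s _.
by rewrite mulrDr (charD He) mulrC.
Qed.

Lemma iter_shift_avg_char S (I : finType) (c : I -> R[i]) (h : I -> G) m x :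
  iter m (shift_avg S) (fun x => \sum_i c i * e (h i * x)) x =
  \sum_i c i * char_mean e S (h i) ^+ m * e (h i * x).
Proof.
elim: m x => [|m IH] x; first by apply: eq_bigr => i _; rewrite expr0 mulr1.
rewrite iterS /shift_avg /avg (eq_bigr _ (fun s _ => IH (x + s))) exchange_big /=.
rewrite mulr_suml; apply: eq_bigr => i _.
have E : (\sum_(s in S) e (h i * (x + s))) / #|S|%:R = char_mean e S (h i) * e (h i * x).
  exact: shift_avg_char.
by rewrite -mulr_sumr -[LHS]mulrA E exprSr; ring.
Qed.

Lemma shift_avg_ge0 S f : (forall x, 0 <= f x) -> forall x, 0 <= shift_avg S f x.
Proof. by move=> h x; rewrite /shift_avg /avg divr_ge0 ?ler0n // sumr_ge0. Qed.

Lemma sum_le_iter_shift_avg S (B : nat -> {set G}) f m : (0 < #|S|)%N ->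
  (forall x, 0 <= f x) ->
  (forall j x s, x \in B j -> s \in S -> x - s \in B j.+1) ->
  \sum_(x in B 0%N) f x <= \sum_(x in B m) iter m (shift_avg S) f x.
Proof.
move=> S0 f0 H; have F j x : 0 <= iter j (shift_avg S) f x.
  by elim: j x => [|j IH] //= x; apply: shift_avg_ge0.
elim: m => [|m IH] //; apply: le_trans IH _; rewrite iterS.
by apply: sum_le_shift_avg => //; apply: H.
Qed.

Lemma exists_phase (z : R[i]) : exists c, cabs c = 1 /\ c * z = (cabs z)%:C%C.
Proof.
have [->|z0] := eqVneq z 0.
  by exists 1; rewrite cabs1 mulr0 cabs0.
have nz : cabs z != 0.
  by apply: contra z0 => /eqP/ComplexField.Normc.eq0_normc ->.
have nz' : (cabs z)%:C%C != 0 :> R[i] by rewrite (fmorph_eq0 (real_complex R)).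
exists (conjc z / (cabs z)%:C%C); split.
  by rewrite cabsM cabsV cabsJ cabs_real (ger0_norm (cabs_ge0 _)) divff.
by rewrite mulrAC [conjc z * z]mulrC -cabs_sqr rmorphXn expr2 mulfK.
Qed.

Section Riesz.
Variables (S T : {set G}) (B : nat -> {set G}) (n m : nat) (lam : 'I_n -> G).
Hypotheses (S0 : (0 < #|S|)%N) (T0 : (0 < #|T|)%N) (nm : (n <= m)%N).
Hypothesis TB : T \subset B 0%N.
Hypothesis HB : forall j x s, x \in B j -> s \in S -> x - s \in B j.+1.
Hypothesis Hdis : dissociated S lam.
Hypothesis Hspec : forall i, 1 / 2 <= cabs (char_mean e T (lam i)).

Lemma riesz_product_bound : expR (n%:R / 32) * #|T|%:R <= 2 * #|B m|%:R :> R.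
Proof.
have /choice [c /all_and2 [c1 c2]] := fun i => exists_phase (char_mean e T (lam i)).
pose X i x : R := complex.Re (c i * e (lam i * x)).
have X1 i x : `|X i x| <= 1.
  have h : cabs (c i * e (lam i * x)) = 1 by rewrite cabsM c1 (cabs_char He) mulr1.
  have h1 := Re_le_cabs (c i * e (lam i * x)).
  have h2 := Re_le_cabs (- (c i * e (lam i * x))).
  rewrite cabsN h raddfN /= in h2; rewrite h in h1.
  by rewrite ler_norml; apply/andP; split; rewrite /X; lra.
(* Riesz product: its mean over [T] is exponentially large in [n] by Jensen's
   inequality, while dissociativity bounds its smoothed sum over [B m]. *)
pose F x : R := \prod_i (1 + 1 / 8 * X i x).
pose coef (i : 'I_n) (a : 'I_3) : R[i] :=
  if val a == 0%N then 1 else if val a == 1%N then (1 / 16)%:C%C * c i else (1 / 16)%:C%C * conjc (c i).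
have F0 x : 0 <= F x.
  by apply: prodr_ge0 => i _; have := X1 i x; rewrite ler_norml => /andP[h1 h2]; lra.
(* [X i x] is half the sum of a number and its conjugate, so each factor expands into three
   characters with coefficients 1, [c i / 16] and the conjugate of the latter. *)
have FE x : (F x)%:C%C =
    \sum_(w : {ffun 'I_n -> 'I_3}) (\prod_i coef i (w i)) * e (tritsum w lam * x).
  have -> : \sum_(w : {ffun 'I_n -> 'I_3}) (\prod_i coef i (w i)) * e (tritsum w lam * x)
    = \sum_(w : {ffun 'I_n -> 'I_3}) \prod_i (coef i (w i) * e (trit (w i) * lam i * x)).
    apply: eq_bigr => w _; rewrite big_split /=; congr (_ * _).
    rewrite /tritsum mulr_suml; elim/big_rec2: _ => [|i a b _ IH]; first exact: char0 He.
    by rewrite (charD He) IH.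
  rewrite -(bigA_distr_bigA (fun i a => coef i a * e (trit a * lam i * x))).
  rewrite rmorph_prod; apply: eq_bigr => i _.
  rewrite !big_ord_recl big_ord0 /coef /trit /= !mul0r (char0 He) !mul1r mulN1r mulNr (charN He).
  rewrite rmorphD rmorphM /= /X; set z := e _.
  case: (c i) => a b; case: z => a' b'.
  by apply/eqP; rewrite eq_complex /=; apply/andP; split; apply/eqP; field.
have lower : expR (n%:R / 32) * #|T|%:R <= \sum_(x in T) F x.
  pose h x : R := 1 / 8 * (\sum_i X i x) - 2 * (1 / 8) ^+ 2 * n%:R.
  have hF x : expR (h x) <= F x.
    by apply: prod_one_add_ge => // ; apply/andP; split; lra.
  have avgh : n%:R / 32 * #|T|%:R <= \sum_(x in T) h x.
    rewrite /h sumrB -mulr_sumr exchange_big sumr_const -mulr_natr /=.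
    have XT i : #|T|%:R / 2 <= \sum_(x in T) X i x.
      have -> : \sum_(x in T) X i x = #|T|%:R * cabs (char_mean e T (lam i)).
        have E : c i * (\sum_(x in T) e (lam i * x)) =
            (#|T|%:R * cabs (char_mean e T (lam i)))%:C%C.
          rewrite rmorphM rmorph_nat /= -(c2 i) /char_mean /avg; field.
          by rewrite pnatr_eq0 -lt0n.
        rewrite -[RHS]/(complex.Re (#|T|%:R * cabs (char_mean e T (lam i)))%:C%C) -E mulr_sumr.
        by rewrite (raddf_sum (@complex.Re R : Rcomplex R -> R)).
      by have := Hspec i; have := ler0n R #|T|; nra.
    have : \sum_(i < n) (#|T|%:R / 2 : R) <= \sum_i \sum_(x in T) X i x by apply: ler_sum.
    by rewrite sumr_const card_ord -mulr_natr; lra.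
  (* Jensen in tangent form: [expR] lies above its tangent at [n / 32], which bounds the mean of [h]
     on [T] from below since [1 / 8 * (n / 2) - 2 * (1 / 8) ^ 2 * n = n / 32]. *)
  apply: le_trans (_ : \sum_(x in T) expR (n%:R / 32) * (1 + (h x - n%:R / 32)) <= _).
    rewrite -mulr_sumr ler_wpM2l ?expR_ge0 // big_split sumrB !sumr_const /=.
    by rewrite -[(_ / _) *+ _]mulr_natr; lra.
  apply: ler_sum => x _; apply: le_trans (hF x).
  rewrite (_ : expR (h x) = expR (n%:R / 32) * expR (h x - n%:R / 32)).
    by rewrite ler_wpM2l ?expR_ge0 // expR_ge1Dx.
  by rewrite -expRD; congr expR; ring.
apply: le_trans lower _.
have TB' : \sum_(x in T) F x <= \sum_(x in B 0%N) F x.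
  rewrite big_mkcond [X in _ <= X]big_mkcond /=; apply: ler_sum => x _.
  by case: ifP => [/(subsetP TB) ->//|_]; case: ifP.
apply: le_trans TB' _.
pose f x := (F x)%:C%C.
have f0 x : 0 <= f x by rewrite /f ler0c.
have h1 := sum_le_iter_shift_avg m S0 f0 HB.
have fE : f = fun x => \sum_(w : {ffun 'I_n -> 'I_3}) (\prod_i coef i (w i)) * e (tritsum w lam * x).
  exact: funext.
have coefN w : \prod_i cabs (coef i (w i)) = cabs (\prod_i coef i (w i)).
  by elim/big_rec2: _ => [|i a b _ IH]; rewrite ?cabs1 // cabsM -IH.
(* One factor has total weight [1 + 1 / 16 + 1 / 16 <= 2]. As [n <= m], the [m] smoothings, each at
   least halving the nontrivial terms, bring their sum to at most 1; the trivial term contributes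
   the other 1 of the factor 2. *)
have coef_sum : \sum_(w : {ffun 'I_n -> 'I_3}) cabs (\prod_i coef i (w i)) <= 2 ^+ m.
  under eq_bigr do rewrite -coefN.
  rewrite -(bigA_distr_bigA (fun i a => cabs (coef i a))).
  apply: le_trans (_ : \prod_(i < n) 2 <= _); last first.
    by rewrite prodr_const card_ord ler_weXn2l // ler1n.
  apply: ler_prod => i _; apply/andP; split; first by apply: sumr_ge0 => a _; apply: cabs_ge0.
  have cb a : cabs (coef i a) = if val a == 0%N then 1 else 1 / 16.
    rewrite /coef; case: ifP => _; rewrite ?cabs1 //.
    by case: ifP => _; rewrite cabsM ?cabsJ c1 cabs_real ger0_norm; lra.
  by rewrite (eq_bigr _ (fun a _ => cb a)) !big_ord_recl big_ord0 /=; lra.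
have term (w : {ffun 'I_n -> 'I_3}) x :
    cabs ((\prod_i coef i (w i)) * char_mean e S (tritsum w lam) ^+ m * e (tritsum w lam * x))
    <= (w == [ffun=> ord0])%:R + cabs (\prod_i coef i (w i)) * (1 / 2) ^+ m.
  rewrite !cabsM (cabs_char He) mulr1 cabsX.
  have [->|w0] := eqVneq w [ffun=> ord0].
    rewrite (eq_bigr (fun=> 1)) => [|i _]; last by rewrite ffunE.
    rewrite big1 // cabs1 !mul1r /tritsum big1 => [|i _]; last by rewrite ffunE mul0r.
    rewrite -[X in X <= _]addr0 lerD ?exprn_ge0 //; last by lra.
    apply: exprn_ile1; rewrite ?cabs_ge0 //.
    apply: le_trans (cabs_avg _ _) _; rewrite -[X in _ <= X](avg_const _ S0).
    by apply: ler_avg => y _; rewrite (cabs_char He).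
  rewrite add0r ler_wpM2l ?cabs_ge0 // lerXn2r ?nnegrE ?cabs_ge0 //; first by lra.
  apply: Hdis; apply/existsP; apply: contraR w0; rewrite negb_exists => /forallP h.
  by apply/eqP/ffunP => i; rewrite ffunE; apply/eqP; have := h i; rewrite negbK.
have pt x : cabs (iter m (shift_avg S) f x) <= 2.
  rewrite fE iter_shift_avg_char; apply: le_trans (cabs_sum _ _ _) _.
  apply: le_trans (ler_sum _ (fun w _ => term w x)) _.
  rewrite big_split /= -mulr_suml (bigD1 [ffun=> ord0]) //= eqxx big1 => [|w /negbTE ->//].
  have : (\sum_(w : {ffun 'I_n -> 'I_3}) cabs (\prod_i coef i (w i))) * (1 / 2) ^+ m <= 2 ^+ m * (1 / 2) ^+ m.
    by rewrite ler_wpM2r // exprn_ge0 //; lra.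
  have -> : 2 ^+ m * (1 / 2) ^+ m = 1 :> R.
    by rewrite -exprMn (_ : 2 * (1 / 2) = 1) ?expr1n //; field.
  by rewrite addr0 mulr1n; lra.
have h2 := ler_norm (\sum_(x in B 0%N) F x).
apply: le_trans h2 _.
rewrite -cabs_real rmorph_sum /=.
have g0 : 0 <= \sum_(x in B 0%N) f x by apply: sumr_ge0 => x _.
have : cabs (\sum_(x in B 0%N) f x) <= cabs (\sum_(x in B m) iter m (shift_avg S) f x).
  rewrite -lecR !cabsE ger0_norm // ger0_norm //; exact: le_trans h1.
move/le_trans; apply; apply: le_trans (cabs_sum _ _ _) _.
rewrite mulr_natr -sumr_const; exact: ler_sum.
Qed.
End Riesz.
End Chang.

Section Span.
Variables (R : realType) (G : finComNzRingType) (e : G -> R[i]).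
Hypothesis He : additive_char e.
Implicit Types (S T : {set G}) (r x y v : G).

Definition shift_close S v (eps : R) :=
  #|[set x in S | x + v \notin S]|%:R <= eps * #|S|%:R.

(** Multiplying the character sum over [S] by [1 - e (r * v)] leaves only the boundary between [S]
    and its translate, at most [2 * eps * #|S|] terms; the sum itself exceeds [#|S| / 2]. *)
Lemma dist_le_of_char_mean S v r (eps : R) : (0 < #|S|)%N ->
  shift_close S v eps -> shift_close S (- v) eps ->
  1 / 2 < cabs (char_mean e S r) -> dist e r v <= 4 * eps.
Proof.
move=> S0 h1 h2 h.
have S0' : (0 : R) < #|S|%:R by rewrite ltr0n.
pose I (x : G) : R := (x \in S)%:R.
have E : (1 - e (r * v)) * (\sum_(x in S) e (r * x)) =
    \sum_x (I x - I (x - v))%:C%C * e (r * x).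
  under [RHS]eq_bigr do rewrite rmorphB mulrBl.
  rewrite sumrB mulrBl mul1r; congr (_ - _).
    by rewrite big_mkcond; apply: eq_bigr => x _; rewrite /I; case: ifP; rewrite ?mul1r ?mul0r.
  rewrite [RHS](reindex_inj (addIr v)) big_mkcond mulr_sumr; apply: eq_bigr => x _ /=.
  rewrite addrK /I mulrDr (charD He); case: ifP => _; rewrite ?mul1r ?mul0r ?mulr0 //.
  by rewrite mulrC.
have b1 : \sum_x cabs ((I x - I (x - v))%:C%C * e (r * x)) <= 2 * eps * #|S|%:R.
  apply: le_trans (_ : #|[set x in S | x - v \notin S]|%:R + #|[set x in S | x + v \notin S]|%:R <= _);
    last by move: h1 h2; rewrite /shift_close; lra.
  rewrite -!sum1_card !natr_sum [X in _ <= X + _]big_mkcond /=.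
  rewrite [X in _ <= _ + X]big_mkcond /= [X in _ <= _ + X](reindex_inj (addIr (- v))) /= -big_split /=; apply: ler_sum => x _.
  rewrite cabsM (cabs_char He) mulr1 cabs_real !inE subrK /I.
  case: (x \in S); case: (x - v \in S) => /=.
  - by rewrite subrr normr0 addr0.
  - by rewrite subr0 normr1 addr0.
  - by rewrite sub0r normrN normr1 add0r.
  - by rewrite subr0 normr0 addr0.
have b2 : cabs (\sum_(x in S) e (r * x)) = cabs (char_mean e S r) * #|S|%:R.
  rewrite /char_mean /avg cabsM cabsV cabs_nat divfK //.
  by rewrite gt_eqF.
have := le_trans (cabs_sum _ _ _) b1; rewrite -E cabsM b2 -/(dist e r v).
set c := cabs _ in h *; have d0 := dist_ge0 e r v; rewrite mulrA (ler_pM2r S0').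
nra.
Qed.

(** If size [N + 1] is impossible but size [N] is attained, adjoining any [r] destroys
    dissociativity, and the offending combination must involve [r] because the old system is
    dissociated. *)
Lemma exists_maximal_dissociated S (P : pred G) N :
  ~ (exists lam : 'I_N -> G, (forall i, P (lam i)) /\ dissociated e S lam) ->
  exists (n : nat) (lam : 'I_n -> G), (n < N)%N /\
    forall r, P r -> exists (w : {ffun 'I_n -> 'I_3}) (a : 'I_3), a != ord0 /\
      1 / 2 < cabs (char_mean e S (trit G a * r + tritsum w lam)).
Proof.
elim: N => [|N IH] H.
  (* The empty system is always dissociated, so the hypothesis fails for size 0. *)
  case: H; exists (fun=> 0); split; first by case.
  by move=> w [[]].
have [Q|Q] := EM (exists lam : 'I_N -> G, (forall i, P (lam i)) /\ dissociated e S lam); last first.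
  by have [n [lam [nN h]]] := IH Q; exists n, lam; split => //; apply: ltnW.
case: Q => lam [Plam Dlam]; exists N, lam; split => // r Pr.
apply: contrapT => K; apply: H.
exists (fun i => if unlift ord0 i is Some j then lam j else r); split.
  by move=> i; case: unliftP => [j|] _.
move=> w [i wi]; rewrite /tritsum big_ord_recl unlift_none.
rewrite (eq_bigr (fun j => trit G ([ffun j : 'I_N => w (lift ord0 j)] j) * lam j)); last first.
  by move=> j _; rewrite liftK ffunE.
have [w0|w0] := eqVneq (w ord0) ord0.
  rewrite w0 /trit /= mul0r add0r; apply: Dlam.
  move: wi; case: (unliftP ord0 i) => [j ->|->]; last by rewrite w0.
  by exists j; rewrite ffunE.
rewrite leNgt; apply/negP => h; apply: K.
by exists [ffun j : 'I_N => w (lift ord0 j)], (w ord0).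
Qed.

Lemma dist_trit_le (a : 'I_3) r v : dist e (trit G a * r) v <= dist e r v.
Proof.
rewrite /trit; case: ifP => _; first by rewrite mul0r (dist0l He) dist_ge0.
by case: ifP => _; rewrite ?mul1r // mulN1r (distNl He).
Qed.

Lemma dist_trit (a : 'I_3) r v : a != ord0 -> dist e (trit G a * r) v = dist e r v.
Proof.
rewrite /trit => a0; rewrite ifF; last by apply/negbTE.
by case: ifP => _; rewrite ?mul1r // mulN1r (distNl He).
Qed.

(** The Riesz product bound excludes [N] dissociated frequencies in the large spectrum of [T]. Given
    a maximal system, any [r] there is, up to sign, an element of the large spectrum of [S] minus a
    combination of the system: these cost [4 * eps] and [n * delta]. *)
Lemma chang_span S T (B : nat -> {set G}) N :
  (0 < #|S|)%N -> (0 < #|T|)%N -> T \subset B 0%N ->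
  (forall j x s, x \in B j -> s \in S -> x - s \in B j.+1) ->
  2 * #|B N|%:R < expR (N%:R / 32) * #|T|%:R :> R ->
  exists (n : nat) (lam : 'I_n -> G), (n <= N)%N /\
    forall v (delta eps : R), shift_close S v eps -> shift_close S (- v) eps ->
      (forall i, dist e (lam i) v <= delta) ->
      forall r, cabs (char_mean e T r) <= 1 / 2 \/ dist e r v <= 4 * eps + n%:R * delta.
Proof.
move=> S0 T0 TB HB big.
have [|n [lam [nN H]]] := @exists_maximal_dissociated S (fun r => 1 / 2 < cabs (char_mean e T r)) N.
  case=> lam [h1 h2]; have h3 i : 1 / 2 <= cabs (char_mean e T (lam i)) by apply: ltW.
  have := riesz_product_bound He S0 T0 (leqnn N) TB HB h2 h3.
  by move/(lt_le_trans big); rewrite ltxx.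
exists n, lam; split; first exact: ltnW.
move=> v delta eps v1 v2 hv r.
case: (leP (cabs (char_mean e T r)) (1 / 2)) => [|hr]; [by left | right].
have [w [a [a0 ha]]] := H r hr.
have h4 := dist_le_of_char_mean S0 v1 v2 ha.
rewrite -(dist_trit _ _ a0).
have -> : trit G a * r = (trit G a * r + tritsum w lam) + - tritsum w lam by ring.
apply: le_trans (distDl He _ _ _) _; apply: lerD => //.
rewrite (distNl He); apply: le_trans (dist_suml He _ _ _ _) _.
rewrite mulr_natl -[in X in _ <= X](card_ord n) -sumr_const; apply: ler_sum => i _.
by apply: le_trans (dist_trit_le _ _ _) _.
Qed.
End Span.

(** * Bohr sets *)

Section Bohr.
Variables (R : realType) (G : finComNzRingType) (e : G -> R[i]).
Hypothesis He : additive_char e.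
Implicit Types (Gam : seq G) (r x y v : G) (rho kappa eps : R).

(* The chord [cabs (1 - e (r * x))] replaces the usual distance to the nearest integer. *)
Definition bohr Gam rho : {set G} := [set x | all (fun r => dist e r x <= rho) Gam].

Lemma bohrP Gam rho x : reflect (forall r, r \in Gam -> dist e r x <= rho) (x \in bohr Gam rho).
Proof. by rewrite inE; apply: allP. Qed.

Lemma bohr_zero Gam rho : 0 <= rho -> 0 \in bohr Gam rho.
Proof. by move=> h; apply/bohrP => r _; rewrite distC (dist0l He). Qed.

Lemma card_bohr_gt0 Gam rho : 0 <= rho -> (0 < #|bohr Gam rho|)%N.
Proof. by move=> h; apply/card_gt0P; exists 0; apply: bohr_zero. Qed.

Lemma bohrN Gam rho x : (- x \in bohr Gam rho) = (x \in bohr Gam rho).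
Proof. by rewrite !inE; apply: eq_all => r; rewrite (distNr He). Qed.

Lemma bohrD Gam rho rho' x y : x \in bohr Gam rho -> y \in bohr Gam rho' ->
  x + y \in bohr Gam (rho + rho').
Proof.
move=> /bohrP hx /bohrP hy; apply/bohrP => r rG.
by apply: le_trans (distDr He _ _ _) _; rewrite lerD ?hx ?hy.
Qed.

Lemma bohrB Gam rho rho' x y : x \in bohr Gam rho -> y \in bohr Gam rho' ->
  x - y \in bohr Gam (rho + rho').
Proof. by move=> hx hy; apply: bohrD => //; rewrite bohrN. Qed.

Lemma subset_bohr Gam rho rho' : rho <= rho' -> bohr Gam rho \subset bohr Gam rho'.
Proof.
move=> h; apply/subsetP => x /bohrP hx; apply/bohrP => r rG.
exact: le_trans (hx r rG) h.
Qed.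

Lemma le_card_bohr Gam rho rho' : rho <= rho' ->
  #|bohr Gam rho|%:R <= #|bohr Gam rho'|%:R :> R.
Proof. by move=> h; rewrite ler_nat subset_leq_card // subset_bohr. Qed.

Lemma bohr_cat Gam Lam rho x :
  (x \in bohr (Gam ++ Lam) rho) = (x \in bohr Gam rho) && (x \in bohr Lam rho).
Proof. by rewrite !inE all_cat. Qed.

Lemma bohr_natmul Gam rho x m : x \in bohr Gam rho -> x *+ m \in bohr Gam (m%:R * rho).
Proof.
move=> hx; elim: m => [|m IH]; first by rewrite mul0r mulr0n bohr_zero.
by rewrite mulrS -addn1 natrD mulrDl mul1r addrC; apply: bohrD.
Qed.

Lemma bohr_intmul Gam rho x (z : int) (H : nat) : 0 <= rho -> (`|z| <= H)%N ->
  x \in bohr Gam rho -> z%:~R * x \in bohr Gam (H%:R * rho).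
Proof.
move=> rho0 zH hx.
apply: (subsetP (subset_bohr _ (_ : `|z|%N%:R * rho <= _))).
  by rewrite ler_wpM2r // ler_nat.
rewrite mulrzl; case: z {zH} => m; rewrite /= ?absz_nat.
  exact: bohr_natmul.
by rewrite NegzE mulrNz bohrN; apply: bohr_natmul.
Qed.

Lemma exists_close_subset (Y : {set G}) r (q : nat) : (0 < q)%N ->
  exists Z : {set G}, [/\ Z \subset Y, (#|Y| <= #|Z| * (q.*2.+1) ^ 2)%N &
    forall x y, x \in Z -> y \in Z -> dist e r (x - y) <= 2 / q%:R].
Proof.
move=> q0; have q0' : (0 : R) < q%:R by rewrite ltr0n.
(* Since [1 + u] ranges over [[0, 2]], truncating [q * (1 + u)] gives [2 * q + 1] values, the last
   one only for [u = 1]. *)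
pose cl (u : R) : 'I_q.*2.+1 := inord (Num.truncn (q%:R * (1 + u))).
pose cell x := (cl (complex.Re (e (r * x))), cl (complex.Im (e (r * x)))).
have RI x : (-1 <= complex.Re (e (r * x)) <= 1) /\ (-1 <= complex.Im (e (r * x)) <= 1).
  have := cabs_sqr (e (r * x)); rewrite (cabs_char He) expr1n.
  case: (e _) => a b /= /eqP; rewrite eq_complex /= => /andP[/eqP h _].
  by split; apply/andP; split; nra.
have clP u w : -1 <= u <= 1 -> -1 <= w <= 1 -> cl u = cl w -> `|u - w| <= 1 / q%:R.
  move=> /andP[u1 u2] /andP[w1 w2] /(congr1 val); rewrite /cl /=.
  have b (t : R) : -1 <= t -> t <= 1 -> (Num.truncn (q%:R * (1 + t)) < q.*2.+1)%N.
    move=> t1 t2; have t0 : 0 <= q%:R * (1 + t) by rewrite mulr_ge0 ?ler0n //; lra.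
    have /andP[h _] := truncn_itv t0.
    by rewrite ltnS -(ler_nat R) -addnn natrD; nra.
  rewrite !inordK ?b // => E.
  have [/andP[a1 a2] /andP[a3 a4]] : (Num.truncn (q%:R * (1 + u)))%:R <= q%:R * (1 + u) < (Num.truncn (q%:R * (1 + u))).+1%:R
     /\ (Num.truncn (q%:R * (1 + w)))%:R <= q%:R * (1 + w) < (Num.truncn (q%:R * (1 + w))).+1%:R.
    by split; apply: truncn_itv; rewrite mulr_ge0 ?ler0n //; lra.
  rewrite E -addn1 natrD in a1 a2; rewrite -addn1 natrD in a4.
  have E1 : q%:R * (1 / q%:R) = 1 :> R by field; rewrite gt_eqF.
  by rewrite ler_norml; apply/andP; split; rewrite -(ler_pM2l q0') ?mulrN E1; lra.
have : (#|Y| <= \sum_(c in [set: 'I_q.*2.+1 * 'I_q.*2.+1]) #|[set x in Y | cell x == c]|)%N.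
  rewrite -sum1_card (partition_big cell (mem [set: 'I_q.*2.+1 * 'I_q.*2.+1])) /= => [|x _]; last by rewrite inE.
  apply: leq_sum => c _; rewrite -sum1_card; apply: eq_leq; apply: eq_bigl => x.
  by rewrite inE.
case/pigeonhole_sum; first by rewrite cardsT card_prod card_ord.
move=> c _; rewrite cardsT card_prod card_ord mulnn => hc.
exists [set x in Y | cell x == c]; split => //.
  by apply/subsetP => x; rewrite inE => /andP[].
move=> x y; rewrite !inE => /andP[_ /eqP hx] /andP[_]; rewrite -hx => /eqP [h1 h2].
have [R1 I1] := RI x; have [R2 I2] := RI y.
have := clP _ _ R1 R2 (esym h1); have := clP _ _ I1 I2 (esym h2).
have -> : dist e r (x - y) = cabs (e (r * x) - e (r * y)).
  have -> : e (r * x) - e (r * y) = - (e (r * y) * (1 - e (r * (x - y)))).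
    by rewrite mulrBr mulr1 -(charD He) (_ : r * y + r * (x - y) = r * x) ?opprB //; ring.
  by rewrite cabsN cabsM (cabs_char He) mul1r.
move=> d1 d2; apply: le_trans (cabs_le_Re_Im _) _.
case: (e (r * x)) d1 d2 => a b; case: (e (r * y)) => a' b' /= d1 d2.
by rewrite (_ : 2 / q%:R = 1 / q%:R + 1 / q%:R) ?lerD //; field; rewrite gt_eqF.
Qed.

(* [q.*2.+1 ^ 2] counts the square cells of side [1 / q] that cover the unit disc. *)
Lemma card_bohr_ge Gam rho (q : nat) : (0 < q)%N -> 2 / q%:R <= rho ->
  (#|G| <= #|bohr Gam rho| * (q.*2.+1 ^ 2) ^ size Gam)%N.
Proof.
move=> q0 hq; have G0 : (0 < #|G|)%N by apply/card_gt0P; exists 0.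
have rho0 : 0 <= rho by apply: le_trans hq; rewrite divr_ge0 ?ler0n.
(* Pigeonholing one frequency after another yields a large set whose differences lie in the Bohr
   set; a translation by one of its own points moves it inside. *)
suff [Z Zc ZG] : exists2 Z : {set G}, (#|G| <= #|Z| * (q.*2.+1 ^ 2) ^ size Gam)%N &
    forall x y r, x \in Z -> y \in Z -> r \in Gam -> dist e r (x - y) <= rho.
  apply: leq_trans Zc _; rewrite leq_mul2r; apply/orP; right.
  have [->|[z zZ]] := set_0Vmem Z; first by rewrite cards0.
  rewrite -(card_imset Z (addIr (- z))); apply: subset_leq_card.
  by apply/subsetP => y /imsetP [x xZ ->]; apply/bohrP => r; apply: ZG.
elim: Gam => [|r Gam [Z Zc ZG]].
  by exists [set: G]; rewrite ?cardsT ?expn0 ?muln1.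
have [Z' [Z'Z Z'c Z'd]] := exists_close_subset Z r q0.
exists Z'.
  apply: leq_trans Zc _; rewrite /= (expnS _ (size Gam)) mulnA leq_mul2r; apply/orP; by right.
move=> x y s xZ yZ; rewrite inE => /orP[/eqP ->|sG]; last first.
  by apply: ZG => //; apply: (subsetP Z'Z).
by apply: le_trans (Z'd _ _ xZ yZ) hq.
Qed.

(** Regularity at the single scale [kappa]; Bourgain's notion compares sizes at every small
    scale. *)
Definition regular Gam rho kappa eps :=
  #|bohr Gam (rho + kappa * rho)|%:R <= (1 + eps) * #|bohr Gam (rho - kappa * rho)|%:R :> R.

(** Between [rho0 / 2] and [rho0] there is room for [J] disjoint annuli of width [2 * kappa * rho0].
    If none contained a regular radius, the size would grow by [1 + eps] across each and exceed
    [#|G|]. *)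
Lemma exists_regular Gam rho0 kappa eps (J : nat) :
  (0 < J)%N -> 0 < rho0 -> 0 <= kappa -> 0 <= eps -> 4 * J%:R * kappa <= 1 ->
  #|G|%:R <= (1 + eps) ^+ J * #|bohr Gam (rho0 / 2)|%:R :> R ->
  exists rho, [/\ rho0 / 2 <= rho, rho <= rho0 & regular Gam rho kappa eps].
Proof.
move=> J0 r0 k0 e0 Jk big; apply: contrapT => K.
pose s (j : nat) := rho0 - 2 * j%:R * kappa * rho0.
pose u j : R := #|bohr Gam (s j)|%:R.
have kr0 : 0 <= kappa * rho0 by rewrite mulr_ge0 // ltW.
have half j : (j <= J)%N -> rho0 / 2 <= s j.
  rewrite -(ler_nat R) /s => jJ.
  have : 4 * j%:R * kappa * rho0 <= 1 * rho0.
    by rewrite ler_pM2r //; apply: le_trans Jk; rewrite ler_wpM2r // ler_wpM2l.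
  lra.
have step j : (j < J)%N -> (1 + eps) * u j.+1 < u j.
  move=> jJ; rewrite ltNge; apply/negP => h; apply: K.
  (* The midpoint of the annulus; its half-width [kappa * rho0] is at least [kappa * rho]. *)
  pose rho := rho0 - (2 * j%:R + 1) * kappa * rho0.
  have js : s j.+1 = rho - kappa * rho0 by rewrite /s /rho -addn1 natrD; ring.
  have js' : s j = rho + kappa * rho0 by rewrite /s /rho; ring.
  have hJ := half _ jJ.
  have j0 : 0 <= 2 * j%:R + 1 :> R by rewrite addr_ge0 ?mulr_ge0 ?ler0n.
  have rr : rho <= rho0 by rewrite /rho gerBl -mulrA mulr_ge0.
  have kk : kappa * rho <= kappa * rho0 by rewrite ler_wpM2l.
  exists rho; split => //; first by lra.
  rewrite /regular; apply: le_trans (_ : u j <= _); first by apply: le_card_bohr; lra.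
  apply: le_trans h _; rewrite ler_wpM2l ?addr_ge0 //.
  by apply: le_card_bohr; lra.
have iter j : (0 < j <= J)%N -> (1 + eps) ^+ j * u j < u 0%N.
  elim: j => // [[|j]] IH /= jJ; first by rewrite expr1; apply: step.
  apply: lt_trans (IH (ltnW jJ)); rewrite exprSr -mulrA ltr_pM2l ?step //.
  by rewrite exprn_gt0 //; lra.
have h1 := iter J; rewrite J0 leqnn in h1; have {}h1 := h1 isT.
have h2 : u 0%N <= #|G|%:R by rewrite ler_nat max_card.
have h3 : (1 + eps) ^+ J * #|bohr Gam (rho0 / 2)|%:R <= (1 + eps) ^+ J * u J.
  by rewrite ler_wpM2l ?exprn_ge0 ?addr_ge0 //; apply: le_card_bohr; apply: half.
by have := le_lt_trans (le_trans big h3) (lt_le_trans h1 h2); rewrite ltxx.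
Qed.

Section RegularConsequences.
Variables (Gam : seq G) (rho kappa eps : R).
Hypotheses (rho0 : 0 <= rho) (kappa0 : 0 <= kappa) (eps0 : 0 <= eps).
Hypothesis Hreg : regular Gam rho kappa eps.

Lemma regular_outer : #|bohr Gam (rho + kappa * rho)|%:R <= (1 + eps) * #|bohr Gam rho|%:R :> R.
Proof.
have kr0 : 0 <= kappa * rho by exact: mulr_ge0.
apply: le_trans Hreg _; rewrite ler_wpM2l ?addr_ge0 //.
by apply: le_card_bohr; lra.
Qed.

(** Points of the Bohr set that [v] moves out avoid the inner Bohr set, so they lie in the thin
    annulus controlled by regularity. *)
Lemma regular_shift_close v : v \in bohr Gam (kappa * rho) -> shift_close (bohr Gam rho) v eps.
Proof.
have kr0 : 0 <= kappa * rho by exact: mulr_ge0.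
move=> hv; rewrite /shift_close.
have dis : [set x in bohr Gam rho | x + v \notin bohr Gam rho] :&: bohr Gam (rho - kappa * rho) = set0.
  apply/setP => x; rewrite in_setI in_set0 in_set; apply/negP => /andP[/andP[_ /negP h] hx].
  by apply: h; have := bohrD hx hv; rewrite subrK.
have h1 : (#|[set x in bohr Gam rho | (x + v)%R \notin bohr Gam rho]| + #|bohr Gam (rho - kappa * rho)%R|
   <= #|bohr Gam (rho + kappa * rho)%R|)%N.
  rewrite -cardsUI dis cards0 addn0.
  apply: subset_leq_card; apply/subsetP => x; rewrite in_setU => /orP[].
    by rewrite inE => /andP[h _]; apply: (subsetP (subset_bohr _ _) _ h); lra.
  by apply: (subsetP (subset_bohr _ _)); lra.
rewrite -(ler_nat R) natrD in h1.
have h2 := Hreg; rewrite /regular in h2.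
have h3 : #|bohr Gam (rho - kappa * rho)|%:R <= #|bohr Gam rho|%:R :> R by apply: le_card_bohr; lra.
have := ler_wpM2l eps0 h3; lra.
Qed.

End RegularConsequences.
End Bohr.

(** * Increment or uniform distribution *)

Lemma card_indic (R : pzSemiRingType) (T : finType) (A : {set T}) (P : pred T) :
  \sum_(x in A) (P x)%:R = #|[set x in A | P x]|%:R :> R.
Proof.
rewrite -sum1_card natr_sum big_mkcond [RHS]big_mkcond /=.
by apply: eq_bigr => x _; rewrite inE; case: (x \in A); case: (P x).
Qed.

Section Uniform.
Variables (R : realType) (G : finComNzRingType).
Variables (B1 V A1 A2 L : {set G}) (al eps c : R).
Hypotheses (B0 : (0 < #|B1|)%N) (V0 : (0 < #|V|)%N) (A10 : (0 < #|A1|)%N) (A20 : (0 < #|A2|)%N).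
Hypotheses (A1B : A1 \subset B1) (LB : L \subset B1) (al0 : 0 < al) (c0 : 0 <= c) (eps0 : 0 <= eps).
Hypothesis A1d : al * #|B1|%:R <= #|A1|%:R.
Hypothesis Vc : forall v, v \in V -> shift_close B1 v eps.
Hypothesis VN : forall v, (- v \in V) = (v \in V).
Hypothesis A2c : forall y, y \in A2 -> shift_close B1 (- y) eps.
Hypothesis noincr : forall u,
  #|B1|%:R * #|[set v in V | u + v \in A1]|%:R <= (1 + c) * #|A1|%:R * #|V|%:R :> R.

Let g u : R := meas R A2 L u.

Lemma sum_meas_ge : #|L|%:R - eps * #|B1|%:R <= \sum_(u in B1) g u.
Proof.
have A2' : (0 : R) < #|A2|%:R by rewrite ltr0n.
rewrite /g /meas /avg -mulr_suml exchange_big /= ler_pdivlMr //.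
rewrite [X in X <= _]mulr_natr -sumr_const; apply: ler_sum => y yA.
have h : (#|L| <= #|[set u in B1 | (u - y)%R \notin B1]| + #|[set u in B1 | (u + y)%R \in L]|)%N.
  rewrite -(card_imset [set u in B1 | u + y \in L] (addIr y)).
  apply: leq_trans (leq_card_setU _ _); apply: subset_leq_card.
  apply/subsetP => w wL; rewrite in_setU; have wB := subsetP LB _ wL.
  case h : (w - y \in B1); last by rewrite inE wB h.
  by apply/orP; right; apply/imsetP; exists (w - y); rewrite ?inE ?subrK ?h.
have h2 := A2c yA; rewrite /shift_close in h2.
rewrite card_indic; rewrite -(ler_nat R) natrD in h; lra.
Qed.

(** A one-sided bound on the local densities [H u] is enough: they are at most [1 + c] times their
    expected value and almost all their mass is on [B1], so their total deficit below this bound is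
    small, and since [g <= 1] it costs little. *)
Lemma uniform_lower_bound :
  #|L|%:R / #|B1|%:R - c - eps / al - eps <=
    avg V (fun v => avg A1 (fun x => g (v + x))).
Proof.
have c0' : 0 <= c by []. have eps0' : 0 <= eps by []. have al0' : 0 < al by [].
have B1' : (0 : R) < #|B1|%:R by rewrite ltr0n.
have V' : (0 : R) < #|V|%:R by rewrite ltr0n.
have A1' : (0 : R) < #|A1|%:R by rewrite ltr0n.
pose H u : R := #|[set v in V | u + v \in A1]|%:R.
have gb u : 0 <= g u <= 1 by apply: meas_bounds.
have exch (F : G -> R) : \sum_(v in V) \sum_(x in A1) F (v + x) = \sum_u H u * F u.
  under eq_bigr => v _.
    rewrite (reindex_inj (addrI (- v))) /=.
    rewrite (eq_bigr F) => [|x _]; last by rewrite addrA subrr add0r.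
    rewrite big_mkcond; over.
  rewrite exchange_big /=; apply: eq_bigr => u _.
  rewrite /H -card_indic mulr_suml (reindex_inj oppr_inj) /= (eq_bigl _ _ VN).
  by apply: eq_bigr => v _; rewrite opprK addrC; case: ifP; rewrite ?mul1r ?mul0r.
have HB : #|V|%:R * #|A1|%:R * (1 - eps / al) <= \sum_(u in B1) H u.
  rewrite big_mkcond; have -> : \sum_u (if u \in B1 then H u else 0) = \sum_u H u * (u \in B1)%:R.
    by apply: eq_bigr => u _; case: (u \in B1); rewrite ?mulr1 ?mulr0.
  rewrite -(exch (fun u => (u \in B1)%:R)) -mulrA mulrC [X in X <= _]mulr_natr -sumr_const; apply: ler_sum => v vV.
  rewrite card_indic.
  have h1 : (#|A1| <= #|[set x in A1 | (v + x)%R \in B1]| + #|[set x in B1 | (x + v)%R \notin B1]|)%N.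
    apply: leq_trans (leq_card_setU _ _); apply: subset_leq_card.
    apply/subsetP => x xA; rewrite in_setU !inE xA (subsetP A1B _ xA) /= addrC.
    by rewrite orbN.
  have := Vc vV; rewrite /shift_close => h2.
  rewrite -(ler_nat R) natrD in h1.
  have h3 : eps * #|B1|%:R <= eps / al * #|A1|%:R.
    by rewrite -mulrA ler_wpM2l // mulrC ler_pdivlMr // mulrC.
  lra.
have HK u : H u <= (1 + c) * #|A1|%:R * #|V|%:R / #|B1|%:R.
  by rewrite ler_pdivlMr // mulrC; apply: noincr.
set K := _ / #|B1|%:R in HK.
have K0 : 0 <= K by rewrite /K !mulr_ge0 ?invr_ge0 ?ler0n // addr_ge0.
(* [(K - H u) * (1 - g u) >= 0], summed over [B1]. *)
have main : K * (\sum_(u in B1) g u) - K * #|B1|%:R + \sum_(u in B1) H u <= \sum_u H u * g u.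
  apply: le_trans (_ : \sum_(u in B1) H u * g u <= _); last first.
    rewrite big_mkcond; apply: ler_sum => u _; case: ifP => // _.
    by rewrite mulr_ge0 ?ler0n //; case/andP: (gb u).
  rewrite mulr_sumr mulr_natr -sumr_const -sumrB -big_split /=; apply: ler_sum => u _.
  by case/andP: (gb u) => g0 g1; have := HK u; nra.
have E : avg V (fun v => avg A1 (fun x => g (v + x))) * (#|V|%:R * #|A1|%:R) = \sum_u H u * g u.
  rewrite -exch /avg -mulr_suml; field; apply/andP; split; exact: lt0r_neq0.
rewrite -(ler_pM2r (mulr_gt0 V' A1')) E; apply: le_trans main.
have sg := sum_meas_ge.
have sg0 : 0 <= \sum_(u in B1) g u by apply: sumr_ge0 => u _; case/andP: (gb u).
have k1 : (#|A1|%:R * #|V|%:R / #|B1|%:R) * (#|L|%:R - eps * #|B1|%:R) <= K * \sum_(u in B1) g u.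
  apply: le_trans (_ : (#|A1|%:R * #|V|%:R / #|B1|%:R) * (\sum_(u in B1) g u) <= _).
    by rewrite ler_wpM2l // divr_ge0 ?mulr_ge0 ?ler0n.
  rewrite ler_wpM2r // /K -!mulrA ler_peMl ?mulr_ge0 ?invr_ge0 ?ler0n //; lra.
have k2 : K * #|B1|%:R = (1 + c) * #|A1|%:R * #|V|%:R by rewrite /K divfK // gt_eqF.
have k3 : (#|A1|%:R * #|V|%:R / #|B1|%:R) * (#|L|%:R - eps * #|B1|%:R) =
   #|L|%:R / #|B1|%:R * (#|V|%:R * #|A1|%:R) - eps * (#|V|%:R * #|A1|%:R).
  by field; rewrite gt_eqF.
rewrite k3 in k1; rewrite k2; lra.
Qed.
End Uniform.

(** This and the next two lemmas follow a chain of radii with requested ratios [kappa], [kappa / N],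
    [kappa]. Passing to a regular radius may halve each of them, so the last request is at least
    [kappa ^+ 3 * rho / (4 * N)] and the last radius at least half of that. *)
Lemma radius_chain_S (R : realFieldType) (kappa rho N : R) :
  0 < kappa -> kappa <= 1 -> 0 < rho -> 1 <= N -> kappa ^+ 3 * rho / (4 * N) <= kappa * rho.
Proof.
move=> k0 k1 r0 N1; rewrite ler_pdivrMr; last by lra.
have k2 : kappa ^+ 2 <= 1 by apply: exprn_ile1; rewrite // ltW.
have kr : 0 < kappa * rho by rewrite mulr_gt0.
have -> : kappa ^+ 3 * rho = kappa * rho * kappa ^+ 2 by ring.
by rewrite ler_wpM2l ?(ltW kr) //; lra.
Qed.

Lemma radius_chain_p (R : realFieldType) (kappa rho rS N : R) :
  0 < kappa -> kappa <= 1 -> 0 < rho -> 1 <= N -> kappa * rho / 2 <= rS ->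
  [/\ kappa ^+ 3 * rho / (4 * N) <= kappa * rS / N, kappa * rS / N <= rS & 0 < rS].
Proof.
move=> k0 k1 r0 N1 h; have kr : 0 < kappa * rho by rewrite mulr_gt0.
have rS0 : 0 < rS by lra.
have ? : kappa * rS <= 1 * rS by rewrite ler_wpM2r // ltW.
have rSN : 1 * rS <= N * rS by rewrite ler_wpM2r // ltW.
split => //; last by rewrite ler_pdivrMr; [rewrite mulrC in rSN *; lra | lra].
have -> : kappa ^+ 3 * rho / (4 * N) = (kappa ^+ 3 * rho / 4) / N by field; lra.
rewrite ler_wpM2r ?invr_ge0 //; first by lra.
have h2 : kappa * (kappa * rho / 2) <= kappa * rS by rewrite ler_wpM2l // ltW.
have : kappa * (kappa * (kappa * rho)) <= 1 * (kappa * (kappa * rho)).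
  by rewrite ler_wpM2r // !mulr_ge0 // ltW.
have : 0 < kappa * (kappa * rho) by rewrite mulr_gt0.
have -> : kappa ^+ 3 * rho = kappa * (kappa * (kappa * rho)) by ring.
lra.
Qed.

Lemma radius_chain_V (R : realFieldType) (kappa rho rS rp N : R) :
  0 < kappa -> kappa <= 1 -> 0 < rho -> 1 <= N -> kappa * rho / 2 <= rS ->
  kappa * rS / N / 2 <= rp ->
  [/\ kappa ^+ 3 * rho / (4 * N) <= kappa * rp,
      kappa ^+ 3 * rho / (8 * N) <= kappa * rp / 2 & 0 < rp].
Proof.
move=> k0 k1 r0 N1 h1 h2; have [_ _ rS0] := radius_chain_p k0 k1 r0 N1 h1.
have N0 : 0 < N by lra.
have rp0 : 0 < rp by apply: lt_le_trans h2; rewrite !divr_gt0 ?mulr_gt0.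
have h : kappa ^+ 3 * rho / (4 * N) <= kappa * rp.
  apply: le_trans (_ : kappa * (kappa * rS / N / 2) <= _); last by rewrite ler_wpM2l // ltW.
  have -> : kappa ^+ 3 * rho / (4 * N) = (kappa * (kappa / N / 2)) * (kappa * rho / 2).
    by field; rewrite gt_eqF.
  have -> : kappa * (kappa * rS / N / 2) = (kappa * (kappa / N / 2)) * rS by ring.
  by rewrite ler_wpM2l // !mulr_ge0 ?invr_ge0 // ltW.
split => //.
have -> : kappa ^+ 3 * rho / (8 * N) = kappa ^+ 3 * rho / (4 * N) / 2 by field; rewrite gt_eqF.
by rewrite ler_wpM2r ?invr_ge0.
Qed.

Lemma smoothing_error_le (R : realFieldType) (eta x al : R) :
  0 <= eta -> 0 < al -> al <= 1 -> x <= 2 / al -> eta / 2 * (1 + x) <= 2 * eta / al.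
Proof.
move=> eta0 al0 al1 hx; have ial : 1 <= al^-1 by rewrite invf_ge1.
apply: le_trans (_ : eta / 2 * (1 + 2 / al) <= _).
  by rewrite ler_wpM2l ?divr_ge0 // lerD2l.
have := ler_wpM2l eta0 ial; lra.
Qed.

(** * Either a density increment or uniform sums in a Bohr set *)

Section Key.
Variables (R : realType) (G : finComNzRingType) (e : G -> R[i]).
Hypothesis He : additive_char e.
Implicit Types (Gam : seq G) (A S T V L : {set G}).

(** Stands for the pigeonhole search, so that regular radii can be requested at will; it is verified
    once, when the parameters are fixed. *)
Definition regular_supply (kappa eps rmin : R) (dmax : nat) :=
  forall Gam rho0, (size Gam <= dmax)%N -> rmin <= rho0 -> rho0 <= 1 ->
    exists rho, [/\ rho0 / 2 <= rho, rho <= rho0 & regular e Gam rho kappa eps].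

(** Averaging over [A1] turns an estimate off a small exceptional set into one at every point: the
    set meets a translate of [A1] in a proportion of at most its size over [#|A1|]. *)
Lemma almost_period_diff A1 A2 L (X : {set G}) (t E tau : R) (s s' : G) :
  (0 < #|A1|)%N -> 0 <= t -> 0 < E ->
  #|[set u | 2 * t < `|meas R A2 L (u + s - s') - meas R A2 L u| ]|%:R * E <= 8 * #|X|%:R ->
  2 * t + 8 * #|X|%:R / E / #|A1|%:R <= tau ->
  forall u, cabs (shift_avg A1 (fun x => (meas R A2 L x)%:C%C) (u + s - s') -
       shift_avg A1 (fun x => (meas R A2 L x)%:C%C) u) <= tau.
Proof.
move=> A10 t0 E0; set exc := [set u | _] => hE htau u.
have A1' : (0 : R) < #|A1|%:R by rewrite ltr0n.
rewrite /shift_avg -avgB; apply: le_trans (cabs_avg _ _) _.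
apply: le_trans htau.
apply: le_trans (_ : avg A1 (fun x => 2 * t + (u + x \in exc)%:R) <= _).
  apply: ler_avg => x _; rewrite -rmorphB cabs_real (_ : u + s - s' + x = (u + x) + s - s'); last by ring.
  have [/andP[a1 a2] /andP[b1 b2]] := (meas_bounds R A2 L (u + x + s - s'), meas_bounds R A2 L (u + x)).
  case h : (_ \in exc).
    by rewrite mulr1n ler_norml; apply/andP; split; lra.
  by move: h; rewrite inE => /negbT; rewrite -leNgt mulr0n addr0.
rewrite /avg big_split /= sumr_const mulrDl -[(2 * t) *+ _]mulr_natr mulfK ?gt_eqF // lerD2l.
rewrite ler_wpM2r ?invr_ge0 ?ler0n // card_indic ler_pdivlMr //.
apply: le_trans hE; rewrite ler_wpM2r ?(ltW E0) // ler_nat.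
rewrite -(card_imset [set x in A1 | u + x \in exc] (addrI u)); apply: subset_leq_card.
by apply/subsetP => y /imsetP [x]; rewrite inE => /andP[_ h] ->.
Qed.

Variables (kappa eps al t eta c rmin : R) (l n N dmax : nat).
Hypotheses (k0 : 0 < kappa) (k1 : kappa <= 1) (e0 : 0 <= eps) (e1 : eps <= 1).
Hypotheses (al0 : 0 < al) (al1 : al <= 1) (t0 : 0 < t) (t1 : t <= 1) (eta0 : 0 <= eta).
Hypotheses (n0 : (0 < n)%N) (N0 : (0 < N)%N) (c0 : 0 <= c).
Hypothesis Hl : 2 * (1 / 4) ^+ l <= eta.
Hypothesis HE : 16 <= al * t * expR (t ^+ 2 * n%:R / 8).
Hypothesis HN : 8 * (2 / al) ^+ n < expR (N%:R / 32).
Hypothesis Heta : 4 * eps + N%:R * kappa <= eta.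
Hypothesis Hsup : regular_supply kappa eps rmin dmax.

Let e1_le_2 (T : finType) (B : {set T}) : (1 + eps) * #|B|%:R <= 2 * #|B|%:R :> R.
Proof. by rewrite ler_wpM2r ?ler0n // -[2]/(1 + 1) lerD2l. Qed.

Let two_div_al (B A X : {set G}) : #|X|%:R <= (1 + eps) * #|B|%:R :> R -> al * #|B|%:R <= #|A|%:R ->
  #|X|%:R <= 2 / al * #|A|%:R :> R.
Proof.
move=> h1 h2; apply: le_trans h1 (le_trans (e1_le_2 B) _).
by rewrite -mulrA ler_wpM2l // mulrC ler_pdivlMr // mulrC.
Qed.

Let al_card_gt0 (B A : {set G}) : (0 < #|B|)%N -> al * #|B|%:R <= #|A|%:R -> (0 < #|A|)%N.
Proof.
move=> h1 h2; rewrite -(ltr_nat R); apply: lt_le_trans h2.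
by rewrite mulr_gt0 // ltr0n.
Qed.

(** Sampling takes place in [A2], shifted by the narrow Bohr set of radius [rS]. By regularity the
    sums stay in a set of size at most [2 / al * #|A2|], which gives the density of [T]. Hypothesis
    [HE] makes the exceptional set cost at most [t], on top of [2 * t]. *)
Lemma exists_almost_periods Gam (rho1 rho2 rS : R) A1 A2 L :
  regular e Gam rho1 kappa eps -> regular e Gam rho2 kappa eps ->
  0 < rho1 -> 0 < rho2 -> rho2 <= kappa * rho1 -> 0 <= rS -> rS <= kappa * rho2 ->
  A2 \subset bohr e Gam rho2 -> L \subset bohr e Gam rho1 ->
  al * #|bohr e Gam rho1|%:R <= #|A1|%:R -> al * #|bohr e Gam rho2|%:R <= #|A2|%:R ->
  exists T : {set G}, [/\ T \subset bohr e Gam rS, (0 < #|T|)%N,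
    #|bohr e Gam rS|%:R <= 2 * #|T|%:R * (2 / al) ^+ n :> R &
    forall s s' u, s \in T -> s' \in T ->
      cabs (shift_avg A1 (fun x => (meas R A2 L x)%:C%C) (u + s - s') -
         shift_avg A1 (fun x => (meas R A2 L x)%:C%C) u) <= 3 * t].
Proof.
move=> reg1 reg2 r10 r20 r21 rS0 rS2 AB2 LB1 d1 d2.
pose S := bohr e Gam rS.
pose E := expR (t ^+ 2 * n%:R / 8).
pose D := bohr e Gam (rho2 + kappa * rho2).
pose X := bohr e Gam (rho1 + kappa * rho1).
have cA1 := al_card_gt0 (card_bohr_gt0 He Gam (ltW r10)) d1.
have cA2 := al_card_gt0 (card_bohr_gt0 He Gam (ltW r20)) d2.
have cX := two_div_al (regular_outer (ltW r10) (ltW k0) e0 reg1) d1.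
have cD := two_div_al (regular_outer (ltW r20) (ltW k0) e0 reg2) d2.
have [T [TS Tc Tap]] : exists T : {set G}, [/\ T \subset S, (#|S| * #|A2| ^ n <= 2 * #|T| * #|D| ^ n)%N &
    forall s s', s \in T -> s' \in T ->
      #|[set u | 2 * t < `|meas R A2 L (u + s - s') - meas R A2 L u| ]|%:R * E <= 8 * #|X|%:R].
  apply: croot_sisask => //; first by rewrite t0.
    move=> y s yA sS; apply: (subsetP (subset_bohr _ _ _)); last first.
      by apply: (bohrD He (subsetP AB2 _ yA) sS).
    by rewrite lerD2l.
  move=> u y uX yA; apply: contra uX => uL.
  rewrite -(addrK y u); apply: (subsetP (subset_bohr _ _ _)); last first.
    by apply: (bohrB He (subsetP LB1 _ uL) (subsetP AB2 _ yA)).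
  by rewrite lerD2l.
have cS : (0 < #|S|)%N by apply: (card_bohr_gt0 He).
exists T; split => //.
- rewrite lt0n; apply/eqP => T0; move: Tc; rewrite T0 muln0 mul0n leqn0 muln_eq0.
  by rewrite -(leqn0 #|S|) leqNgt cS /= expn_eq0 -(leqn0 #|A2|) leqNgt cA2.
- have cA2' : 0 < (#|A2|%:R : R) ^+ n by rewrite exprn_gt0 // ltr0n.
  have h := Tc; rewrite -(ler_nat R) !natrM !natrX in h.
  rewrite -(ler_pM2r cA2'); apply: le_trans h _.
  rewrite -[X in _ <= X]mulrA -exprMn ler_wpM2l ?mulr_ge0 ?ler0n //.
  by rewrite lerXn2r ?nnegrE ?mulr_ge0 ?ler0n ?invr_ge0 // ltW.
move=> s s' u sT s'T.
apply: (almost_period_diff cA1 (ltW t0) (expR_gt0 _) (Tap _ _ sT s'T)).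
have : 8 * #|X|%:R / E / #|A1|%:R <= t; last by lra.
rewrite ler_pdivrMr ?ltr0n // ler_pdivrMr ?expR_gt0 //.
apply: le_trans (_ : 8 * (2 / al * #|A1|%:R) <= _); first by rewrite ler_wpM2l.
rewrite (_ : 8 * (2 / al * #|A1|%:R) = 16 / al * #|A1|%:R); last by ring.
rewrite [X in _ <= X]mulrAC ler_wpM2r ?ler0n // ler_pdivrMr //; apply: le_trans HE _.
by rewrite -/E le_eqVlt; apply/orP; left; apply/eqP; ring.
Qed.

(** Chang's theorem is applied relative to a Bohr set of radius [rp], narrow enough that [N] steps
    of it stay in a [kappa]-dilation of the one containing [T]. The new Bohr set adds the
    dissociated frequencies and shrinks to radius at most [kappa * rp], so [Heta] bounds the whole
    large spectrum by [eta]. *)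
Lemma exists_smoothing_bohr Gam (rS rp : R) T :
  (size Gam + N <= dmax)%N -> regular e Gam rS kappa eps -> regular e Gam rp kappa eps ->
  0 < rS -> 0 < rp -> rp <= 1 -> N%:R * rp <= kappa * rS -> rmin <= kappa * rp ->
  T \subset bohr e Gam rS -> (0 < #|T|)%N ->
  #|bohr e Gam rS|%:R <= 2 * #|T|%:R * (2 / al) ^+ n :> R ->
  exists Gam' rV, [/\ (size Gam' <= size Gam + N)%N, kappa * rp / 2 <= rV <= kappa * rp,
    regular e Gam' rV kappa eps, bohr e Gam' rV \subset bohr e Gam (kappa * rp) &
    forall r, cabs (char_mean e T r) <= 1 / 2 \/
      forall v, v \in bohr e Gam' rV -> cabs (1 - e (r * v)) <= eta].
Proof.
move=> hsz regS regp rS0 rp0 rp1 Nrp hrm TS cT STc.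
have cS' : (0 < #|bohr e Gam rp|)%N by apply: (card_bohr_gt0 He); apply: ltW.
have krp1 : kappa * rp <= 1 by rewrite -[1]mulr1; apply: ler_pM; rewrite // ltW.
have [m [lam [mN Hlam]]] : exists (m : nat) (lam : 'I_m -> G), (m <= N)%N /\
    forall v (delta eps' : R), shift_close (bohr e Gam rp) v eps' ->
      shift_close (bohr e Gam rp) (- v) eps' ->
      (forall i, dist e (lam i) v <= delta) ->
      forall r, cabs (char_mean e T r) <= 1 / 2 \/ dist e r v <= 4 * eps' + m%:R * delta.
  apply: (chang_span He (B := fun j => bohr e Gam (rS + j%:R * rp))) => //.
  - by rewrite mul0r addr0.
  - move=> j x s hx hs; rewrite -addn1 natrD mulrDl mul1r addrA.
    exact: (bohrB He).
  - apply: (@le_lt_trans _ _ (2 * (2 * #|bohr e Gam rS|%:R))).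
      rewrite ler_wpM2l //; apply: le_trans (_ : #|bohr e Gam (rS + kappa * rS)|%:R <= _).
        by apply: le_card_bohr; rewrite lerD2l.
      exact: le_trans (regular_outer (ltW rS0) (ltW k0) e0 regS) (e1_le_2 _).
    apply: (@le_lt_trans _ _ ((8 * (2 / al) ^+ n) * #|T|%:R)); first by lra.
    by rewrite ltr_pM2r // ltr0n.
have szG : (size (Gam ++ codom lam) <= size Gam + N)%N.
  by rewrite size_cat size_codom card_ord leq_add2l.
have [rV [rV1 rV2 regV]] := Hsup (leq_trans szG hsz) hrm krp1.
have VB : bohr e (Gam ++ codom lam) rV \subset bohr e Gam (kappa * rp).
  apply/subsetP => v; rewrite bohr_cat => /andP[h _].
  exact: (subsetP (subset_bohr _ _ rV2)).
exists (Gam ++ codom lam), rV; split => //; first by rewrite rV1.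
move=> r; have [h|h] := leP (cabs (char_mean e T r)) (1 / 2); [by left | right => v vV].
have sc w : w \in bohr e (Gam ++ codom lam) rV -> shift_close (bohr e Gam rp) w eps.
  by move=> wV; apply: (regular_shift_close He (ltW rp0) (ltW k0) e0 regp); apply: (subsetP VB).
have vN : - v \in bohr e (Gam ++ codom lam) rV by rewrite (bohrN He).
have hlam i : dist e (lam i) v <= rV.
  by move: vV; rewrite bohr_cat => /andP[_ /bohrP]; apply; apply: codom_f.
case: (Hlam v rV eps (sc _ vV) (sc _ vN) hlam r) => [|].
  by move/(lt_le_trans h); rewrite ltxx.
move/le_trans; apply; apply: le_trans Heta; rewrite lerD2l.
apply: ler_pM; rewrite ?ler0n ?ler_nat //.
  by apply: le_trans rV1; rewrite divr_ge0 // mulr_ge0 // ltW.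
by apply: le_trans rV2 _; rewrite ler_piMr // ltW.
Qed.

(** The errors are those of [uniform_lower_bound], then [2 * l] replacements at cost [3 * t], then
    the spectral error, where the squares of [meas] add up to at most [#|X| <= 2 / al * #|A1|]. *)
Lemma uniform_of_smoothing (B1 V X : {set G}) A1 A2 L T :
  (0 < #|B1|)%N -> (0 < #|V|)%N -> (0 < #|A1|)%N -> (0 < #|A2|)%N -> (0 < #|T|)%N ->
  A1 \subset B1 -> L \subset B1 -> al * #|B1|%:R <= #|A1|%:R ->
  (forall u y, u \notin X -> y \in A2 -> u + y \notin L) -> #|X|%:R <= 2 / al * #|A1|%:R :> R ->
  (forall v, v \in V -> shift_close B1 v eps) -> (forall v, (- v \in V) = (v \in V)) ->
  (forall y, y \in A2 -> shift_close B1 (- y) eps) ->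
  (forall s s' u, s \in T -> s' \in T ->
      cabs (shift_avg A1 (fun x => (meas R A2 L x)%:C%C) (u + s - s') -
         shift_avg A1 (fun x => (meas R A2 L x)%:C%C) u) <= 3 * t) ->
  (forall r, cabs (char_mean e T r) <= 1 / 2 \/
      forall v, v \in V -> cabs (1 - e (r * v)) <= eta) ->
  (forall u, #|B1|%:R * #|[set v in V | u + v \in A1]|%:R <= (1 + c) * #|A1|%:R * #|V|%:R :> R) ->
  #|L|%:R / #|B1|%:R - c - eps / al - eps - 6 * l%:R * t - 2 * eta / al
    <= avg A1 (fun x => meas R A2 L x).
Proof.
move=> cB1 cV cA1 cA2 cT AB1 LB1 d1 hX cX Vc VN A2c per spec noincr.
have t3 : 0 <= 3 * t by rewrite mulr_ge0 // ltW.
have close := shift_avg_close He cA1 cV cT eta0 Hl t3 spec per.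
have U := uniform_lower_bound cB1 cV cA1 cA2 AB1 LB1 al0 c0 e0 d1 Vc VN A2c noincr.
have avgC (B : {set G}) (f : G -> R) : avg B (fun x => (f x)%:C%C) = (avg B f)%:C%C.
  by rewrite /avg rmorphM rmorph_sum fmorphV rmorph_nat.
have E1 : shift_avg A1 (fun x => (meas R A2 L x)%:C%C) 0 = (avg A1 (fun x => meas R A2 L x))%:C%C.
  by rewrite /shift_avg -avgC; apply: eq_avg => x _; rewrite add0r.
have E2 : shift_avg V (shift_avg A1 (fun x => (meas R A2 L x)%:C%C)) 0 =
   (avg V (fun v => avg A1 (fun x => meas R A2 L (v + x))))%:C%C.
  by rewrite /shift_avg -avgC; apply: eq_avg => v _; rewrite -avgC; apply: eq_avg => x _; rewrite add0r.
rewrite E1 E2 -rmorphB cabs_real in close.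
have sq : (\sum_x cabs (meas R A2 L x)%:C%C ^+ 2) / #|A1|%:R <= 2 / al.
  rewrite ler_pdivrMr ?ltr0n //; apply: le_trans cX.
  rewrite -sum1_card natr_sum [X in _ <= X]big_mkcond; apply: ler_sum => x _.
  have /andP[g0 g1] := meas_bounds R A2 L x.
  case: ifP => hx; first by rewrite cabs_real ger0_norm // exprn_ile1.
  rewrite meas_out ?cabs_real ?normr0 ?expr0n // => y yA.
  by apply: hX => //; rewrite hx.
have sq' := smoothing_error_le eta0 al0 al1 sq.
move: close; rewrite ler_norml => /andP[h _].
move: U h sq'; set W := avg V _; set W0 := avg A1 _; set sm := eta / 2 * _.
move=> U h sq'; lra.
Qed.

Lemma density_increment_or_uniform Gam (rho1 rho2 : R) A1 A2 L :
  let B1 := bohr e Gam rho1 in let B2 := bohr e Gam rho2 in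
  (size Gam + N <= dmax)%N -> regular e Gam rho1 kappa eps -> regular e Gam rho2 kappa eps ->
  0 < rho2 -> rho2 <= kappa * rho1 -> rho1 <= 1 ->
  rmin <= kappa ^+ 3 * rho2 / (4 * N%:R) ->
  A1 \subset B1 -> A2 \subset B2 -> al * #|B1|%:R <= #|A1|%:R -> al * #|B2|%:R <= #|A2|%:R ->
  L \subset B1 ->
  (exists Gam' rho' u, [/\ (size Gam' <= size Gam + N)%N,
      kappa ^+ 3 * rho2 / (8 * N%:R) <= rho' <= 1, regular e Gam' rho' kappa eps &
      (1 + c) * #|A1|%:R * #|bohr e Gam' rho'|%:R <
        #|B1|%:R * #|[set v in bohr e Gam' rho' | u + v \in A1]|%:R :> R]) \/
  #|L|%:R / #|B1|%:R - c - eps / al - eps - 6 * l%:R * t - 2 * eta / al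
    <= avg A1 (fun x => meas R A2 L x).
Proof.
move=> B1 B2 hsz reg1 reg2 r20 r21 r11 hrmin AB1 AB2 d1 d2 LB1.
have N1 : (1 : R) <= N%:R by rewrite ler1n.
have N0' : (0 : R) < N%:R by rewrite ltr0n.
have kle (x : R) : 0 < x -> kappa * x <= x by move=> x0; rewrite ler_piMl // ltW.
have r10 : 0 < rho1 by have := lt_le_trans r20 r21; rewrite pmulr_rgt0.
have r2le1 : rho2 <= 1 by apply: le_trans r21 (le_trans (kle _ r10) r11).
have hszG : (size Gam <= dmax)%N by apply: leq_trans (leq_addr _ _) hsz.
have [rS [rS1 rS2 regS]] := Hsup hszG (le_trans hrmin (radius_chain_S k0 k1 r20 N1))
  (le_trans (kle _ r20) r2le1).
have [th1 th2 rS0] := radius_chain_p k0 k1 r20 N1 rS1.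
have rSle2 : rS <= rho2 by apply: le_trans rS2 (kle _ r20).
have rSle1 : rS <= 1 by apply: le_trans rSle2 r2le1.
have [rp [rp1 rp2 regp]] := Hsup hszG (le_trans hrmin th1) (le_trans th2 rSle1).
have [th3 th4 rp0] := radius_chain_V k0 k1 r20 N1 rS1 rp1.
have rpleS : rp <= rS by apply: le_trans rp2 th2.
have Nrp : N%:R * rp <= kappa * rS by rewrite mulrC -ler_pdivlMr.
have [T [TS cT STc per]] := exists_almost_periods reg1 reg2 r10 r20 r21 (ltW rS0) rS2 AB2 LB1 d1 d2.
have [Gam' [rV [szG /andP[rV1 rV2] regV VB spec]]] :=
  exists_smoothing_bohr hsz regS regp rS0 rp0 (le_trans rpleS rSle1) Nrp (le_trans hrmin th3) TS cT STc.
have rV0 : 0 < rV by apply: lt_le_trans rV1; rewrite divr_gt0 // mulr_gt0.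
have rVle1 : rV <= 1.
  exact: le_trans rV2 (le_trans (kle _ rp0) (le_trans rpleS rSle1)).
have [incr|noincr] := EM (exists u, (1 + c) * #|A1|%:R * #|bohr e Gam' rV|%:R <
        #|B1|%:R * #|[set v in bohr e Gam' rV | u + v \in A1]|%:R :> R).
  left; case: incr => u hu; exists Gam', rV, u; split => //.
  by rewrite rVle1 andbT; apply: le_trans rV1.
right.
have cB1 : (0 < #|B1|)%N by apply: (card_bohr_gt0 He); apply: ltW.
have cB2 : (0 < #|B2|)%N by apply: (card_bohr_gt0 He); apply: ltW.
have cX := two_div_al (regular_outer (ltW r10) (ltW k0) e0 reg1) d1.
apply: (uniform_of_smoothing cB1 _ (al_card_gt0 cB1 d1) (al_card_gt0 cB2 d2) cT AB1 LB1 d1 _ cX _ _ _ per spec).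
- by apply: (card_bohr_gt0 He); apply: ltW.
- move=> u y uX yA; apply: contra uX => uL.
  rewrite -(addrK y u); apply: (subsetP (subset_bohr _ _ _)); last first.
    by apply: (bohrB He (subsetP LB1 _ uL) (subsetP AB2 _ yA)).
  by rewrite lerD2l.
- move=> v /(subsetP VB) hv; apply: (regular_shift_close He (ltW r10) (ltW k0) e0 reg1).
  apply: (subsetP (subset_bohr _ _ _)) hv; apply: le_trans (kle _ rp0) _.
  exact: le_trans rpleS (le_trans rSle2 r21).
- by move=> v; rewrite (bohrN He).
- move=> y yA; apply: (regular_shift_close He (ltW r10) (ltW k0) e0 reg1).
  by rewrite (bohrN He); apply: (subsetP (subset_bohr _ _ r21)); apply: (subsetP AB2).
- by move=> u; rewrite leNgt; apply/negP => h; apply: noincr; exists u.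
Qed.
End Key.

(** * Counting solutions in a finite ring *)

Section Tuples.
Variables (T : finType) (V : nmodType).

Definition fcons n (x : T) (f : {ffun 'I_n -> T}) : {ffun 'I_n.+1 -> T} :=
  [ffun i => if unlift ord0 i is Some j then f j else x].

Lemma fcons0 n x (f : {ffun 'I_n -> T}) : fcons x f ord0 = x.
Proof. by rewrite ffunE unlift_none. Qed.

Lemma fcons_lift n x (f : {ffun 'I_n -> T}) j : fcons x f (lift ord0 j) = f j.
Proof. by rewrite ffunE liftK. Qed.

Lemma fcons_bij n : bijective (fun p : T * {ffun 'I_n -> T} => fcons p.1 p.2).
Proof.
exists (fun f : {ffun 'I_n.+1 -> T} => (f ord0, [ffun j => f (lift ord0 j)])).
  by move=> [x f] /=; rewrite fcons0; congr pair; apply/ffunP => j; rewrite ffunE fcons_lift.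
move=> f; apply/ffunP => i /=; case: (unliftP ord0 i) => [j|] ->.
  by rewrite fcons_lift ffunE.
by rewrite fcons0.
Qed.

Lemma sum_family_cons n (A : 'I_n.+1 -> {set T}) (F : {ffun 'I_n.+1 -> T} -> V) :
  \sum_(f : {ffun 'I_n.+1 -> T} | [forall i, f i \in A i]) F f =
  \sum_(x in A ord0) \sum_(f : {ffun 'I_n -> T} | [forall i, f i \in A (lift ord0 i)]) F (fcons x f).
Proof.
rewrite pair_big_dep /= (reindex (fun p : T * {ffun 'I_n -> T} => fcons p.1 p.2)) /=; last first.
  exact/onW_bij/fcons_bij.
apply: eq_bigl => [[x f]] /=; apply/forallP/andP => [h|[hx /forallP hf] i].
  split; first by have := h ord0; rewrite fcons0.
  by apply/forallP => j; have := h (lift ord0 j); rewrite fcons_lift.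
by case: (unliftP ord0 i) => [j|] ->; rewrite ?fcons0 ?fcons_lift.
Qed.
End Tuples.

Lemma sum_fcons (G : nmodType) (T : finType) n x (f : {ffun 'I_n -> T}) (h : 'I_n.+1 -> T -> G) :
  \sum_i h i (fcons x f i) = h ord0 x + \sum_i h (lift ord0 i) (f i).
Proof.
rewrite big_ord_recl fcons0; congr (_ + _).
by apply: eq_bigr => i _; rewrite fcons_lift.
Qed.

Section FourSets.
Variables (R : realType) (G : finComNzRingType).
Variables (B A0 A1 A2 A3 : {set G}) (eps : R) (s : G).
Hypotheses (B0 : (0 < #|B|)%N) (A20 : (0 < #|A2|)%N) (A30 : (0 < #|A3|)%N).
Hypotheses (A00 : (0 < #|A0|)%N) (A10 : (0 < #|A1|)%N).
Hypothesis eps8 : eps <= 1 / 8.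
Hypothesis BN : forall x, (- x \in B) = (x \in B).
Hypothesis sB : shift_close B (- s) eps.
Hypothesis unif01 : forall L : {set G}, L \subset B ->
  #|L|%:R / #|B|%:R - 1 / 8 <= avg A0 (fun x => meas R A1 L x).
Hypothesis unif23 : forall L : {set G}, L \subset B ->
  #|L|%:R / #|B|%:R - 1 / 8 <= avg A2 (fun x => meas R A3 L x).

Lemma avg_measE (X Y L : {set G}) : (0 < #|X|)%N -> (0 < #|Y|)%N ->
  avg X (fun x => meas R Y L x) * (#|X|%:R * #|Y|%:R) =
  \sum_(x in X) \sum_(y in Y) (x + y \in L)%:R.
Proof.
move=> X0 Y0; rewrite /avg /meas /avg -mulr_suml; field.
by rewrite !pnatr_eq0 -!lt0n X0 Y0.
Qed.

(** At least half of the pairs from [A0] and [A1] have a sum whose complement to [s] is hit by more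
    than [#|A2| * #|A3| / (8 * #|B|)] pairs from [A2] and [A3]; the product of 1/2 and 1/8 is the
    constant 1/16. *)
Lemma four_sets_count :
  #|A0|%:R * #|A1|%:R * #|A2|%:R * #|A3|%:R / (16 * #|B|%:R) <=
  \sum_(x0 in A0) \sum_(x1 in A1) \sum_(x2 in A2) \sum_(x3 in A3)
     (x0 + x1 + x2 + x3 == s)%:R :> R.
Proof.
have eps8' : eps <= 1 / 8 by [].
have B' : (0 : R) < #|B|%:R by rewrite ltr0n.
have A0' : (0 : R) < #|A0|%:R by rewrite ltr0n.
have A1' : (0 : R) < #|A1|%:R by rewrite ltr0n.
have A2' : (0 : R) < #|A2|%:R by rewrite ltr0n.
have A3' : (0 : R) < #|A3|%:R by rewrite ltr0n.
pose r (x : G) : R := \sum_(x2 in A2) \sum_(x3 in A3) (x2 + x3 == x)%:R.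
have r0 x : 0 <= r x by apply: sumr_ge0 => y _; apply: sumr_ge0 => z _; rewrite ler0n.
(* Sums from [A2 + A3] rarely land in the unpopular set [L], so [L] is small. *)
pose L := [set x in B | r x <= #|A2|%:R * #|A3|%:R / (8 * #|B|%:R)].
have LB : L \subset B by apply/subsetP => x; rewrite inE => /andP[].
have L4 : #|L|%:R <= #|B|%:R / 4 :> R.
  have h1 : avg A2 (fun x => meas R A3 L x) * (#|A2|%:R * #|A3|%:R) <=
      1 / 8 * (#|A2|%:R * #|A3|%:R).
    rewrite avg_measE //.
    have -> : \sum_(x in A2) \sum_(y in A3) (x + y \in L)%:R = \sum_(z in L) r z :> R.
      rewrite /r [RHS]exchange_big /=; apply: eq_bigr => x _; rewrite [RHS]exchange_big /=.
      apply: eq_bigr => y _; case h : (x + y \in L).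
        rewrite (bigD1 (x + y)) //= eqxx big1 ?addr0 // => z /andP[_ /negbTE].
        by rewrite eq_sym => ->.
      rewrite big1 // => z zL; case: eqP => // E; by rewrite E zL in h.
    apply: le_trans (_ : \sum_(z in L) #|A2|%:R * #|A3|%:R / (8 * #|B|%:R) <= _).
      by apply: ler_sum => z; rewrite inE => /andP[].
    rewrite sumr_const -[X in X <= _]mulr_natr.
    have LB' : #|L|%:R <= #|B|%:R :> R by rewrite ler_nat subset_leq_card.
    apply: le_trans (_ : #|A2|%:R * #|A3|%:R / (8 * #|B|%:R) * #|B|%:R <= _).
      by rewrite ler_wpM2l // divr_ge0 ?mulr_ge0 ?ler0n.
    by rewrite le_eqVlt; apply/orP; left; apply/eqP; field; rewrite gt_eqF.
  rewrite ler_pM2r ?mulr_gt0 // in h1.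
  have h2 := le_trans (unif23 LB) h1.
  by move: h2; rewrite lerBlDr ler_pdivrMr //; lra.
(* Sums with a popular complement. Of [B] at most a quarter is lost to [L] and an eighth to the
   boundary, leaving 5/8; uniformity then loses another 1/8. *)
pose P := [set x in B | s - x \in B :\: L].
have PB : P \subset B by apply/subsetP => x; rewrite inE => /andP[].
have P5 : 5 / 8 * #|B|%:R <= #|P|%:R :> R.
  have h : (#|B| <= #|P| + #|[set x in B | (x - s)%R \notin B]| + #|L|)%N.
    have -> : #|L| = #|[set (s - x)%R | x in L]|.
      by rewrite card_imset // => x y /addrI /oppr_inj.
    apply: leq_trans (_ : #|P :|: [set x in B | (x - s)%R \notin B]| + #|[set (s - x)%R | x in L]| <= _)%N; last first.
      by rewrite leq_add2r leq_card_setU.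
    apply: leq_trans (leq_card_setU _ _); apply: subset_leq_card; apply/subsetP => x xB.
    rewrite !in_setU !in_set xB /= -(BN (x - s)) opprB.
    case h1 : (s - x \in B); last by rewrite orbT.
    rewrite andbT orbF; case h2 : (r (s - x) <= _) => //=.
    by apply/imsetP; exists (s - x); rewrite ?inE ?h1 ?h2 // opprB addrC subrK.
  have := sB; rewrite /shift_close => h2.
  rewrite -(ler_nat R) !natrD in h.
  have h3 : eps * #|B|%:R <= 1 / 8 * #|B|%:R by rewrite ler_wpM2r // ltW.
  lra.
have h01 : 1 / 2 * (#|A0|%:R * #|A1|%:R) <= \sum_(x in A0) \sum_(y in A1) (x + y \in P)%:R :> R.
  rewrite -avg_measE // ler_pM2r ?mulr_gt0 //; apply: le_trans (unif01 PB).
  have : 5 / 8 <= #|P|%:R / #|B|%:R :> R by rewrite ler_pdivlMr.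
  lra.
have hr x : x \in P -> #|A2|%:R * #|A3|%:R / (8 * #|B|%:R) <= r (s - x).
  rewrite !inE => /andP[_ /andP[h sx]].
  by move: h; rewrite sx /= -ltNge => /ltW.
apply: le_trans (_ : (#|A2|%:R * #|A3|%:R / (8 * #|B|%:R)) *
   \sum_(x in A0) \sum_(y in A1) (x + y \in P)%:R <= _).
  apply: le_trans (ler_wpM2l _ h01); last by rewrite divr_ge0 ?mulr_ge0 ?ler0n.
  by rewrite le_eqVlt; apply/orP; left; apply/eqP; field; rewrite gt_eqF.
rewrite mulr_sumr; apply: ler_sum => x _; rewrite mulr_sumr; apply: ler_sum => y _.
have -> : \sum_(x2 in A2) \sum_(x3 in A3) (x + y + x2 + x3 == s)%:R = r (s - (x + y)).
  apply: eq_bigr => x2 _; apply: eq_bigr => x3 _; congr (_%:R : R); congr nat_of_bool.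
  by rewrite -subr_eq0 -[RHS]subr_eq0; congr (_ == 0); ring.
by case h : (_ \in P); rewrite ?mulr1 ?mulr0 // hr.
Qed.
End FourSets.

Lemma exists_ge_avg (R : realFieldType) (T : finType) (B : {set T}) (f : T -> R) (c : R) :
  (0 < #|B|)%N -> c * #|B|%:R <= \sum_(y in B) f y -> exists2 y, y \in B & c <= f y.
Proof.
move=> B0 h; apply/exists_inP; apply: contraT; rewrite negb_exists_in => /forall_inP K.
have [y0 y0B] := card_gt0P B0.
have : \sum_(y in B) f y < \sum_(y in B) c.
  apply: ltr_sum => [|y yB]; last by rewrite ltNge; apply: K.
  by apply/hasP; exists y0; rewrite ?mem_index_enum.
by rewrite sumr_const -[X in _ < X]mulr_natr ltNge h.
Qed.

Lemma exchange_sum4 (V : nmodType) (T I : finType) (P : pred I) (A0 A1 A2 A3 : {set T})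
    (F : T -> T -> T -> T -> I -> V) :
  \sum_(x0 in A0) \sum_(x1 in A1) \sum_(x2 in A2) \sum_(x3 in A3) \sum_(f | P f) F x0 x1 x2 x3 f =
  \sum_(f | P f) \sum_(x0 in A0) \sum_(x1 in A1) \sum_(x2 in A2) \sum_(x3 in A3) F x0 x1 x2 x3 f.
Proof.
rewrite [RHS]exchange_big; apply: eq_bigr => x0 _.
rewrite [RHS]exchange_big; apply: eq_bigr => x1 _.
rewrite [RHS]exchange_big; apply: eq_bigr => x2 _.
by rewrite [RHS]exchange_big.
Qed.

Lemma sum_family_const (R : comNzRingType) (T : finType) n (A : 'I_n -> {set T}) (c : R) :
  \sum_(f : {ffun 'I_n -> T} | [forall i, f i \in A i]) c = c * \prod_i #|A i|%:R.
Proof.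
have -> : \prod_i #|A i|%:R = \prod_i \sum_(x in A i) 1 :> R.
  by apply: eq_bigr => i _; rewrite sumr_const.
rewrite bigA_distr_big_dep mulr_sumr; apply: eq_big => f; first by apply/forallP/familyP.
by rewrite big1 ?mulr1.
Qed.

Section Solutions.
Variables (G : finComNzRingType) (k : nat) (a : 'I_k -> int).
Implicit Types A : {set G}.

Definition nsol_ring A : nat :=
  #|[set x : {ffun 'I_k -> G} | [forall i, x i \in A] && (\sum_i (a i)%:~R * x i == 0)]|.

(** Coefficients summing to zero make the equation invariant under affine maps, so solutions found
    inside an increment pull back to the original set. *)
Lemma nsol_ring_affine A (w q : G) : \sum_i a i = 0 -> injective (fun b => q * b) ->
  (nsol_ring [set v | (w + q * v)%R \in A] <= nsol_ring A)%N.
Proof.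
move=> a0 qinj; rewrite /nsol_ring.
pose h (x : {ffun 'I_k -> G}) : {ffun 'I_k -> G} := [ffun i => w + q * x i].
have hinj : injective h.
  move=> x x' /ffunP E; apply/ffunP => i; have := E i; rewrite !ffunE.
  by move/addrI/qinj.
rewrite -(card_imset _ hinj); apply: subset_leq_card; apply/subsetP => y /imsetP [x].
rewrite inE => /andP[/forallP xA /eqP xs] ->; rewrite inE; apply/andP; split.
  by apply/forallP => i; have := xA i; rewrite inE ffunE.
rewrite (eq_bigr (fun i => (a i)%:~R * w + q * ((a i)%:~R * x i))) => [|i _]; last by rewrite ffunE; ring.
by rewrite big_split /= -mulr_suml -mulr_sumr xs -rmorph_sum a0 rmorph0 mul0r mulr0 addr0.
Qed.
End Solutions.

(** The [k] densities average nearly [alpha] and none is much larger, so none is much smaller. The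
    excesses of the others cost less than [alpha / 128], and [k * eps <= al / 64 <= alpha / 128],
    which together leave 63/64. *)
Lemma one_coordinate_ge (R : realFieldType) (k alpha eps al F S : R) :
  4 <= k -> 0 < alpha -> 2 * al <= alpha -> 64 * k * eps <= al ->
  k * (alpha - eps) <= F + S -> S <= (k - 1) * (alpha * (1 + 1 / (128 * k))) ->
  63 / 64 * alpha <= F.
Proof.
move=> k4 alpha0 h1 h2 h3 h4; have k0 : 0 < k by lra.
have E : (k - 1) * (alpha * (1 + 1 / (128 * k))) =
    k * alpha + alpha / 128 - alpha - alpha * (1 / (128 * k)) by field; rewrite gt_eqF.
have E2 : 0 <= alpha * (1 / (128 * k)).
  by apply: mulr_ge0; [exact: ltW | apply: divr_ge0 => //; apply: mulr_ge0 => //; exact: ltW].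
lra.
Qed.

Lemma increment_ge (R : realFieldType) (k alpha B A : R) :
  1 <= k -> 0 < alpha -> 0 <= B -> 63 / 64 * alpha * B <= A ->
  alpha * (1 + 1 / (128 * k)) * B <= (1 + 1 / 16) * A.
Proof.
move=> k1 alpha0 B0 h; set y := 1 / (128 * k).
have y1 : y <= 1 / 128.
  by rewrite /y !mul1r lef_pV2 ?posrE ?mulr_gt0 //; lra.
have aB : 0 <= alpha * B by rewrite mulr_ge0 // ltW.
have : alpha * B * y <= alpha * B * (1 / 128) by rewrite ler_wpM2l.
lra.
Qed.

(** Two reductions by [kappa / H] precede the chain [kappa], [kappa / N], [kappa]: dilating by some
    [q i] may enlarge a radius by [H], and the dilated set must still be narrow in the previous
    one. *)
Lemma radius_chain (R : realFieldType) (kappa rho rho1 rho2 N H : R) :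
  0 < kappa -> kappa <= 1 -> 0 < rho -> 1 <= N -> 1 <= H ->
  kappa * rho / H / 2 <= rho1 -> kappa * rho1 / H / 2 <= rho2 ->
  [/\ kappa ^+ 2 * rho / (4 * H ^+ 2) <= rho2,
      kappa ^+ 5 * rho / (16 * N * H ^+ 2) <= kappa ^+ 3 * rho2 / (4 * N),
      kappa ^+ 5 * rho / (32 * N * H ^+ 2) <= kappa ^+ 3 * rho2 / (8 * N),
      kappa ^+ 5 * rho / (32 * N * H ^+ 2) <= rho2 &
      kappa ^+ 5 * rho / (16 * N * H ^+ 2) <= kappa * rho1 / H /\
      kappa ^+ 5 * rho / (16 * N * H ^+ 2) <= kappa * rho / H].
Proof.
move=> k0 k1 r0 N1 H1.
have N0 : 0 < N by lra.
have H0 : 0 < H by lra.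
pose u := kappa / H; pose w := kappa ^+ 3 / N.
have u0 : 0 < u by rewrite divr_gt0.
have u1 : u <= 1 by rewrite ler_pdivrMr // mul1r (le_trans k1).
have w0 : 0 < w by rewrite divr_gt0 // exprn_gt0.
have w1 : w <= 1.
  by rewrite ler_pdivrMr // mul1r; apply: le_trans N1; apply: exprn_ile1; rewrite // ltW.
have -> : kappa * rho / H / 2 = u * rho / 2 by rewrite /u; field; rewrite gt_eqF.
have -> : kappa * rho1 / H / 2 = u * rho1 / 2 by rewrite /u; field; rewrite gt_eqF.
have -> : kappa * rho1 / H = u * rho1 by rewrite /u; field; rewrite gt_eqF.
have -> : kappa * rho / H = u * rho by rewrite /u; field; rewrite gt_eqF.
have -> : kappa ^+ 2 * rho / (4 * H ^+ 2) = u * (u * rho) / 4 by rewrite /u; field; rewrite gt_eqF.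
have -> : kappa ^+ 5 * rho / (16 * N * H ^+ 2) = w * (u * (u * rho)) / 16.
  by rewrite /u /w; field; rewrite !gt_eqF.
have -> : kappa ^+ 5 * rho / (32 * N * H ^+ 2) = w * (u * (u * rho)) / 32.
  by rewrite /u /w; field; rewrite !gt_eqF.
have -> : kappa ^+ 3 * rho2 / (4 * N) = w * rho2 / 4 by rewrite /w; field; rewrite gt_eqF.
have -> : kappa ^+ 3 * rho2 / (8 * N) = w * rho2 / 8 by rewrite /w; field; rewrite gt_eqF.
clearbody u w; move: u0 u1 w0 w1 r0; clear; move=> u0 u1 w0 w1 r0 h1 h2.
have ur0 : 0 < u * rho by rewrite mulr_gt0.
have uur0 : 0 < u * (u * rho) by rewrite mulr_gt0.
have h3 : u * (u * rho) <= 1 * (u * rho) by rewrite ler_wpM2r // ltW.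
have h4 : w * (u * (u * rho)) <= 1 * (u * (u * rho)) by rewrite ler_wpM2r // ltW.
have h5 : u * (u * rho / 2) <= u * rho1 by rewrite ler_wpM2l // ltW.
have h6 : u * (u * rho) / 4 <= rho2 by lra.
have h7 : w * (u * (u * rho) / 4) <= w * rho2 by rewrite ler_wpM2l // ltW.
by split; [| | | |split]; lra.
Qed.

(** * One step of the density increment and its iteration *)

Section Step.
Variables (R : realType) (G : finComNzRingType) (e : G -> R[i]).
Hypothesis He : additive_char e.
Variables (m : nat) (a q : 'I_m.+4 -> int) (P : int) (H : nat).
Hypotheses (Ha : \sum_i a i = 0) (Hq : forall i, a i * q i = P).
Hypothesis (Hinj : forall i, injective (fun b : G => (q i)%:~R * b)).
Hypotheses (HH : forall i, (`|q i| <= H)%N) (mH : (m.+4 <= H)%N).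
Variables (kappa eps al t eta rmin : R) (l n N dmax : nat).
Hypotheses (k0 : 0 < kappa) (k1 : kappa <= 1) (e0 : 0 <= eps) (e1 : eps <= 1 / 8).
Hypotheses (al0 : 0 < al) (al1 : al <= 1) (t0 : 0 < t) (t1 : t <= 1) (eta0 : 0 <= eta).
Hypotheses (n0 : (0 < n)%N) (N0 : (0 < N)%N).
Hypothesis Hl : 2 * (1 / 4) ^+ l <= eta.
Hypothesis HE : 16 <= al * t * expR (t ^+ 2 * n%:R / 8).
Hypothesis HN : 8 * (2 / al) ^+ n < expR (N%:R / 32).
Hypothesis Heta : 4 * eps + N%:R * kappa <= eta.
Hypothesis Herr : eps / al + eps + 6 * l%:R * t + 2 * eta / al <= 1 / 16.
Hypothesis Heps : 64 * m.+4%:R * eps <= al.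
Hypothesis Hsup : regular_supply e kappa eps rmin dmax.

(** The allowed error 1/8 is shared equally between the increment constant [c = 1 / 16] and the
    terms of [Herr]. *)
Lemma unif_or_incr (Gam : seq G) (rho1 rho2 : R) (A1 A2 : {set G}) :
  let B1 := bohr e Gam rho1 in let B2 := bohr e Gam rho2 in
  (size Gam + N <= dmax)%N -> regular e Gam rho1 kappa eps -> regular e Gam rho2 kappa eps ->
  0 < rho2 -> rho2 <= kappa * rho1 -> rho1 <= 1 ->
  rmin <= kappa ^+ 3 * rho2 / (4 * N%:R) ->
  A1 \subset B1 -> A2 \subset B2 -> al * #|B1|%:R <= #|A1|%:R -> al * #|B2|%:R <= #|A2|%:R ->
  ~ (exists (Gam' : seq G) (rho' : R) (u : G), [/\ (size Gam' <= size Gam + N)%N,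
      kappa ^+ 3 * rho2 / (8 * N%:R) <= rho' <= 1, regular e Gam' rho' kappa eps &
      (1 + 1 / 16) * #|A1|%:R * #|bohr e Gam' rho'|%:R <
        #|B1|%:R * #|[set v in bohr e Gam' rho' | u + v \in A1]|%:R :> R]) ->
  forall L : {set G}, L \subset B1 ->
  #|L|%:R / #|B1|%:R - 1 / 8 <= avg A1 (fun x => meas R A2 L x).
Proof.
move=> B1 B2 h1 h2 h3 h4 h5 h6 h7 h8 h9 h10 h11 noinc L LB.
have e1' : eps <= 1 by apply: le_trans e1 _; lra.
have c0 : 0 <= 1 / 16 :> R by lra.
case: (density_increment_or_uniform He k0 k1 e0 e1' al0 al1 t0 t1 eta0 n0 N0 c0 Hl HE HN Heta Hsup
   h1 h2 h3 h4 h5 h6 h7 h8 h9 h10 h11 LB) => // h.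
apply: le_trans h; have := Herr; rewrite -/B1; set x := _ / #|B1|%:R; lra.
Qed.

Lemma popular_translate (Gam : seq G) (rho : R) (z : G) (A : {set G}) (alpha : R) :
  0 < rho -> regular e Gam rho kappa eps -> z \in bohr e Gam (kappa * rho) ->
  alpha * #|bohr e Gam rho|%:R <= #|A :&: bohr e Gam rho|%:R ->
  (alpha - eps) * #|bohr e Gam rho|%:R <= #|[set y in bohr e Gam rho | y + z \in A]|%:R.
Proof.
move=> r0 reg hz d; set B := bohr e Gam rho in d *.
have zN : - z \in bohr e Gam (kappa * rho) by rewrite (bohrN He).
have := regular_shift_close He (ltW r0) (ltW k0) e0 reg zN; rewrite /shift_close -/B => h1.
have h2 : (#|A :&: B| <= #|[set y in B | (y + z)%R \in A]| + #|[set x in B | (x - z)%R \notin B]|)%N.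
  rewrite -(card_imset [set y in B | y + z \in A] (addIr z)).
  apply: leq_trans (leq_card_setU _ _); apply: subset_leq_card.
  apply/subsetP => w; rewrite in_setI => /andP[wA wB]; rewrite in_setU.
  case h : (w - z \in B); last by apply/orP; right; rewrite in_set wB h.
  apply/orP; left; apply/imsetP; exists (w - z); last by rewrite subrK.
  by rewrite in_set h subrK.
rewrite -(ler_nat R) natrD in h2; lra.
Qed.

Lemma count_of_uniform (Gam : seq G) (rho1 rho2 alpha : R) (y : G) (A : {set G})
    (B1 B2 : {set G}) (As : 'I_m.+4 -> {set G}) :
  B1 = bohr e Gam rho1 -> B2 = bohr e Gam rho2 ->
  regular e Gam rho1 kappa eps -> 0 < rho1 -> 0 < rho2 -> H%:R * rho2 <= kappa * rho1 ->
  0 < alpha ->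
  (forall i x, x \in As i -> y + (q i)%:~R * x \in A) ->
  let i0 : 'I_m.+4 := ord0 in let i1 := lift i0 ord0 in
  let i2 := lift i0 (lift ord0 ord0) in let i3 := lift i0 (lift ord0 (lift ord0 ord0)) in
  alpha * #|B1|%:R <= #|As i0|%:R -> alpha * #|B2|%:R <= #|As i1|%:R ->
  alpha * #|B1|%:R <= #|As i2|%:R -> alpha * #|B2|%:R <= #|As i3|%:R ->
  (forall j : 'I_m, let i := lift i0 (lift ord0 (lift ord0 (lift ord0 j))) in
     As i \subset B2 /\ alpha * #|B2|%:R <= #|As i|%:R) ->
  (forall L : {set G}, L \subset B1 ->
    #|L|%:R / #|B1|%:R - 1 / 8 <= avg (As i0) (fun x => meas R (As i1) L x)) ->
  (forall L : {set G}, L \subset B1 ->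
    #|L|%:R / #|B1|%:R - 1 / 8 <= avg (As i2) (fun x => meas R (As i3) L x)) ->
  1 / 16 * alpha ^+ m.+4 * #|B2|%:R ^+ m.+3 <= (nsol_ring a A)%:R.
Proof.
move=> B1E B2E reg1 r10 r20 hr2 alpha0 hA i0 i1 i2 i3 d0 d1 d2 d3 dr u01 u23.
have cB1 : (0 < #|B1|)%N by rewrite B1E; apply: (card_bohr_gt0 He); apply: ltW.
have cB2 : (0 < #|B2|)%N by rewrite B2E; apply: (card_bohr_gt0 He); apply: ltW.
have pos (B A' : {set G}) : (0 < #|B|)%N -> alpha * #|B|%:R <= #|A'|%:R -> (0 < #|A'|)%N.
  move=> h1 h2; rewrite -(ltr_nat R); apply: lt_le_trans h2.
  by rewrite mulr_gt0 // ltr0n.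
have B1' : (0 : R) < #|B1|%:R by rewrite ltr0n.
have B2' : (0 : R) < #|B2|%:R by rewrite ltr0n.
have r21 : rho2 <= rho1.
  have : 1 * rho2 <= H%:R * rho2 by rewrite ler_wpM2r ?ler1n ?(leq_trans _ mH) // ltW.
  have : kappa * rho1 <= 1 * rho1 by rewrite ler_wpM2r // ltW.
  lra.
have B21 : #|B2|%:R <= #|B1|%:R :> R by rewrite B1E B2E; apply: le_card_bohr.
pose Ar (j : 'I_m) := As (lift i0 (lift ord0 (lift ord0 (lift ord0 j)))).
pose sols := [set x : {ffun 'I_m.+4 -> G} | [forall i, x i \in As i] && (\sum_i x i == 0)].
have cs : (#|sols| <= nsol_ring a A)%N.
  pose h (x : {ffun 'I_m.+4 -> G}) : {ffun 'I_m.+4 -> G} := [ffun i => y + (q i)%:~R * x i].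
  have hinj : injective h.
    move=> x x' /ffunP E; apply/ffunP => i; have := E i; rewrite !ffunE.
    by move/addrI/Hinj.
  rewrite -(card_imset _ hinj); apply: subset_leq_card; apply/subsetP => z /imsetP [x].
  rewrite /sols in_set => /andP[/forallP xA /eqP xs] ->; rewrite inE; apply/andP; split.
    by apply/forallP => i; rewrite ffunE; apply: hA.
  rewrite (eq_bigr (fun i => (a i)%:~R * y + P%:~R * x i)) => [|i _].
    by rewrite big_split /= -mulr_suml -mulr_sumr xs -rmorph_sum Ha rmorph0 mul0r mulr0 addr0.
  by rewrite ffunE -(Hq i) rmorphM; ring.
apply: le_trans (_ : #|sols|%:R <= _); last by rewrite ler_nat.
have -> : #|sols|%:R = \sum_(x : {ffun 'I_m.+4 -> G} | [forall i, x i \in As i]) (\sum_i x i == 0)%:R :> R.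
  rewrite -sum1_card natr_sum big_mkcond [RHS]big_mkcond /=; apply: eq_bigr => x _.
  by rewrite inE; case: [forall i, _]; case: (_ == 0).
have -> : \sum_(x : {ffun 'I_m.+4 -> G} | [forall i, x i \in As i]) (\sum_i x i == 0)%:R =
   \sum_(f : {ffun 'I_m -> G} | [forall j, f j \in Ar j])
   \sum_(x0 in As i0) \sum_(x1 in As i1) \sum_(x2 in As i2) \sum_(x3 in As i3)
     (x0 + x1 + x2 + x3 == - \sum_j f j)%:R :> R.
  rewrite -exchange_sum4 sum_family_cons; apply: eq_bigr => x0 _.
  rewrite sum_family_cons; apply: eq_bigr => x1 _.
  rewrite sum_family_cons; apply: eq_bigr => x2 _.
  rewrite sum_family_cons; apply: eq_bigr => x3 _.
  apply: eq_bigr => f _; rewrite !(sum_fcons _ _ (fun=> id)) -[in RHS]subr_eq0 opprK.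
  by congr ((_ == 0)%:R); ring.
(* For each choice [f] of the last [m] coordinates the first four are counted with target
   [- \sum_j f j]. It hardly shifts [B1], because [m * rho2 <= H * rho2 <= kappa * rho1]. *)
apply: le_trans (_ : \sum_(f : {ffun 'I_m -> G} | [forall j, f j \in Ar j])
   #|As i0|%:R * #|As i1|%:R * #|As i2|%:R * #|As i3|%:R / (16 * #|B1|%:R) <= _).
  rewrite sum_family_const.
  have pr : (alpha * #|B2|%:R) ^+ m <= \prod_j #|Ar j|%:R :> R.
    rewrite -[in X in X <= _](card_ord m) -prodr_const; apply: ler_prod => j _.
    by rewrite mulr_ge0 ?ler0n ?(ltW alpha0) //=; have [] := dr j.
  have h1 : (alpha * #|B1|%:R) * (alpha * #|B2|%:R) * (alpha * #|B1|%:R) * (alpha * #|B2|%:R)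
     <= #|As i0|%:R * #|As i1|%:R * #|As i2|%:R * #|As i3|%:R.
    by do 3! (apply: ler_pM; rewrite ?mulr_ge0 ?ler0n ?(ltW alpha0) //).
  apply: le_trans (_ : (alpha * #|B1|%:R) * (alpha * #|B2|%:R) * (alpha * #|B1|%:R) * (alpha * #|B2|%:R)
     / (16 * #|B1|%:R) * (alpha * #|B2|%:R) ^+ m <= _); last first.
    apply: ler_pM => //; rewrite ?exprn_ge0 ?divr_ge0 ?mulr_ge0 ?ler0n ?(ltW alpha0) //.
    by rewrite ler_pM2r ?invr_gt0 ?mulr_gt0.
  apply: le_trans (_ : 1 / 16 * alpha ^+ m.+4 * (#|B1|%:R * #|B2|%:R ^+ m.+2) <= _); last first.
    by rewrite le_eqVlt; apply/orP; left; apply/eqP; rewrite exprMn !exprS; field; rewrite gt_eqF.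
  have c16 : 0 <= 1 / 16 * alpha ^+ m.+4 by rewrite mulr_ge0 ?exprn_ge0 ?(ltW alpha0) ?divr_ge0.
  by rewrite [_ ^+ m.+3]exprS ler_wpM2l // ler_wpM2r // exprn_ge0 ?ler0n.
apply: ler_sum => f /forallP hf.
apply: (four_sets_count cB1 (pos _ _ cB1 d2) (pos _ _ cB2 d3) (pos _ _ cB1 d0) (pos _ _ cB2 d1) e1) => //.
  by move=> x; rewrite B1E (bohrN He).
rewrite opprK B1E; apply: (regular_shift_close He (ltW r10) (ltW k0) e0 reg1).
apply: (subsetP (subset_bohr _ _ (_ : m%:R * rho2 <= _))).
  apply: le_trans hr2; rewrite ler_wpM2r ?(ltW r20) // ler_nat.
  by apply: leq_trans mH; rewrite -addn4 leq_addr.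
have hfB j : f j \in bohr e Gam rho2.
  by rewrite -B2E; have [h _] := dr j; apply: (subsetP h); apply: hf.
rewrite -[X in X%:R](card_ord m) -sum1_card natr_sum mulr_suml.
elim/big_rec2: _ => [|j x r _ IH]; first by apply: (bohr_zero He).
by rewrite mul1r; apply: (bohrD He).
Qed.

Lemma increment_or_many_solutions (Gam : seq G) (rho alpha : R) (A : {set G}) :
  (size Gam + N <= dmax)%N -> regular e Gam rho kappa eps -> 0 < rho -> rho <= 1 ->
  rmin <= kappa ^+ 5 * rho / (16 * N%:R * H%:R ^+ 2) -> 2 * al <= alpha ->
  alpha * #|bohr e Gam rho|%:R <= #|A :&: bohr e Gam rho|%:R ->
  (exists Gam' rho' w i, [/\ (size Gam' <= size Gam + N)%N,
      kappa ^+ 5 * rho / (32 * N%:R * H%:R ^+ 2) <= rho' <= 1, regular e Gam' rho' kappa eps &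
      alpha * (1 + 1 / (128 * m.+4%:R)) * #|bohr e Gam' rho'|%:R <=
        #|[set v in bohr e Gam' rho' | w + (q i)%:~R * v \in A]|%:R]) \/
  exists rho2, kappa ^+ 2 * rho / (4 * H%:R ^+ 2) <= rho2 /\
   1 / 16 * (alpha / 2) ^+ m.+4 * #|bohr e Gam rho2|%:R ^+ m.+3 <= (nsol_ring a A)%:R.
Proof.
move=> hsz reg r0 r1 hrm h2al dA.
have [inc|noinc] := EM (exists (Gam' : seq G) (rho' : R) (w : G) (i : 'I_m.+4), [/\ (size Gam' <= size Gam + N)%N,
      kappa ^+ 5 * rho / (32 * N%:R * H%:R ^+ 2) <= rho' <= 1, regular e Gam' rho' kappa eps &
      alpha * (1 + 1 / (128 * m.+4%:R)) * #|bohr e Gam' rho'|%:R <=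
        #|[set v in bohr e Gam' rho' | w + (q i)%:~R * v \in A]|%:R]); [by left | right].
have hszG : (size Gam <= dmax)%N by apply: leq_trans (leq_addr _ _) hsz.
have H1 : 1 <= H%:R :> R by rewrite ler1n (leq_trans _ mH).
have N1 : 1 <= N%:R :> R by rewrite ler1n.
have H0 : 0 < H%:R :> R by apply: lt_le_trans H1.
have kr0 : 0 < kappa * rho by rewrite mulr_gt0.
have divH (x : R) : 0 <= x -> x / H%:R <= x by move=> x0; rewrite ler_pdivrMr // ler_peMr.
have kle (x : R) : 0 <= x -> kappa * x <= x by move=> x0; rewrite ler_piMl.
have [rho1 [r11 r12 reg1]] : exists rho', [/\ kappa * rho / H%:R / 2 <= rho', rho' <= kappa * rho / H%:R & regular e Gam rho' kappa eps].
  apply: Hsup => //; last by apply: le_trans (divH _ (ltW kr0)) (le_trans (kle _ (ltW r0)) r1).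
  by apply: le_trans hrm _; have [_ _ _ _ []] := radius_chain k0 k1 r0 N1 H1 (lexx _) (lexx _).
have r10 : 0 < rho1 by apply: lt_le_trans r11; rewrite !divr_gt0.
have r1rho : rho1 <= rho by apply: le_trans r12 (le_trans (divH _ (ltW kr0)) (kle _ (ltW r0))).
have kr1 : 0 < kappa * rho1 by rewrite mulr_gt0.
have [rho2 [r21 r22 reg2]] : exists rho', [/\ kappa * rho1 / H%:R / 2 <= rho', rho' <= kappa * rho1 / H%:R & regular e Gam rho' kappa eps].
  apply: Hsup => //; last first.
    by apply: le_trans (divH _ (ltW kr1)) (le_trans (kle _ (ltW r10)) (le_trans r1rho r1)).
  by apply: le_trans hrm _; have [_ _ _ _ []] := radius_chain k0 k1 r0 N1 H1 r11 (lexx _).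
have r20 : 0 < rho2 by apply: lt_le_trans r21; rewrite !divr_gt0.
have [c1 c2 c3 c4 _] := radius_chain k0 k1 r0 N1 H1 r11 r21.
have r2k : rho2 <= kappa * rho1 by apply: le_trans r22 (divH _ (ltW kr1)).
have r2r1 : rho2 <= rho1 by apply: le_trans r2k (kle _ (ltW r10)).
have Hr2 : H%:R * rho2 <= kappa * rho1 by rewrite mulrC -ler_pdivlMr.
have Hr1 : H%:R * rho1 <= kappa * rho by rewrite mulrC -ler_pdivlMr.
have Hr2' : H%:R * rho2 <= kappa * rho by apply: le_trans Hr1; rewrite ler_wpM2l // ltW.
have r11' : rho1 <= 1 by apply: le_trans r1rho r1.
exists rho2; split => //.
set B := bohr e Gam rho in dA.
pose B1 := bohr e Gam rho1; pose B2 := bohr e Gam rho2.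
(* Coordinates 0 and 2 range over the larger Bohr set, all the others over the smaller one. *)
pose rr (i : 'I_m.+4) := if (val i == 0%N) || (val i == 2%N) then rho1 else rho2.
pose Bs i := bohr e Gam (rr i).
have rr0 i : 0 < rr i by rewrite /rr; case: ifP.
have cBs i : (0 < #|Bs i|)%N by apply: (card_bohr_gt0 He); apply: ltW.
have cB : (0 < #|B|)%N by apply: (card_bohr_gt0 He); apply: ltW.
pose As y i := [set b in Bs i | y + (q i)%:~R * b \in A].
pose k : R := m.+4%:R.
have kk0 : 0 < k by rewrite ltr0n.
have kk4 : 4 <= k by rewrite /k ler_nat.
have alpha0 : 0 < alpha by apply: lt_le_trans h2al; rewrite mulr_gt0.
pose f y i : R := #|As y i|%:R / #|Bs i|%:R.
(* A denser piece would already be an increment, with the same frequencies and the dilation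
   [q i]. *)
have fup y i : f y i <= alpha * (1 + 1 / (128 * k)).
  rewrite leNgt; apply/negP => h; apply: noinc; exists Gam, (rr i), y, i; split.
  - exact: leq_addr.
  - by rewrite /rr; case: ifP => _; apply/andP; split => //; [apply: le_trans c4 r2r1 | apply: le_trans r2r1 r11'].
  - by rewrite /rr; case: ifP.
  - by rewrite -ler_pdivlMr; [exact: ltW h | rewrite ltr0n; exact: cBs].
(* For fixed [i] and [b] in [Bs i] the element [q i * b] lies in [bohr e Gam (kappa * rho)], so
   translating by it loses at most [eps] of the density of [A]. *)
have sumf : k * (alpha - eps) * #|B|%:R <= \sum_(y in B) \sum_i f y i.
  rewrite exchange_big /= -mulrA mulr_natl -[in X in X <= _](card_ord m.+4) -sumr_const.
  apply: ler_sum => i _; rewrite /f -mulr_suml ler_pdivlMr ?ltr0n //.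
  rewrite (eq_bigr (fun y => \sum_(b in Bs i) (y + (q i)%:~R * b \in A)%:R)) => [|y _]; last by rewrite card_indic.
  rewrite exchange_big /= [X in X <= _]mulr_natr -sumr_const; apply: ler_sum => b bB.
  rewrite card_indic; apply: popular_translate => //.
  apply: (subsetP (subset_bohr _ _ (_ : H%:R * rr i <= _))); first by rewrite /rr; case: ifP.
  by apply: (bohr_intmul He) => //; apply: ltW.
(* Averaging the sum over all coordinates lets one base point [y] serve them simultaneously. *)
have [y yB hy] := exists_ge_avg cB sumf.
have ek : 64 * k * eps <= al by exact: Heps.
have flow i : 63 / 64 * alpha <= f y i.
  rewrite (bigD1 i) //= in hy.
  have h : \sum_(j < m.+4 | j != i) f y j <= (k - 1) * (alpha * (1 + 1 / (128 * k))).
    apply: le_trans (ler_sum _ (fun j _ => fup y j)) _.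
    have -> : k - 1 = m.+3%:R by rewrite /k -[m.+4%:R]natr1 addrK.
    by rewrite sumr_const -[X in X <= _]mulr_natl cardC1 card_ord.
  exact: one_coordinate_ge kk4 alpha0 h2al ek hy h.
have As_low i : 63 / 64 * alpha * #|Bs i|%:R <= #|As y i|%:R.
  by rewrite -ler_pdivlMr; [exact: flow | rewrite ltr0n; exact: cBs].
have As_low2 i : alpha / 2 * #|Bs i|%:R <= #|As y i|%:R.
  by apply: le_trans (As_low i); rewrite ler_wpM2r ?ler0n //; lra.
have As_al i : al * #|Bs i|%:R <= #|As y i|%:R.
  by apply: le_trans (As_low2 i); rewrite ler_wpM2r ?ler0n //; lra.
have As_sub i : As y i \subset Bs i by apply/subsetP => b; rewrite in_set => /andP[].
have unif i j : rr i = rho1 -> rr j = rho2 -> forall L : {set G}, L \subset B1 ->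
    #|L|%:R / #|B1|%:R - 1 / 8 <= avg (As y i) (fun x => meas R (As y j) L x).
  move=> ri rj; have hi : Bs i = B1 by rewrite /Bs ri.
  have hj : Bs j = B2 by rewrite /Bs rj.
  have := unif_or_incr (A1 := As y i) (A2 := As y j) hsz reg1 reg2 r20 r2k r11' (le_trans hrm c2).
  rewrite -/B1 -/B2 -hi -hj; apply => //.
  (* An increment of [As y i] at [u] is one of [A] at [y + q i * u]. The factor [1 + 1 / 16]
     outweighs the initial loss to [63 / 64 * alpha]. *)
  case=> [Gam' [rho' [u [g1 /andP[g2 g3] g4 g5]]]]; apply: noinc.
  exists Gam', rho', (y + (q i)%:~R * u), i; split => //.
    by apply/andP; split => //; apply: le_trans c3 g2.
  have Bi : 0 < #|Bs i|%:R :> R by rewrite ltr0n.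
  apply: le_trans (_ : #|[set v in bohr e Gam' rho' | u + v \in As y i]|%:R <= _); last first.
    rewrite ler_nat; apply: subset_leq_card; apply/subsetP => v; rewrite !in_set.
    by case/andP => -> /andP[_]; rewrite mulrDr addrA.
  rewrite -(ler_pM2l Bi); apply: le_trans (ltW g5).
  rewrite mulrCA mulrA ler_wpM2r ?ler0n //.
  have kk1 : 1 <= k by rewrite /k ler1n.
  exact: (increment_ge kk1 alpha0 (ler0n _ _) (As_low i)).
have alpha2 : 0 < alpha / 2 by rewrite divr_gt0.
apply: (count_of_uniform (Gam := Gam) (rho1 := rho1) (rho2 := rho2) (y := y) (A := A) (B1 := B1) (B2 := B2) (As := As y)) => //.
- by move=> i x; rewrite in_set => /andP[].
- exact: (As_low2 ord0).
- exact: (As_low2 (lift ord0 ord0)).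
- exact: (As_low2 (lift ord0 (lift ord0 ord0))).
- exact: (As_low2 (lift ord0 (lift ord0 (lift ord0 ord0)))).
- move=> j; pose i : 'I_m.+4 := lift ord0 (lift ord0 (lift ord0 (lift ord0 j))).
  by split; [exact: (As_sub i) | exact: (As_low2 i)].
- exact: unif.
- exact: unif.
Qed.

Variables (sigma bmin : R).
Hypotheses (s0 : 0 < sigma) (s1 : sigma <= 1) (b0 : 0 <= bmin).
Hypothesis Hsig : sigma * (32 * N%:R * H%:R ^+ 2) <= kappa ^+ 5.
Hypothesis Hbmin : forall Gam rho, (size Gam <= dmax)%N -> rmin <= rho ->
  bmin <= #|bohr e Gam rho|%:R.

(* [j] bounds the number of increments still possible; for [j = 0] the density would exceed 1. *)
Lemma iterate_increment (j : nat) (Gam : seq G) (rho alpha : R) (A : {set G}) :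
  (size Gam + j * N <= dmax)%N -> regular e Gam rho kappa eps -> 0 < rho -> rho <= 1 ->
  rmin <= sigma ^+ j * rho -> 2 * al <= alpha ->
  1 < (1 + 1 / (128 * m.+4%:R)) ^+ j * alpha ->
  alpha * #|bohr e Gam rho|%:R <= #|A :&: bohr e Gam rho|%:R ->
  1 / 16 * al ^+ m.+4 * bmin ^+ m.+3 <= (nsol_ring a A)%:R.
Proof.
elim: j Gam rho alpha A => [|j IH] Gam rho alpha A hsz reg r0 r1 hrm h2al big dA.
  rewrite expr0 mul1r in big.
  have cB : (0 < #|bohr e Gam rho|)%N by apply: (card_bohr_gt0 He); apply: ltW.
  have : #|A :&: bohr e Gam rho|%:R <= #|bohr e Gam rho|%:R :> R.
    by rewrite ler_nat subset_leq_card // subsetIr.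
  move/(le_trans dA); rewrite -[X in _ <= X]mul1r ler_pM2r ?ltr0n // => h.
  by move: (lt_le_trans big h); rewrite ltxx.
have H1 : 1 <= H%:R :> R by rewrite ler1n (leq_trans _ mH).
have N1 : 1 <= N%:R :> R by rewrite ler1n.
have NH0 : 0 < N%:R * H%:R ^+ 2 :> R by rewrite mulr_gt0 ?exprn_gt0 // (lt_le_trans ltr01).
have hsr : sigma * rho <= kappa ^+ 5 * rho / (32 * N%:R * H%:R ^+ 2).
  rewrite ler_pdivlMr; last by rewrite -mulrA mulr_gt0.
  by rewrite mulrAC ler_wpM2r // ltW.
have hsr2 : sigma * rho <= kappa ^+ 5 * rho / (16 * N%:R * H%:R ^+ 2).
  apply: le_trans hsr _; rewrite ler_wpM2l ?mulr_ge0 ?exprn_ge0 ?(ltW k0) ?(ltW r0) //.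
  by rewrite -(mulrA 16) -(mulrA 32) lef_pV2 ?posrE ?mulr_gt0 ?exprn_gt0 ?(lt_le_trans ltr01 N1) ?(lt_le_trans ltr01 H1) // ler_wpM2r ?(ltW NH0) // ler_nat.
have sj1 : sigma ^+ j <= 1 by apply: exprn_ile1; rewrite // ltW.
have hrs : rmin <= sigma * rho.
  apply: le_trans hrm _; by rewrite exprSr -mulrA ler_piMl // mulr_ge0 ?(ltW s0) ?(ltW r0).
have hsz' : (size Gam + N <= dmax)%N.
  by apply: leq_trans hsz; rewrite leq_add2l mulSn leq_addr.
have [inc|many] := increment_or_many_solutions hsz' reg r0 r1 (le_trans hrs hsr2) h2al dA.
  case: inc => Gam' [rho' [w [i [g1 /andP[g2 g3] g4 g5]]]].
  have a0 : 0 < alpha by apply: lt_le_trans h2al; rewrite mulr_gt0.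
  have r'0 : 0 < rho' by apply: lt_le_trans (le_trans hsr g2); rewrite mulr_gt0.
  have c1 : 0 <= 1 / (128 * m.+4%:R) :> R by rewrite divr_ge0 ?mulr_ge0 ?ler0n.
  (* The recursion continues with the affine preimage of [A], of larger density in a Bohr set
     centred at 0. *)
  apply: le_trans (_ : (nsol_ring a [set v | w + (q i)%:~R * v \in A])%:R <= _); last first.
    by rewrite ler_nat; apply: nsol_ring_affine => //; apply: Hinj.
  apply: (IH Gam' rho' (alpha * (1 + 1 / (128 * m.+4%:R)))) => //.
  - by apply: leq_trans hsz; rewrite mulSn addnA leq_add2r.
  - apply: le_trans hrm _; rewrite exprSr -mulrA ler_wpM2l ?exprn_ge0 ?(ltW s0) //.
    exact: le_trans hsr g2.
  - by apply: le_trans h2al _; rewrite ler_peMr ?(ltW a0) // lerDl.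
  - by rewrite mulrA mulrAC -exprSr.
  - apply: le_trans g5 _; rewrite ler_nat; apply: subset_leq_card; apply/subsetP => v.
    by rewrite in_setI !in_set andbC.
case: many => rho2 [g1 g2]; apply: le_trans g2.
have hszG : (size Gam <= dmax)%N by apply: leq_trans hsz; rewrite leq_addr.
have bB : bmin <= #|bohr e Gam rho2|%:R.
  apply: Hbmin => //; apply: le_trans hrs (le_trans hsr2 (le_trans _ g1)).
  rewrite ler_pdivrMr; last by rewrite -mulrA mulr_gt0.
  rewrite [X in _ <= X](_ : _ = kappa ^+ 2 * rho * (4 * N%:R)); last by field; rewrite gt_eqF // (lt_le_trans ltr01).
  have kr : 0 < kappa ^+ 2 * rho by rewrite mulr_gt0 ?exprn_gt0.
  have k3 : kappa ^+ 3 <= 1 by apply: exprn_ile1; rewrite // ltW.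
  rewrite (_ : kappa ^+ 5 * rho = kappa ^+ 2 * rho * kappa ^+ 3); last by ring.
  rewrite ler_wpM2l ?(ltW kr) //; lra.
have al2 : al <= alpha / 2 by lra.
have h16 : 0 <= 1 / 16 :> R by lra.
apply: ler_pM.
- by rewrite mulr_ge0 // exprn_ge0 // ltW.
- by rewrite exprn_ge0.
- by rewrite ler_wpM2l // lerXn2r ?nnegrE ?(ltW al0) // (le_trans (ltW al0)).
- by rewrite lerXn2r ?nnegrE.
Qed.
End Step.

(** * Choice of the parameters *)

Section ParameterChoice.
Variables (m H : nat).

(* With [L] about [log2 (1 / alpha)]: [par_l] Fourier averages, [par_n] samples,
   [par_N] new frequencies per increment, [par_J] increments, total rank [par_d];
   scales shrink by [2 ^- K], and every Bohr set used has density at least [2 ^- par_W]. *)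
Definition par_s := (64 * m.+4 + 2 * H)%N.
Definition par_l (L : nat) := (L + 4)%N.
Definition par_n (L : nat) := (8 * (384 * par_l L) ^ 2 * (2 * L + 17))%N.
Definition par_N (L : nat) := (32 * (4 + L.+1 * par_n L))%N.
Definition par_J (L : nat) := (128 * m.+4 * L)%N.
Definition par_d (L : nat) := (par_J L * par_N L)%N.
Definition par_W (K L : nat) := ((12 * K * par_J L + 8) * par_d L)%N.

Lemma cubic_bound (x p r L l : nat) : (l <= 5 * L)%N ->
  (p * (x * l) ^ 2 * (r * L) <= p * (x * 5) ^ 2 * r * L ^ 3)%N.
Proof.
move=> hl; have h2 : ((x * l) ^ 2 <= (x * 5 * L) ^ 2)%N.
  by rewrite leq_exp2r // -mulnA leq_mul2l hl orbT.
apply: leq_trans (_ : p * (x * 5 * L) ^ 2 * (r * L) <= _)%N.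
  by rewrite leq_mul2r leq_mul2l h2 !orbT.
by apply: eq_leq; rewrite expnMn [(L ^ 3)%N]expnSr; move: (x * 5)%N (L ^ 2)%N => y z; ring.
Qed.

Lemma par_n_le : exists Cn : nat, forall L, (0 < L)%N -> (par_n L <= Cn * L ^ 3)%N.
Proof.
exists (8 * (384 * 5) ^ 2 * 19)%N => L L0.
apply: leq_trans (cubic_bound 384 8 19 (_ : (par_l L <= 5 * L)%N)); last by rewrite /par_l; lia.
by rewrite /par_n leq_mul2l; apply/orP; right; lia.
Qed.

(** The rank is of order [L ^ 5] and the logarithm of the radius of order [c * L ^ 2]. It matters
    that [X] is chosen before [c]. *)
Lemma par_W_le : exists X : nat, forall c L, (0 < c)%N -> (0 < L)%N ->
  (par_W (c * L) L <= X * c * L ^ 7)%N.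
Proof.
have [Cn hn'] := par_n_le.
exists (1544 * m.+4 * (128 * m.+4 * (32 * (4 + 2 * Cn))))%N => c L c0 L0.
have hn := hn' L L0.
have hN : (par_N L <= 32 * (4 + 2 * Cn) * L ^ 4)%N.
  have h1 : (L.+1 * par_n L <= 2 * Cn * L ^ 4)%N.
    have -> : (2 * Cn * L ^ 4 = (2 * L) * (Cn * L ^ 3))%N by rewrite [(L ^ 4)%N]expnSr; ring.
    by apply: leq_mul hn; lia.
  have h2 : (4 <= 4 * L ^ 4)%N by rewrite leq_pmulr // expn_gt0 L0.
  by rewrite /par_N -mulnA leq_mul2l mulnDl leq_add ?orbT.
rewrite /par_W /par_d.
have E (x y z w k : nat) : (x <= 1544 * k * c * z -> y <= 32 * (4 + 2 * Cn) * w ->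
    x * (128 * k * L * y) <= 1544 * k * (128 * k * (32 * (4 + 2 * Cn))) * c * (z * L * w))%N.
  move=> h1 h2; apply: leq_trans (leq_mul h1 (leq_mul (leqnn _) h2)) _.
  by apply: eq_leq; move: (32 * _)%N 1544%N 128%N => A B D; ring.
have -> : (L ^ 7 = L ^ 2 * L * L ^ 4)%N by rewrite -expnSr -expnD.
apply: E => //.
have h1 : (8 <= 8 * (m.+4 * c * L ^ 2))%N by rewrite leq_pmulr // !muln_gt0 c0 ?expn_gt0 L0.
rewrite /par_J.
have E2 (k p r : nat) : (p * (c * L) * (r * k * L) = (p * r) * (k * c * L ^ 2))%N.
  by rewrite expnS expn1; ring.
rewrite E2; apply: leq_trans (leq_add (leqnn _) h1) _.
by rewrite -mulnDl -!mulnA.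
Qed.

(** This resolves the circularity between [kappa = 2 ^- K] and [par_W], which depends on
    [K = c * L]: the left side grows only linearly in [c]. *)
Lemma exists_par_c : exists c : nat, (0 < c)%N /\ forall L, (0 < L)%N ->
  (4 * 2 ^ (L + par_s) * par_W (c * L) L <= 2 ^ (c * L))%N.
Proof.
have [X hX] := par_W_le.
pose Y := (4 * 2 ^ par_s * X)%N.
(* The share [8 * L] of the exponent absorbs [2 ^ L * L ^ 7]; the rest absorbs the constant
   [Y * c]. *)
exists (8 + (Y + (Y + 8)))%N; split => // L L0.
set c := (8 + _)%N.
have hc : (Y * c <= 2 ^ (Y + (Y + 8)))%N.
  rewrite expnD; apply: leq_mul; first by apply: ltnW; apply: ltn_expl.
  have h := ltn_expl (Y + 7) (isT : (1 < 2)%N).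
  have -> : (Y + 8 = (Y + 7).+1)%N by lia.
  rewrite expnS /c; lia.
apply: leq_trans (leq_mul (leqnn _) (hX c L _ L0)) _ => //.
have -> : (4 * 2 ^ (L + par_s) * (X * c * L ^ 7) = (Y * c) * (2 ^ L * L ^ 7))%N.
  by rewrite expnD /Y; move: (2 ^ L)%N (2 ^ par_s)%N (L ^ 7)%N => x y z; ring.
rewrite {2}/c mulnDl expnD mulnC.
apply: leq_mul.
  rewrite (_ : 8 * L = L + L * 7)%N; last by lia.
  rewrite expnD leq_mul2l expnM leq_exp2r // (ltnW (ltn_expl _ _)) //; by rewrite orbT.
apply: leq_trans hc _; rewrite leq_exp2l // leq_pmulr //.
Qed.

End ParameterChoice.

Lemma par_n_gt0 L : (0 < par_n L)%N.
Proof. by rewrite /par_n !muln_gt0 ?expn_gt0 ?muln_gt0 /par_l !addn_gt0 !orbT. Qed.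

Lemma six_mul k : (6 * k = k * 5 + k)%N. Proof. lia. Qed.

Lemma double_par_l L : (2 * par_l L = (2 * L + 7).+1)%N.
Proof. by rewrite /par_l; lia. Qed.

Lemma par_WE m K L : par_W m K L = ((2 * (6 * K * par_J m L) + 8) * par_d m L)%N.
Proof. by rewrite /par_W !mulnA. Qed.

(** * Inequalities between powers of two *)

Section PowersOfTwo.
Variable R : realType.

Lemma bernoulli_ge (x : R) n : 0 <= x -> 1 + n%:R * x <= (1 + x) ^+ n.
Proof.
move=> x0; elim: n => [|n IH]; first by rewrite mul0r addr0 expr0.
rewrite exprS -natr1; have := ler_wpM2l (addr_ge0 ler01 x0) IH.
apply: le_trans; have := ler0n R n; nra.
Qed.

Lemma two_pow_le_expR n : 2 ^+ n <= expR n%:R :> R.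
Proof.
rewrite -[n%:R]mulr1 expRM_natl lerXn2r ?nnegrE ?expR_ge0 //.
by have := expR_ge1Dx (1 : R); lra.
Qed.

(** Used both to bound the number of increments, with [x = 1 / (128 * m.+4)], and to count the
    annuli needed for regularity, with [x = eps]. *)
Lemma pow_two_ge (x : R) (M n : nat) : 0 <= x -> 1 <= M%:R * x -> 2 ^+ n <= (1 + x) ^+ (M * n).
Proof.
move=> x0 hM; rewrite exprM lerXn2r ?nnegrE ?exprn_ge0 ?addr_ge0 //.
by apply: le_trans (bernoulli_ge M x0); lra.
Qed.

Lemma le_inv_two_pow a b : (a <= b)%N -> (2 : R) ^- b <= 2 ^- a.
Proof. by move=> h; rewrite lef_pV2 ?posrE ?exprn_gt0 // ler_weXn2l // ler1n. Qed.

Lemma inv_two_pow_gt0 a : 0 < (2 : R) ^- a.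
Proof. by rewrite invr_gt0 exprn_gt0. Qed.

Lemma inv_two_powD a b : (2 : R) ^- (a + b) = 2 ^- a * 2 ^- b.
Proof. by rewrite exprD invfM. Qed.

(** Of the six factors [2 ^- k], five match the right-hand side and the sixth absorbs
    [32 * n * h ^+ 2]. *)
Lemma sigma_bound (k n h s w : nat) : (32 * h ^ 2 <= 2 ^ s)%N -> (n <= w)%N -> (2 ^ s * w <= 2 ^ k)%N ->
  (2 : R) ^- (6 * k) * (32 * n%:R * h%:R ^+ 2) <= (2 ^- k) ^+ 5.
Proof.
move=> hs nw wk; rewrite six_mul inv_two_powD -mulrA exprVn -exprM.
rewrite ler_piMr ?(ltW (inv_two_pow_gt0 _)) //.
rewrite mulrC ler_pdivrMr ?exprn_gt0 // mul1r -!natrX -!natrM ler_nat.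
apply: leq_trans wk; rewrite mulnAC; exact: leq_mul.
Qed.

Lemma lt_inv1024 : 0 < 1 / 1024 :> R. Proof. lra. Qed.

Lemma le_inv1024 : 1 / 1024 <= 1 / 8 :> R. Proof. lra. Qed.

Lemma inv_le1 (x : R) : 1 <= x -> 1 / (384 * x) <= 1.
Proof. by move=> x1; rewrite ler_pdivrMr; lra. Qed.

End PowersOfTwo.

(** * Verification of the chosen parameters *)

Section Main.
Variables (R : realType) (G : finComNzRingType) (e : G -> R[i]).
Hypothesis He : additive_char e.

Lemma card_bohr_two_pow (Gam : seq G) (rho : R) (b d : nat) : (size Gam <= d)%N ->
  2 ^- b.+1 <= rho -> (#|G| <= #|bohr e Gam rho| * 2 ^ ((2 * b + 8) * d))%N.
Proof.
move=> sd hr; have q0 : (0 < 2 ^ (b + 2))%N by rewrite expn_gt0.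
have hq : 2 / (2 ^ (b + 2))%:R <= rho.
  apply: le_trans hr; rewrite natrX addn2 exprS invfM mulrA divff ?pnatr_eq0 // mul1r.
  exact: lexx.
apply: leq_trans (card_bohr_ge He Gam q0 hq) _; rewrite leq_mul2l; apply/orP; right.
rewrite expnM; apply: leq_trans (_ : (2 ^ (2 * b + 8)) ^ size Gam <= _)%N; last first.
  by rewrite leq_pexp2l // expn_gt0.
have h : (((2 ^ (b + 2)).*2.+1) ^ 2 <= 2 ^ (2 * b + 8))%N.
  rewrite (_ : 2 * b + 8 = (b + 4) * 2)%N; last by lia.
  rewrite expnM leq_exp2r // !expnD -muln2; have : (0 < 2 ^ b)%N by rewrite expn_gt0.
  by move: (2 ^ b)%N => x; lia.
by case: (size Gam) => [|s] //; rewrite leq_exp2r.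
Qed.

(** With [2 ^ s * ((2 * b + 8) * d)] annuli, growth by [1 + eps] across each would exceed the ratio
    [2 ^ ((2 * b + 8) * d)] between the ring and the smallest Bohr set involved. *)
Lemma regular_supply_two_pow (kappa eps rmin : R) (b s d : nat) :
  0 <= kappa -> 2 ^- s <= eps -> 2 ^- b <= rmin -> (0 < d)%N ->
  4 * (2 ^ s * ((2 * b + 8) * d))%:R * kappa <= 1 ->
  regular_supply e kappa eps rmin d.
Proof.
move=> k0 es br d0 hJ Gam rho0 sd r1 r2.
have r0 : 0 < rho0 by apply: lt_le_trans (le_trans br r1); apply: inv_two_pow_gt0.
have eps0 : 0 <= eps by apply: le_trans es; rewrite ltW // inv_two_pow_gt0.
apply: (exists_regular _ r0 k0 eps0 hJ); first by rewrite !muln_gt0 expn_gt0 d0 addn_gt0 orbT.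
have hb : 2 ^- b.+1 <= rho0 / 2.
  rewrite exprSr invfM ler_wpM2r ?invr_ge0 //; exact: le_trans br r1.
have := card_bohr_two_pow sd hb; rewrite -(ler_nat R) natrM natrX mulrC => h.
apply: le_trans h _; rewrite ler_wpM2r ?ler0n //.
apply: pow_two_ge => //; rewrite natrX.
by rewrite -ler_pdivrMl ?exprn_gt0 // mulr1.
Qed.

Variables (m : nat) (a q : 'I_m.+4 -> int) (P : int) (H : nat).
Hypotheses (Ha : \sum_i a i = 0) (Hq : forall i, a i * q i = P).
Hypothesis (Hinj : forall i, injective (fun b : G => (q i)%:~R * b)).
Hypotheses (HH : forall i, (`|q i| <= H)%N) (mH : (m.+4 <= H)%N).

Variables (c L : nat).
Hypothesis L0 : (0 < L)%N.
Let s := par_s m H.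
Let K := (c * L)%N.
Let l := par_l L.
Let n := par_n L.
Let N := par_N L.
Let J := par_J m L.
Let d := par_d m L.
Let W := par_W m K L.
Hypothesis Hc : (4 * 2 ^ (L + s) * W <= 2 ^ K)%N.

Let kappa : R := 2 ^- K.
Let eps : R := 2 ^- (L + s).
Let al : R := 2 ^- L.
Let eta : R := 2 ^- (L + 7).
Let t : R := 1 / (384 * l%:R).

Let N0 : (0 < N)%N. Proof. by []. Qed.
Let J0 : (0 < J)%N. Proof. by rewrite /J /par_J muln_gt0 L0. Qed.
Let d0 : (0 < d)%N. Proof. by rewrite /d /par_d muln_gt0 -/J J0. Qed.

Let dW : (d <= W)%N.
Proof. by rewrite /W /par_W -/d leq_pmull // addn_gt0 orbT. Qed.

Let NW : (N <= W)%N.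
Proof. by apply: leq_trans dW; rewrite /d /par_d leq_pmull. Qed.

(** [par_s] does not depend on [L]; its power of two absorbs the factors [32 * H ^ 2] and
    [64 * m.+4] that enter through dilations and the number of variables. *)
Let s_ge : (10 <= s)%N /\ (32 * H ^ 2 <= 2 ^ s)%N /\ (64 * m.+4 <= 2 ^ s)%N.
Proof.
split; first by rewrite /s /par_s; lia.
rewrite /s /par_s expnD; split.
  have h1 : (32 <= 2 ^ (64 * m.+4))%N.
    by apply: (@leq_trans (2 ^ 5)) => //; rewrite leq_exp2l //; lia.
  by rewrite leq_mul // mulnC expnM leq_exp2r // ltnW // ltn_expl.
apply: leq_trans (ltnW (ltn_expl _ (isT : (1 < 2)%N))) _.
by rewrite leq_pmulr // expn_gt0.
Qed.

Let l0 : (0 : R) < l%:R. Proof. by rewrite ltr0n /l /par_l addn_gt0 orbT. Qed.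

(** [par_n] is defined so that [t ^+ 2 * n / 8] is exactly [2 * L + 17]: one [L] cancels [al], the
    other with the constant beats [1 / t]. *)
Let HE : 16 <= al * t * expR (t ^+ 2 * n%:R / 8).
Proof.
have l0' := l0.
have -> : t ^+ 2 * n%:R / 8 = (2 * L + 17)%:R.
  have -> : n%:R = 8 * (384 * l%:R) ^+ 2 * (2 * L + 17)%:R :> R.
    by rewrite /n /par_n -/l natrM [X in X * _]natrM natrX natrM.
  by rewrite /t; move: (2 * L + 17)%N => x; field; exact: lt0r_neq0.
apply: le_trans (_ : al * t * 2 ^+ (2 * L + 17) <= _); last first.
  rewrite ler_wpM2l ?two_pow_le_expR // mulr_ge0 ?divr_ge0 ?mulr_ge0 ?ler0n //.
  exact: ltW (inv_two_pow_gt0 _ _).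
rewrite (_ : 2 * L + 17 = L + (L + 17))%N; last by lia.
rewrite exprD (_ : al * t * (2 ^+ L * _) = 2 ^+ (L + 17) / (384 * l%:R)); last first.
  by rewrite /al /t; field; rewrite !lt0r_neq0 ?exprn_gt0.
rewrite ler_pdivlMr ?mulr_gt0 // exprD.
have hl : (l <= 5 * 2 ^ L)%N.
  by have := ltn_expl L (isT : (1 < 2)%N); rewrite /l /par_l; move: (2 ^ L)%N => x; lia.
rewrite -(ler_nat R) natrM natrX in hl.
have : 1 <= 2 ^+ L :> R by rewrite exprn_ege1 // ler1n.
have -> : 2 ^+ 17 = 16 * 16 * 16 * 32 :> R by ring.
by move: (2 ^+ L) hl => x; lra.
Qed.

Let HN : 8 * (2 / al) ^+ n < expR (N%:R / 32).
Proof.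
have -> : N%:R / 32 = (4 + L.+1 * n)%:R :> R.
  by rewrite /N /par_N -/n natrM mulrAC divff ?mul1r // pnatr_eq0.
have -> : 8 * (2 / al) ^+ n = 2 ^+ (3 + L.+1 * n) :> R.
  rewrite exprD exprM /al invrK -exprS; congr (_ * _); ring.
apply: lt_le_trans (two_pow_le_expR _ _).
by rewrite ltr_eXn2l ?ltr1n // ltn_add2r.
Qed.

Let WK : (2 ^ s * W <= 2 ^ K)%N.
Proof.
apply: leq_trans Hc; rewrite leq_mul2r expnD mulnA leq_pmull ?orbT //.
by rewrite muln_gt0 expn_gt0.
Qed.

Let HNk : N%:R * kappa <= 2 ^- (L + 8).
Proof.
rewrite /kappa ler_pdivrMr ?exprn_gt0 // mulrC ler_pdivlMr ?exprn_gt0 //.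
rewrite -!natrX -natrM ler_nat; apply: leq_trans Hc.
have [s10 _] := s_ge.
apply: leq_trans (_ : 2 ^ (L + s) * W <= _)%N; last by rewrite leq_mul2r leq_pmull ?orbT.
by rewrite mulnC leq_mul // leq_exp2l //; lia.
Qed.

Let Heps2 : eps <= 2 ^- (L + 10).
Proof. by have [s10 _] := s_ge; apply: le_inv_two_pow; rewrite leq_add2l. Qed.

Let halfE i j : (2 : R) ^- (i + j.+1) * 2 = 2 ^- (i + j).
Proof. by rewrite addnS exprS invfM mulrAC mulVf ?mul1r // pnatr_eq0. Qed.

Let Heta : 4 * eps + N%:R * kappa <= eta.
Proof.
have h1 := Heps2; have h2 := HNk; rewrite /eta.
have := halfE L 7; have := halfE L 8; have := halfE L 9.
move: eps (N%:R * kappa) h1 h2 => x y h1 h2; lra.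
Qed.

Let al0 : 0 < al. Proof. exact: inv_two_pow_gt0. Qed.

Let al1 : al <= 1.
Proof. by rewrite -[1](invr1) -(expr0 (2 : R)); apply: le_inv_two_pow. Qed.

Let Heps_al : eps <= al * (1 / 1024).
Proof.
apply: le_trans Heps2 _; rewrite inv_two_powD /al ler_wpM2l ?(ltW (inv_two_pow_gt0 _ _)) //.
rewrite (_ : 2 ^- 10 = 1 / 1024) //.
have -> : 2 ^+ 10 = 32 * 32 :> R by ring.
have -> : 1024 = 32 * 32 :> R by ring.
by rewrite mul1r.
Qed.

Let Herr : eps / al + eps + 6 * l%:R * t + 2 * eta / al <= 1 / 16.
Proof.
have a0 := al0; have a1 := al1; have h1 := Heps_al; have l0' := l0.
have -> : 6 * l%:R * t = 1 / 64 by rewrite /t; field; exact: lt0r_neq0.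
have h2 : eps / al <= 1 / 1024 by rewrite ler_pdivrMr // mulrC.
have h3 : 2 * eta / al = 1 / 64.
  have -> : eta = al * (1 / 128).
    rewrite /eta inv_two_powD /al; congr (_ * _).
    have -> : 2 ^+ 7 = 128 :> R by ring.
    by rewrite mul1r.
  by field; exact: lt0r_neq0.
have h5 : eps <= 1 / 1024 by apply: le_trans h1 _; apply: ler_piMl => //; lra.
have gen (x y : R) : x <= 1 / 1024 -> y <= 1 / 1024 -> x + y + 1 / 64 + 1 / 64 <= 1 / 16 by lra.
by rewrite h3; apply: gen.
Qed.

Let Heps : 64 * m.+4%:R * eps <= al.
Proof.
have [_ [_ h]] := s_ge.
rewrite /eps inv_two_powD -/al mulrCA ler_piMr ?(ltW al0) //.
by rewrite ler_pdivrMr ?exprn_gt0 // mul1r -natrM -natrX ler_nat.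
Qed.

Let Hl : 2 * (1 / 4) ^+ l <= eta.
Proof.
have -> : (1 / 4) ^+ l = 2 ^- (2 * l) :> R.
  rewrite exprM -exprVn; congr (_ ^+ _); have -> : 2 ^+ 2 = 4 :> R by ring.
  by rewrite mul1r.
rewrite /l (double_par_l L).
rewrite exprS invfM mulrA divff ?mul1r ?pnatr_eq0 //; by apply: le_inv_two_pow; rewrite leq_add2r leq_pmull.
Qed.

Let sigma : R := 2 ^- (6 * K).
Let rmin : R := 2 ^- (6 * K * J).

Let Hsig : sigma * (32 * N%:R * H%:R ^+ 2) <= kappa ^+ 5.
Proof.
have [_ [h _]] := s_ge; exact: sigma_bound h NW WK.
Qed.

Let Hsup : regular_supply e kappa eps rmin d.
Proof.
apply: (@regular_supply_two_pow _ _ _ (6 * K * J) (L + s)) => //.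
  exact: ltW (inv_two_pow_gt0 _ _).
rewrite -par_WE -/W.
by rewrite ler_pdivrMr ?exprn_gt0 // mul1r -natrM mulnA -natrX ler_nat.
Qed.

Lemma many_solutions_of_params (A : {set G}) : (#|G| * 2 <= #|A| * 2 ^ L)%N ->
  (#|G| ^ m.+3 <= nsol_ring a A * 2 ^ (4 + L * m.+4 + W * m.+3))%N.
Proof.
move=> hA.
have [_ hs] := s_ge.
have W2 : 0 < 2 ^+ W :> R by rewrite exprn_gt0.
pose bmin : R := #|G|%:R / 2 ^+ W.
have b0 : 0 <= bmin by rewrite divr_ge0 ?ler0n // ltW.
have Hb Gam rho : (size Gam <= d)%N -> rmin <= rho -> bmin <= #|bohr e Gam rho|%:R.
  move=> sd hr; rewrite ler_pdivrMr // -natrX -natrM ler_nat.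
  rewrite /W par_WE -/J -/d.
  by apply: card_bohr_two_pow => //; apply: le_trans hr; apply: le_inv_two_pow.
have k0 : 0 < kappa by apply: inv_two_pow_gt0.
have k1 : kappa <= 1 by rewrite -[1](invr1) -(expr0 (2 : R)); apply: le_inv_two_pow.
have e0 : 0 <= eps by apply: ltW; apply: inv_two_pow_gt0.
have e8 : eps <= 1 / 8.
  exact: le_trans Heps_al (le_trans (ler_piMl (ltW (lt_inv1024 R)) al1) (le_inv1024 R)).
have t0 : 0 < t by rewrite divr_gt0 ?mulr_gt0.
have t1 : t <= 1 by apply: inv_le1; rewrite ler1n /l /par_l addn_gt0 orbT.
have eta0 : 0 <= eta by apply: ltW; apply: inv_two_pow_gt0.
have n0 : (0 < n)%N by apply: par_n_gt0.
have s0 : 0 < sigma by apply: inv_two_pow_gt0.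
have s1 : sigma <= 1 by rewrite -[1](invr1) -(expr0 (2 : R)); apply: le_inv_two_pow.
(* The iteration starts from the empty list of frequencies, whose Bohr set is the whole ring and is
   regular at any radius. *)
have setB : bohr e [::] 1 = [set: G] by apply/setP => x; rewrite !inE.
have hdens : 2 * al * #|bohr e [::] 1|%:R <= #|A :&: bohr e [::] 1|%:R.
  rewrite setB setIT cardsT /al mulrAC ler_pdivrMr ?exprn_gt0 //.
  by rewrite -natrM -natrX -natrM ler_nat mulnC.
(* [J = 128 * m.+4 * L] increments by [1 + 1 / (128 * m.+4)] multiply the density by at least
   [2 ^ L], taking [2 * al] to at least 2. *)
have hbig : 1 < (1 + 1 / (128 * m.+4%:R)) ^+ J * (2 * al).
  have h := @pow_two_ge R (1 / (128 * m.+4%:R)) (128 * m.+4) L.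
  have x0 : 0 <= 1 / (128 * m.+4%:R) :> R by rewrite divr_ge0 ?mulr_ge0 ?ler0n.
  have x1 : 1 <= (128 * m.+4)%:R * (1 / (128 * m.+4%:R)) :> R.
    by rewrite natrM mul1r divff // mulf_neq0 // pnatr_eq0.
  apply: lt_le_trans (ler_wpM2r _ (h x0 x1)); last by rewrite mulr_ge0 // (ltW al0).
  by rewrite mulrCA /al divff ?mulr1 ?ltr1n // expf_neq0 // pnatr_eq0.
have hreg : regular e [::] 1 kappa eps.
  rewrite /regular (_ : bohr e [::] (1 + kappa * 1) = [set: G]); last by apply/setP => x; rewrite !inE.
  rewrite (_ : bohr e [::] (1 - kappa * 1) = [set: G]); last by apply/setP => x; rewrite !inE.
  by rewrite ler_peMl ?ler0n // lerDl.
have := iterate_increment He Ha Hq Hinj HH mH k0 k1 e0 e8 al0 al1 t0 t1 eta0 n0 N0 Hl HE HN Heta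
   Herr Heps Hsup s0 s1 b0 Hsig Hb (j := J) (Gam := [::]) (rho := 1) (alpha := 2 * al) (A := A).
move/(_ _ hreg ltr01 (lexx _) _ (lexx _) hbig hdens).
rewrite /rmin /sigma mulr1 exprVn -exprM => /(_ _ (lexx _)).
move=> /(_ _) main.
have {}main : 1 / 16 * al ^+ m.+4 * bmin ^+ m.+3 <= (nsol_ring a A)%:R by apply: main.
rewrite -(ler_nat R) natrM !natrX.
have -> : 2 ^+ (4 + L * m.+4 + W * m.+3) = 16 * (2 ^+ L) ^+ m.+4 * (2 ^+ W) ^+ m.+3 :> R.
  by rewrite !exprD -!exprM; congr (_ * _ * _); ring.
have z0 : 0 < 16 * (2 ^+ L) ^+ m.+4 * (2 ^+ W) ^+ m.+3 :> R.
  by apply: mulr_gt0; [apply: mulr_gt0 => // | ]; rewrite !exprn_gt0.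
rewrite -(ler_pdivrMr _ _ z0); apply: le_trans _ main.
rewrite le_eqVlt; apply/orP; left; apply/eqP; rewrite /al /bmin exprVn expr_div_n.
by field; rewrite !expf_neq0 ?pnatr_eq0.
Qed.
End Main.

Lemma many_solutions_ring (m H : nat) : (m.+4 <= H)%N -> exists C0 : nat,
  forall (R : realType) (G : finComNzRingType) (e : G -> R[i]) (a q : 'I_m.+4 -> int) (P : int),
  additive_char e -> \sum_i a i = 0 -> (forall i, a i * q i = P) ->
  (forall i, injective (fun b : G => (q i)%:~R * b)) -> (forall i, (`|q i| <= H)%N) ->
  forall (L : nat) (A : {set G}), (0 < L)%N -> (#|G| * 2 <= #|A| * 2 ^ L)%N ->
  (#|G| ^ m.+3 <= nsol_ring a A * 2 ^ (C0 * L ^ 7))%N.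
Proof.
move=> mH; have [X hX] := par_W_le m; have [c [c0 hc]] := exists_par_c m H.
exists (4 + m.+4 + X * c * m.+3)%N => R G e a q P He Ha Hq Hinj HH L A L0 hA.
apply: leq_trans (many_solutions_of_params He Ha Hq Hinj HH mH L0 (hc L L0) hA) _.
rewrite leq_mul2l leq_exp2l //; apply/orP; right.
rewrite !mulnDl; apply: leq_add; first apply: leq_add.
- by rewrite leq_pmulr // expn_gt0 L0.
- by rewrite mulnC leq_mul2l -[X in (X <= _)%N]expn1 leq_pexp2l.
- by rewrite mulnAC leq_mul2r hX ?orbT.
Qed.

(** * From the integers to Z/M *)

Lemma exists_primitive_root (R : rcfType) n : (0 < n)%N -> exists z : R[i], n.-primitive_root z.
Proof.
move=> n0; have [r] := closed_field_poly_normal ('X^n - 1 : {poly R[i]}).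
rewrite (monicP (monicXnsubC _ n0)) scale1r => E.
have all_r : all n.-unity_root r by apply/allP => z; rewrite -root_prod_XsubC -E.
have size_r : (n <= size r)%N by rewrite -ltnS -(size_prod_XsubC r id) -E size_XnsubC.
suff ur : uniq r by have /hasP [z _ pz] := has_prim_root n0 all_r ur size_r; exists z.
by rewrite -separable_prod_XsubC -E separable_Xn_sub_1 // pnatr_eq0 -lt0n.
Qed.

Lemma exists_additive_char (R : realType) (M : nat) : (1 < M)%N ->
  exists e : 'Z_M -> R[i], additive_char e.
Proof.
move=> M1; have [z pz] := exists_primitive_root R (ltnW M1).
have zM : z ^+ M = 1 by apply: prim_expr_order.
pose e (x : 'Z_M) := z ^+ x.
have eD x y : e (x + y) = e x * e y.
  rewrite /e -exprD /= -[in RHS](expr_mod _ zM); congr (_ ^+ (_ %% _)).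
  exact: Zp_cast.
exists e; split => //.
  move=> x; have h : cabs (e x) ^+ M = 1.
    by rewrite -cabsX /e -exprM mulnC exprM zM expr1n cabs1.
  by apply/eqP; rewrite -(@pexpr_eq1 _ _ M) ?cabs_ge0 ?h // ltnW.
move=> x; have [->|x0] := eqVneq x 0.
  rewrite (eq_bigr (fun=> 1)) => [|r _]; last by rewrite mulr0 /e.
  by rewrite sumr_const.
set T := \sum_r _; have hT : (e x - 1) * T = 0.
  rewrite mulrBl mul1r [in X in _ - X]/T (reindex_inj (addrI 1)) /= mulr_sumr -sumrB big1 // => r _.
  (* Shifting the summation variable by 1 multiplies the sum by [e x], so the sum vanishes unless
     [e x = 1]. *)
  by rewrite mulrDl mul1r eD subrr.
move/eqP: hT; rewrite mulf_eq0 => /orP[|/eqP //].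
rewrite subr_eq0 /e -(prim_order_dvd pz) => h; case/negP: x0.
have xM : (x < M)%N by have := ltn_ord x; rewrite [X in (_ < X)%N]Zp_cast.
apply/eqP/val_inj => /=; apply/eqP; rewrite -leqn0 leqNgt; apply/negP => x0.
by have := dvdn_leq x0 h; rewrite leqNgt xM.
Qed.

Lemma intr_Zp_eq0 (M : nat) (z : int) : (1 < M)%N -> (`|z| < M)%N ->
  z%:~R = 0 :> 'Z_M -> z = 0.
Proof.
move=> M1 zM h; apply/eqP; rewrite -absz_eq0; apply/eqP.
have : (`|z|%N%:R : 'Z_M) = 0.
  case: z zM h => n _ h //=; apply/eqP; rewrite -oppr_eq0; apply/eqP.
  by rewrite NegzE rmorphN /= in h.
by move/(congr1 val); rewrite /= val_Zp_nat // modn_small.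
Qed.

Section Transfer.
Variables (m : nat) (a : 'I_m.+4 -> int).
Hypotheses (a_neq0 : forall i, a i <> 0) (Ha : \sum_i a i = 0).

Let P : int := \prod_i a i.
Let q (i : 'I_m.+4) : int := \prod_(j | j != i) a j.
Let p := `|P|%N.
Let S := (\sum_i `|a i|)%N.

Let Hq i : a i * q i = P. Proof. by rewrite /q /P [RHS](bigD1 i). Qed.

Let p0 : (0 < p)%N.
Proof.
rewrite /p absz_gt0 /P; apply/prodf_neq0 => i _; exact/eqP.
Qed.

Let S0 : (1 < S)%N.
Proof.
have h i : (1 <= `|a i|)%N by rewrite absz_gt0; apply/eqP.
rewrite /S !big_ord_recl; have := h ord0; have := h (lift ord0 ord0); lia.
Qed.

(** The modulus [M = p * S * N + 1] does two things: [M = 1] modulo [p] makes every [q i]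
    invertible, and [M > S * N] prevents a combination of elements of [A] from vanishing modulo [M]
    without vanishing. It exceeds [N] only by a constant factor, hence [D]. *)
Lemma many_solutions_int : exists C0 D : nat, (0 < D)%N /\
  forall (N : nat) (A : {set 'I_N.+1}) (L : nat),
  (0 < N)%N -> (0 < L)%N -> (D * N <= #|A| * 2 ^ L)%N ->
  (N ^ m.+3 <= nsol a A * 2 ^ (C0 * L ^ 7))%N.
Proof.
pose H := (m.+4 + \sum_i `|q i|)%N.
have [C0 hC0] := many_solutions_ring (leq_addr (\sum_i `|q i|)%N m.+4).
exists C0, (4 * p * S)%N; split; first by rewrite !muln_gt0 p0 (ltnW S0).
move=> N A L N0 L0 hA.
pose M := (p * S * N).+1.
have M1 : (1 < M)%N by rewrite ltnS !muln_gt0 p0 N0 (ltnW S0).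
have SNM : (S * N < M)%N by rewrite ltnS -mulnA leq_pmull.
have NM : (N < M)%N by apply: leq_ltn_trans SNM; rewrite leq_pmull // ltnW.
have [e He] := exists_additive_char Rdefinitions.R M1.
have cardG : #|('Z_M : finComNzRingType)| = M by rewrite card_ord Zp_cast.
(* Thus [p] is invertible in ['Z_M], and so is each [q i], which divides [P = a i * q i]. *)
have aq : (p * (S * N))%:R = -1 :> 'Z_M.
  by apply/eqP; rewrite -subr_eq0 opprK natr1 mulnA pchar_Zp.
have Pp : p%:R = (sgz P * P)%:~R :> 'Z_M by rewrite -abszEsg.
have Hinj i : injective (fun b : 'Z_M => (q i)%:~R * b).
  move=> b b' E; apply: oppr_inj; rewrite -[- b]mulN1r -[- b']mulN1r -aq natrM Pp.
  rewrite -(Hq i) mulrC [RHS]mulrC !rmorphM /= [_ * (q i)%:~R]mulrC !mulrA.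
  have E' : (q i)%:~R * b = (q i)%:~R * b' by exact: E.
  transitivity ((S%:R * N%:R * (sgz (a i * q i))%:~R * (a i)%:~R) * ((q i)%:~R * b)); first by ring.
  by rewrite E'; ring.
have HH i : (`|q i| <= H)%N by rewrite /H (bigD1 i) //= addnCA leq_addr.
pose f (x : 'I_N.+1) : 'Z_M := (x : nat)%:R.
have fval x : val (f x) = x.
  rewrite /f /= val_Zp_nat // modn_small //; apply: leq_ltn_trans NM.
  by rewrite -ltnS ltn_ord.
have finj : injective f by move=> x y E; apply/val_inj; rewrite /= -!fval E.
pose AG : {set 'Z_M} := f @: A.
have dG : (#|('Z_M : finComNzRingType)| * 2 <= #|AG| * 2 ^ L)%N.
  rewrite cardG card_imset //; apply: leq_trans hA.
  have : (0 < p * S * N)%N by rewrite !muln_gt0 p0 N0 (ltnW S0).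
  by rewrite /M -!mulnA; move: (p * _)%N => y; lia.
have main := hC0 Rdefinitions.R 'Z_M e a q P He Ha Hq Hinj HH L AG L0 dG.
rewrite cardG in main.
apply: leq_trans (_ : M ^ m.+3 <= _)%N; first by rewrite leq_exp2r // ltnW.
apply: leq_trans main _; rewrite leq_mul2r; apply/orP; right.
pose g (x : {ffun 'I_m.+4 -> 'I_N.+1}) : {ffun 'I_m.+4 -> 'Z_M} := [ffun i => f (x i)].
rewrite /nsol_ring /nsol.
apply: leq_trans (leq_imset_card g _); apply: subset_leq_card; apply/subsetP => y.
rewrite in_set => /andP[/forallP yA /eqP ys].
pose x : {ffun 'I_m.+4 -> 'I_N.+1} := [ffun i => inord (val (y i))].
have xE i : x i \in A /\ f (x i) = y i.
  have /imsetP [w wA E] := yA i.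
  have -> : x i = w by rewrite ffunE E fval inord_val.
  by rewrite E.
apply/imsetP; exists x; last by apply/ffunP => i; rewrite ffunE; case: (xE i) => _ ->.
rewrite in_set; apply/andP; split; first by apply/forallP => i; case: (xE i).
apply/eqP; apply: (@intr_Zp_eq0 M) => //.
  apply: leq_ltn_trans SNM; rewrite /S big_distrl /=.
  apply: (@leq_trans (\sum_i `|(a i * Posz (x i))%R|)%N).
    elim/big_rec2: _ => [|i u v _ IH] //.
    have h : (`|(a i * Posz (x i) + v)%R| <= `|(a i * Posz (x i))%R| + `|v|)%N.
      by rewrite -lez_nat PoszD !abszE ler_normD.
    by apply: leq_trans h _; rewrite leq_add2l.
  by apply: leq_sum => i _; rewrite abszM leq_mul // absz_nat -ltnS ltn_ord.
rewrite rmorph_sum -[RHS]ys; apply: eq_bigr => i _.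
by rewrite rmorphM /=; case: (xE i) => _ <-.
Qed.
End Transfer.

(* Passage to real logarithms *)
Local Close Scope ring_scope.
From Stdlib Require Import Reals Lra.

Section LogScale.
Import ssrnat.

(** [L] is one more than the integer logarithm of [D * N / a]; this overshoot of at most one factor
    2 is the 2 in [ln (2 / alpha)]. *)
Lemma log_scale (D N a : nat) : (0 < D)%N -> (0 < a)%N -> (a <= N)%N ->
  exists L : nat, [/\ (0 < L)%N, (D * N <= a * 2 ^ L)%N &
    (INR L * ln 2 <= ln (INR D) + ln (2 / (INR a / INR N)))%R].
Proof.
move=> D0 a0 aN; have N0 : (0 < N)%N by apply: leq_trans aN.
pose n := ((D * N) %/ a)%N.
have n0 : (0 < n)%N by rewrite divn_gt0 // (leq_trans aN) // leq_pmull.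
have /andP[h1 h2] := trunc_log_bounds (isT : (1 < 2)%N) n0.
exists (trunc_log 2 n).+1; split => //.
  rewrite [X in (_ <= X)%N]mulnC; apply: leq_trans (ltnW (ltn_ceil (D * N) a0)) _.
  by apply: leq_mul => //; exact: h2.
have posR x : (0 < x)%N -> (0 < INR x)%R by move=> /ltP h; apply: lt_0_INR.
have D0' := posR _ D0; have a0' := posR _ a0; have N0' := posR _ N0.
set t := trunc_log 2 n in h1 *.
have h3 : (2 ^ t * a <= D * N)%N by apply: leq_trans (leq_divM (D * N) a); rewrite leq_mul2r h1 orbT.
have {h3} h4 : (2 ^ t * INR a <= INR D * INR N)%R.
  have -> : (2 ^ t = INR (2 ^ t)%N)%R by rewrite -[2%R]/(INR 2) -pow_INR; congr INR; elim: (t) => //= u ->; rewrite expnS.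
  by rewrite -!mult_INR; apply: le_INR; apply/leP.
have p2 : (0 < 2 ^ t)%R by apply: pow_lt; Lra.lra.
have q0 : (0 < 2 / (INR a / INR N))%R.
  by apply: Rdiv_lt_0_compat; [Lra.lra | apply: Rdiv_lt_0_compat].
have l2 : (INR t * ln 2 = ln (2 ^ t))%R by rewrite ln_pow //; Lra.lra.
rewrite S_INR Rmult_plus_distr_r Rmult_1_l l2 -ln_mult //; last Lra.lra.
rewrite -ln_mult //.
have : (2 ^ t * 2 <= INR D * (2 / (INR a / INR N)))%R.
  have -> : (INR D * (2 / (INR a / INR N)) = (INR D * INR N) * 2 / INR a)%R by field; Lra.lra.
  apply: (Rmult_le_reg_r (INR a)) => //.
  have -> : ((INR D * INR N) * 2 / INR a * INR a = (INR D * INR N) * 2)%R by field; Lra.lra.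
  Lra.lra.
case=> [h|->]; last exact: Rle_refl.
by left; apply: ln_increasing => //; Lra.lra.
Qed.

End LogScale.

Theorem theorem3 (k : nat) (a : 'I_k -> int)
  (Hk : (4 <= k)%N) (Hinv : invariant_eq a) (Hnz : forall i, a i <> GRing.zero) :
  exists C : R, (0 < C)%R /\
    forall (N : nat) (A : {set 'I_N.+1}),
      subset_1N A -> (0 < #|A|)%N ->
      let alpha := (INR #|A| / INR N)%R in
      (exp (- C * (ln (2 / alpha)) ^ 7) * INR N ^ (k - 1) <= INR (nsol a A))%R.
Proof.
case: k a Hk Hinv Hnz => [|[|[|[|m]]]] // a _ Ha a_neq0.
have [C0 [D [D0 main]]] := many_solutions_int a_neq0 (esym Ha).
have ln2 : (0 < ln 2)%R by rewrite -ln_1; apply: ln_increasing; Lra.lra.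
have D1 : (1 <= INR D)%R by rewrite -[1%R]/(INR 1); apply: le_INR; apply/ssrnat.leP.
have lnD : (0 <= ln (INR D))%R.
  by rewrite -ln_1; case: D1 => [h|<-]; [left; apply: ln_increasing; Lra.lra | right].
(* As [x = ln (2 / alpha) >= ln 2], the constant [ln D] is at most [ln D / ln 2 * x]; hence
   [L * ln 2 <= ln D + x] gives [L <= B * x]. *)
pose B := ((ln (INR D) / ln 2 + 1) / ln 2)%R.
have B0 : (0 <= B)%R.
  apply: Rlt_le; apply: Rdiv_lt_0_compat => //.
  have : (0 <= ln (INR D) / ln 2)%R by apply: Rle_mult_inv_pos.
  Lra.lra.
(* The summand 1 keeps the constant positive and only contributes the factor [exp (- x ^ 7) <= 1] at
   the end. *)
exists (INR C0 * B ^ 7 * ln 2 + 1)%R; split.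
  have : (0 <= INR C0 * B ^ 7 * ln 2)%R.
    by apply: Rmult_le_pos; [apply: Rmult_le_pos; [exact: pos_INR | exact: pow_le] | Lra.lra].
  Lra.lra.
move=> N A hA A0 alpha.
(* ['I_N.+1] has [N + 1] elements, and 0 is not in [A]; this gives [alpha <= 1]. *)
have AN : (#|A| <= N)%N.
  have sub : A \subset ~: [set ord0].
    by apply/subsetP => x xA; rewrite !inE; apply: contraL (hA x xA) => /eqP ->.
  by have := subset_leq_card sub; rewrite cardsC1 card_ord.
have N0 : (0 < N)%N by apply: leq_trans AN.
have [L [L0 hL hlog]] := log_scale D0 A0 AN.
have {}main := main N A L N0 L0 hL.
have N0' : (0 < INR N)%R by apply: lt_0_INR; apply/ssrnat.ltP.
have A0' : (0 < INR #|A|)%R by apply: lt_0_INR; apply/ssrnat.ltP.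
have AN' : (INR #|A| <= INR N)%R by apply: le_INR; apply/ssrnat.leP.
rewrite -/alpha in hlog; set x := ln (2 / alpha) in hlog *.
have a1 : (0 < alpha <= 1)%R.
  split; first exact: Rdiv_lt_0_compat.
  by apply: (Rmult_le_reg_r (INR N)) => //; rewrite /alpha; field_simplify; Lra.lra.
have x2 : (ln 2 <= x)%R.
  have : (2 <= 2 / alpha)%R.
    apply: (Rmult_le_reg_r alpha); first Lra.lra.
    have -> : (2 / alpha * alpha = 2)%R by field; Lra.lra.
    Lra.lra.
  by case=> [h|h]; [left; apply: ln_increasing; Lra.lra | right; rewrite /x -h].
have LB : (INR L <= B * x)%R.
  apply: (Rmult_le_reg_r (ln 2)) => //; apply: Rle_trans hlog _.
  have -> : (B * x * ln 2 = ln (INR D) / ln 2 * x + x)%R by rewrite /B; field; Lra.lra.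
  have h : (0 <= ln (INR D) / ln 2)%R by apply: Rle_mult_inv_pos.
  have : (ln (INR D) / ln 2 * ln 2 <= ln (INR D) / ln 2 * x)%R by apply: Rmult_le_compat_l.
  have -> : (ln (INR D) / ln 2 * ln 2 = ln (INR D))%R by field; Lra.lra.
  Lra.lra.
have powE (b u : nat) : INR (expn b u) = (INR b ^ u)%R.
  by elim: u => [|u IH] //=; rewrite expnS mult_INR IH.
rewrite subSS subn0.
have hmain : (INR N ^ m.+3 <= INR (nsol a A) * exp (INR C0 * B ^ 7 * ln 2 * x ^ 7))%R.
  apply: Rle_trans (_ : INR (nsol a A) * INR (expn 2 (muln C0 (expn L 7))) <= _)%R.
    by rewrite -powE -mult_INR; apply: le_INR; apply/ssrnat.leP.
  apply: Rmult_le_compat_l; first exact: pos_INR.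
  have -> : INR (expn 2 (muln C0 (expn L 7))) = exp (INR C0 * INR L ^ 7 * ln 2).
    rewrite powE -[INR 2]/(2%R) -Rpower_pow; last Lra.lra.
    by rewrite /Rpower mult_INR powE.
  have h7 : (INR L ^ 7 <= B ^ 7 * x ^ 7)%R.
    by rewrite -Rpow_mult_distr; apply: pow_incr; split; [exact: pos_INR | ].
  have h8 : (INR C0 * INR L ^ 7 * ln 2 <= INR C0 * B ^ 7 * ln 2 * x ^ 7)%R.
    have -> : (INR C0 * B ^ 7 * ln 2 * x ^ 7 = INR C0 * (B ^ 7 * x ^ 7) * ln 2)%R by ring.
    apply: Rmult_le_compat_r; first Lra.lra.
    by apply: Rmult_le_compat_l => //; exact: pos_INR.
  by case: h8 => [h|->]; [left; apply: exp_increasing | right].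
apply: Rle_trans (Rmult_le_compat_l _ _ _ (Rlt_le _ _ (exp_pos _)) hmain) _.
rewrite Rmult_comm Rmult_assoc -exp_plus.
rewrite -[X in (_ <= X)%R]Rmult_1_r; apply: Rmult_le_compat_l; first exact: pos_INR.
have x7 : (0 <= x ^ 7)%R by apply: pow_le; Lra.lra.
have -> : (INR C0 * B ^ 7 * ln 2 * x ^ 7 + - (INR C0 * B ^ 7 * ln 2 + 1) * x ^ 7 = - x ^ 7)%R by ring.
rewrite -exp_0; case: x7 => [h|<-]; last by right; congr exp; ring.
by left; apply: exp_increasing; Lra.lra.
Qed.
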